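(* Every $7$-dimensional abstract core $\mathfrak m=\bigoplus\mathfrak m^p$ of type (B) and $\operatorname{sgn}(\mathfrak J)=(2,0)$ is of the form $$\mathfrak m^p=0\ \text{ for all } p\ne-2,-1,0,\qquad \mathfrak m^{-2}=\mathfrak c^{-2}=\langle e^{-2}\rangle,\qquad \mathfrak m^{-1}=\mathfrak c^{-1}=\langle e_1,e_2,e_3,e_4\rangle,\qquad \mathfrak m^0=\operatorname{Re}(\mathfrak m^{0(10)}\oplus\overline{\mathfrak m^{0(10)}})$$ and is isomorphic with one and only one of the canonical forms $\mathfrak m_t$, $t\in[0,1]$, of this shape, where $$\mathfrak m_t^{0(10)}=\big\langle (1+t)\,e_1^{10}\odot e_1^{10}+(1-t)\,e_2^{10}\odot e_2^{10}\big\rangle_{\mathbb C}.$$ Any $7$-dimensional and strongly regular CR manifold $(M,\mathcal D,\mathcal J)$ of type $\mathfrak m_t$ is $2$-nondegenerate, and it is not (even locally) CR diffeomorphic to any other $(M',\mathcal D',\mathcal J')$ of type $\mathfrak m_{t'}$ if $t\ne t'$.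
   Context: **CR manifolds.** A CR structure on a manifold $M$ is a pair $(\mathcal D,\mathcal J)$, with $\mathcal D\subset TM$ an even rank distribution and $\mathcal J$ a smooth family of complex structures on the fibres of $\mathcal D$ such that the $+i$-eigenbundle $\mathcal D^{10}\subset\mathcal D\otimes\mathbb C$ is involutive; $\mathcal D^{01}=\overline{\mathcal D^{10}}$. Underlining denotes spaces of sections. Tanaka sequence: $\underline{\mathcal D}_{-1}=\underline{\mathcal D}$, $\underline{\mathcal D}_{p}=\underline{\mathcal D}_{p+1}+[\underline{\mathcal D}_{-1},\underline{\mathcal D}_{p+1}]$ for $p\le -2$. Freeman sequence: $\underline{\mathcal F}^{10}_{-1}=\underline{\mathcal D}^{10}$ and, for $p\ge0$, $\underline{\mathcal F}^{10}_{p}=\{X\in\underline{\mathcal F}^{10}_{p-1}: [X,\underline{\mathcal D}^{01}]=0 \bmod \underline{\mathcal F}^{10}_{p-1}\oplus\underline{\mathcal D}^{01}\}$; $\underline{\mathcal F}_p=\underline{\mathcal F}_p^{10}\oplus\overline{\underline{\mathcal F}_p^{10}}$. All CR manifolds are assumed regular: these modules are the sections of distributions $\mathcal D_p$, $\mathcal F^{10}_p$, and $\mathcal D_{-\mu}=TM$ for some positive integer $\mu$. $M$ is $k$-nondegenerate if $\mathcal F_p\ne0$ for $-1\le p\le k-2$ and $\mathcal F_{k-1}=0$. **Abstract cores.** Hats denote complexification. An abstract core is a finite-dimensional $\mathbb Z$-graded real vector space $\mathfrak m=\bigoplus\mathfrak m^p$ with (i) a grading-preserving complex structure $J$ on $\bigoplus_{p\ge-1}\mathfrak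 m^p$ (write $\widehat{\mathfrak m}^p=\mathfrak m^{p(10)}\oplus\mathfrak m^{p(01)}$ for the $\pm i$-eigenspaces); (ii) a graded Lie bracket on $\mathfrak m_-=\bigoplus_{p<0}\mathfrak m^p$ with $[Jv,Jw]=[v,w]$ for $v,w\in\mathfrak m^{-1}$, fundamental (generated by $\mathfrak m^{-1}$) and nondegenerate ($v\in\mathfrak m^{-1}$, $[v,\mathfrak m^{-1}]=0$ imply $v=0$); (iii) for each $p\ge0$ an injective $\mathbb C$-linear map $L^{p+2}:\mathfrak m^{p(10)}\to\big(\mathfrak m^{p-1(10)}\otimes(\mathfrak m^{-1(01)})^*\big)\cap\big(\widehat{\mathfrak m}^{-2}\otimes S^{p+2}(\mathfrak m^{-1(01)})^*\big)$, where $\mathfrak m^{-1(10)}$ is regarded as a space of maps $\mathfrak m^{-1(01)}\to\widehat{\mathfrak m}^{-2}$ via the bracket (ii). Isomorphisms are graded linear isomorphisms commuting with $J$, the bracket on $\mathfrak m_-$ and the maps $L^{p+2}$. The core of $M$ at $x$ is $\mathfrak m_x=\bigoplus\mathfrak m_x^p$ with $\mathfrak m_x^p=\mathcal D_p|_x/\mathcal D_{p+1}|_x$ for $p\le-2$ and $\mathfrak m_x^p=\operatorname{Re}(\mathcal F_p)|_x/\operatorname{Re}(\mathcal F_{p+1})|_x$ for $p\ge-1$, with $J$ induced by $\mathcal J$ and brackets and $L^{p+2}$ induced by commutators of vector fields. $M$ is strongly regular of type $\mathfrak m$ if $\mathfrak m_x\simeq\mathfrak m$ for all $x\in M$. A $7$-dimensional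 abstract core is of type (B) if $\dim_{\mathbb R}\mathfrak m^{-2}=1$, $\mathfrak m^{-1}\simeq\mathbb C^2$, $\mathfrak m^0\simeq\mathbb C$ and $\mathfrak m^p=0$ otherwise. **Realization.** Let $\mathfrak c_-=\mathfrak c^{-2}\oplus\mathfrak c^{-1}$ be the Heisenberg algebra with $\mathfrak c^{-2}=\langle e^{-2}\rangle$, $\dim\mathfrak c^{-1}=4$, $[v,w]=B(v,w)e^{-2}$, $B$ symplectic, and $\mathfrak J\in\mathfrak{sp}(\mathfrak c^{-1},B)$ a complex structure on $\mathfrak c^{-1}$. Its signature is $(r,s)$ if the symmetric form $B(\mathfrak Jv,w)$ has real signature $(2r,2s)$. For $\operatorname{sgn}(\mathfrak J)=(2,0)$, $\{e_1,\dots,e_4\}$ denotes a complex-symplectic basis of $\mathfrak c^{-1}$: $B(e_i,e_{i+2})=-B(e_{i+2},e_i)=1$ and $\mathfrak J(e_i)=-e_{i+2}$, $\mathfrak J(e_{i+2})=e_i$ for $i=1,2$, all other $B(e_i,e_j)=0$. Put $e_j^{10}=\frac12(e_j-i\mathfrak Je_j)$, $e_j^{01}=\overline{e_j^{10}}$; $\mathfrak c^{-1(10)}$ and $\mathfrak c^{-1(01)}$ are the $\pm i$-eigenspaces of $\mathfrak J$ on $\widehat{\mathfrak c}^{-1}$. Identify $\mathfrak{sp}(\widehat{\mathfrak c}^{-1})\simeq S^2(\widehat{\mathfrak c}^{-1})$ by $[v_1\odot v_2,w]=v_1B(v_2,w)+v_2B(v_1,w)$. Cores of type (B) are realized (up to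 isomorphism) with $\mathfrak m^{-2}=\mathfrak c^{-2}$, $\mathfrak m^{-1}=\mathfrak c^{-1}$, $J=\mathfrak J$ on $\mathfrak m^{-1}$, and $\mathfrak m^{0(10)}$ a complex line in $S^2(\mathfrak c^{-1(10)})$, $J$ being multiplication by $i$ on $\mathfrak m^{0(10)}$ and $L^2(v)(w)=[v,w]\in\mathfrak c^{-1(10)}$ for $v\in\mathfrak m^{0(10)}$, $w\in\mathfrak c^{-1(01)}$. *)

(* Defs.v *)
From HB Require Import structures.
From mathcomp Require Import all_boot all_order all_algebra.
From mathcomp Require Import all_classical all_reals all_analysis.
From mathcomp Require Import complex.

Set Implicit Arguments.
Unset Strict Implicit.
Unset Printing Implicit Defensive.

Import Order.TTheory GRing.Theory Num.Theory.
Import numFieldNormedType.Exports.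

Local Open Scope classical_set_scope.
Local Open Scope ring_scope.

(* The pair (a, b) stands for a + i b. *)
Definition cx (R : rcfType) (V : lmodType R) : Type := (V * V)%type.

HB.instance Definition _ (R : rcfType) (V : lmodType R) :=
  GRing.Zmodule.copy (cx V) (V * V)%type.

Definition cx_scale (R : rcfType) (V : lmodType R) (c : R[i]) (z : cx V) : cx V :=
  let: Complex x y := c in (x *: z.1 - y *: z.2, x *: z.2 + y *: z.1).

Lemma cx_scaleA (R : rcfType) (V : lmodType R) (a b : R[i]) (z : cx V) :
  cx_scale a (cx_scale b z) = cx_scale (a * b) z.
Proof.
case: a b z => [a a'] [b b'] [u v].
rewrite /cx_scale /=; congr pair.
- rewrite scalerBr scalerDr scalerBl scalerDl !scalerA !opprD.
  by rewrite [X in _ + X]addrC addrACA.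
- rewrite scalerBr scalerDr scalerBl scalerDl !scalerA.
  by rewrite [X in _ + X]addrC addrACA.
Qed.

Lemma cx_scale1 (R : rcfType) (V : lmodType R) : left_id 1 (@cx_scale R V).
Proof. by case=> u v; rewrite /cx_scale /= !scale1r !scale0r subr0 addr0. Qed.

Lemma cx_scaleDr (R : rcfType) (V : lmodType R) :
  right_distributive (@cx_scale R V) +%R.
Proof.
case=> a a' [u v] [u' v']; rewrite /cx_scale /=; congr pair => /=.
- by rewrite !scalerDr opprD addrACA.
- by rewrite !scalerDr addrACA.
Qed.

Lemma cx_scaleDl (R : rcfType) (V : lmodType R) (z : cx V) :
  {morph (fun c => cx_scale c z) : a b / a + b}.
Proof.
case: z => u v [a a'] [b b']; rewrite /cx_scale /=; congr pair => /=.
- by rewrite !scalerDl opprD addrACA.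
- by rewrite !scalerDl addrACA.
Qed.

HB.instance Definition _ (R : rcfType) (V : lmodType R) :=
  GRing.Zmodule_isLmodule.Build R[i] (cx V)
    (@cx_scaleA R V) (@cx_scale1 R V) (@cx_scaleDr R V) (@cx_scaleDl R V).

Definition imag {R : rcfType} : R[i] := Complex 0 1.

Definition cx_conj (R : rcfType) (V : lmodType R) (z : cx V) : cx V := (z.1, - z.2).

Definition cx_map (R : rcfType) (V W : lmodType R) (f : V -> W) (z : cx V) : cx W :=
  (f z.1, f z.2).

Definition cx_bil (R : rcfType) (U V W : lmodType R) (f : U -> V -> W)
    (z : cx U) (w : cx V) : cx W :=
  (f z.1 w.1 - f z.2 w.2, f z.1 w.2 + f z.2 w.1).

(* The space m is the (direct) sum of the subspaces [gr p] of an ambient space.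
   The values of the structure maps outside their domain of definition
   ([cJ] on the m^p with p >= -1, [cbr] on m_-, [cL p], which is L^{p+2},
   on m^{p(10)} x m^{-1(01)}) are irrelevant. *)
Record coreData (R : rcfType) := CoreData {
  amb : vectType R;
  gr : int -> {vspace amb};
  cJ : amb -> amb;
  cbr : amb -> amb -> amb;
  cL : nat -> cx amb -> cx amb -> cx amb
}.

Definition m10 (R : rcfType) (m : coreData R) (p : int) (z : cx (amb m)) : Prop :=
  [/\ z.1 \in gr m p, z.2 \in gr m p & cx_map (@cJ R m) z = imag *: z].

Definition m01 (R : rcfType) (m : coreData R) (p : int) (z : cx (amb m)) : Prop :=
  [/\ z.1 \in gr m p, z.2 \in gr m p & cx_map (@cJ R m) z = - imag *: z].

(* v in m^{k-1(10)} seen as a map of k + 1 arguments in m^{-1(01)}, with values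
   in the complexification of m^{-2}. *)
Fixpoint core_form (R : rcfType) (m : coreData R) (k : nat) (v : cx (amb m))
    (ws : seq (cx (amb m))) : cx (amb m) :=
  match k, ws with
  | 0%N, w :: _ => cx_bil (@cbr R m) v w
  | k'.+1, w :: ws' => core_form k' (cL k' v w) ws'
  | _, [::] => 0
  end.

Record abstract_core (R : rcfType) (m : coreData R) : Prop := {
  core_finite : exists N : nat, forall p : int, N%:Z < `|p| -> gr m p = 0%VS;
  core_direct : forall N : nat,
    directv (\sum_(i < N.*2.+1) gr m (i%:Z - N%:Z));
  core_J_linear : forall (p : int) (a : R) (u v : amb m), -1 <= p ->
    u \in gr m p -> v \in gr m p -> cJ (a *: u + v) = a *: cJ u + cJ v;
  core_J_graded : forall (p : int) (v : amb m), -1 <= p ->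
    v \in gr m p -> cJ v \in gr m p;
  core_J_square : forall (p : int) (v : amb m), -1 <= p ->
    v \in gr m p -> cJ (cJ v) = - v;
  core_br_linearl : forall (a : R) (u v w : amb m),
    cbr (a *: u + v) w = a *: cbr u w + cbr v w;
  core_br_linearr : forall (a : R) (u v w : amb m),
    cbr w (a *: u + v) = a *: cbr w u + cbr w v;
  core_br_graded : forall (p q : int) (u v : amb m), p < 0 -> q < 0 ->
    u \in gr m p -> v \in gr m q -> cbr u v \in gr m (p + q);
  core_br_anti : forall (p q : int) (u v : amb m), p < 0 -> q < 0 ->
    u \in gr m p -> v \in gr m q -> cbr u v = - cbr v u;
  core_br_jacobi : forall (p q r : int) (u v w : amb m), p < 0 -> q < 0 -> r < 0 ->
    u \in gr m p -> v \in gr m q -> w \in gr m r ->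
    cbr u (cbr v w) + cbr v (cbr w u) + cbr w (cbr u v) = 0;
  core_br_J : forall v w : amb m, v \in gr m (-1) -> w \in gr m (-1) ->
    cbr (cJ v) (cJ w) = cbr v w;
  core_fundamental : forall W : {vspace amb m}, (gr m (-1)%R <= W)%VS ->
    (forall u v, u \in W -> v \in W -> cbr u v \in W) ->
    forall p : int, p < 0 -> (gr m p <= W)%VS;
  core_nondegenerate : forall v : amb m, v \in gr m (-1) ->
    (forall w, w \in gr m (-1) -> cbr v w = 0) -> v = 0;
  core_L_linearl : forall (p : nat) (a : R[i]) (u v w : cx (amb m)),
    m10 p%:Z u -> m10 p%:Z v -> m01 (-1) w ->
    cL p (a *: u + v) w = a *: cL p u w + cL p v w;
  core_L_linearr : forall (p : nat) (a : R[i]) (u v w : cx (amb m)),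
    m10 p%:Z w -> m01 (-1) u -> m01 (-1) v ->
    cL p w (a *: u + v) = a *: cL p w u + cL p w v;
  core_L_target : forall (p : nat) (v w : cx (amb m)),
    m10 p%:Z v -> m01 (-1) w -> m10 (p%:Z - 1) (cL p v w);
  core_L_sym : forall (p : nat) (v : cx (amb m)) (ws ws' : seq (cx (amb m))),
    m10 p%:Z v -> (forall w, w \in ws -> m01 (-1) w) -> size ws = p.+2 ->
    perm_eq ws ws' -> core_form p.+1 v ws = core_form p.+1 v ws';
  core_L_inj : forall (p : nat) (v : cx (amb m)), m10 p%:Z v ->
    (forall w, m01 (-1) w -> cL p v w = 0) -> v = 0
}.

Definition core_dim (R : rcfType) (m : coreData R) (d : nat) : Prop :=
  exists2 N : nat, (forall p : int, N%:Z < `|p| -> gr m p = 0%VS) &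
    \dim (\sum_(i < N.*2.+1) gr m (i%:Z - N%:Z))%VS = d.

Definition core_iso (R : rcfType) (m m' : coreData R) : Prop :=
  exists f : 'Hom(amb m, amb m'),
  [/\ forall p : int, (f @: gr m p)%VS = gr m' p,
      forall (p : int) (v : amb m), v \in gr m p -> f v = 0 -> v = 0,
      forall (p : int) (v : amb m), -1 <= p -> v \in gr m p -> f (cJ v) = cJ (f v),
      forall (p q : int) (v w : amb m), p < 0 -> q < 0 ->
        v \in gr m p -> w \in gr m q -> f (cbr v w) = cbr (f v) (f w)
    & forall (p : nat) (v w : cx (amb m)), m10 p%:Z v -> m01 (-1) w ->
        cx_map f (cL p v w) = cL p (cx_map f v) (cx_map f w)].

(* The dimensions are real, so that m^{-1} = C^2 and m^0 = C. *)
Definition type_B (R : rcfType) (m : coreData R) : Prop :=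
  [/\ \dim (gr m (-2)) = 1%N, \dim (gr m (-1)) = 4%N, \dim (gr m 0) = 2%N
    & forall p : int, p != -2 -> p != -1 -> p != 0 -> gr m p = 0%VS].

Definition has_signature (R : rcfType) (V : vectType R) (W : {vspace V})
    (b : V -> V -> R) (r s : nat) : Prop :=
  exists P N : {vspace V},
  [/\ (P + N)%VS = W, directv (P + N), \dim P = r & \dim N = s] /\
  [/\ forall v, v \in P -> v != 0 -> 0 < b v v,
      forall v, v \in N -> v != 0 -> b v v < 0
    & forall v w, v \in P -> w \in N -> b v w = 0 /\ b w v = 0].

(* sgn(J) = (r, s) for a core with one-dimensional m^{-2}: the form B is defined
   by the choice of a generator e of m^{-2}. *)
Definition core_signature (R : rcfType) (m : coreData R) (r s : nat) : Prop :=
  exists (e : amb m) (B : amb m -> amb m -> R),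
  [/\ e != 0, gr m (-2) = <[e]>%VS,
      forall v w, v \in gr m (-1) -> w \in gr m (-1) -> cbr v w = B v w *: e
    & has_signature (gr m (-1)) (fun v w => B (cJ v) w) r.*2 s.*2].

(* c^{-1} is the space of columns 'cV_4, with the complex-symplectic basis
   e_1, ..., e_4 given by [sp_e 0], ..., [sp_e 3]. *)
Definition sp_e (R : rcfType) (j : 'I_4) : 'cV[R]_4 := delta_mx j 0.

(* [sp_form] is the matrix of B: B(e_i, e_{i+2}) = - B(e_{i+2}, e_i) = 1. *)
Definition sp_form (R : rcfType) : 'M[R]_4 :=
  \matrix_(i < 4, j < 4) ((j == i + 2 :> nat)%N%:R - (i == j + 2 :> nat)%N%:R).

Definition sp_B (R : rcfType) (v w : 'cV[R]_4) : R := (v^T *m sp_form R *m w) 0 0.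

(* J(e_i) = - e_{i+2}, J(e_{i+2}) = e_i. *)
Definition sp_J (R : rcfType) : 'M[R]_4 :=
  \matrix_(i < 4, j < 4) ((j == i + 2 :> nat)%N%:R - (i == j + 2 :> nat)%N%:R).

(* The endomorphism w |-> v1 B(v2, w) + v2 B(v1, w), as a matrix. *)
Definition sp_odot (R : rcfType) (v1 v2 : 'cV[R]_4) : 'M[R]_4 :=
  v1 *m v2^T *m sp_form R + v2 *m v1^T *m sp_form R.

Definition cx_odot (R : rcfType) : cx 'cV[R]_4 -> cx 'cV[R]_4 -> cx 'M[R]_4 :=
  cx_bil (@sp_odot R).

Definition e10 (R : rcfType) (j : 'I_4) : cx 'cV[R]_4 :=
  (2^-1 *: sp_e R j, - (2^-1 *: (sp_J R *m sp_e R j))).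

Definition c10 (R : rcfType) (z : cx 'cV[R]_4) : Prop :=
  cx_map (mulmx (sp_J R)) z = imag *: z.

Definition S2c10 (R : rcfType) (q : cx 'M[R]_4) : Prop :=
  exists2 s : seq (cx 'cV[R]_4 * cx 'cV[R]_4),
    forall x, x \in s -> c10 x.1 /\ c10 x.2
    & q = \sum_(x <- s) cx_odot x.1 x.2.

(* Ambient space c^{-2} + c^{-1} + gl(c^{-1}). *)
Definition ambB (R : rcfType) : vectType R := (R^o * 'cV[R]_4 * 'M[R]_4)%type.

Definition c2_in (R : rcfType) (x : R) : ambB R := (x : R^o, 0, 0).
Definition c1_in (R : rcfType) (v : 'cV[R]_4) : ambB R := (0, v, 0).
Definition m0_in (R : rcfType) (A : 'M[R]_4) : ambB R := (0, 0, A).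

(* Here m^{0(10)} is the complex line spanned by q. Its real mfd_points
   m^0 = Re(m^{0(10)} + conj m^{0(10)}) = { z + conj z | z in m^{0(10)} } are
   spanned by the real parts of q and i q. *)
Definition grB (R : rcfType) (q : cx 'M[R]_4) (p : int) : {vspace ambB R} :=
  if p == -2 then <[c2_in 1]>%VS
  else if p == -1 then <<[seq c1_in (sp_e R j) | j <- enum 'I_4]>>%VS
  else if p == 0 then <<[:: m0_in (fst q); m0_in (fst (imag *: q))]>>%VS
  else 0%VS.

(* On m^0 the complex structure is A |-> J o A: elements of S^2(c^{-1(10)}) have
   values in c^{-1(10)}, so this is multiplication by i on m^{0(10)} (and by - i
   on its conjugate). *)
Definition coreB (R : rcfType) (q : cx 'M[R]_4) : coreData R :=
  @CoreData R (ambB R) (grB q)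
    (fun u => (0, sp_J R *m u.1.2, sp_J R *m u.2))
    (fun u v => c2_in (sp_B u.1.2 v.1.2))
    (fun k => if k is 0%N then
                cx_bil (fun u v : ambB R => c1_in (u.2 *m v.1.2))
              else fun _ _ => 0).

Definition canon_gen (R : rcfType) (t : R) : cx 'M[R]_4 :=
  Complex (1 + t) 0 *: cx_odot (e10 R 0) (e10 R 0)
  + Complex (1 - t) 0 *: cx_odot (e10 R 1) (e10 R 1).

Definition canon_core (R : rcfType) (t : R) : coreData R := coreB (canon_gen t).

Fixpoint Ck (R : realType) (n : nat) (W : normedModType R) (k : nat)
    (U : set 'rV[R]_n) (f : 'rV[R]_n -> W) : Prop :=
  if k is k'.+1 then
    (forall x, U x -> differentiable f x) /\
    (forall v, Ck k' U (fun x => 'D_v f x))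
  else forall x, U x -> {for x, continuous f}.

Definition smooth_on (R : realType) (n : nat) (W : normedModType R)
    (U : set 'rV[R]_n) (f : 'rV[R]_n -> W) : Prop := forall k, Ck k U f.

(* Nonempty smooth manifold of dimension n. [chart_inv i] is the inverse of the chart
   [chart i : chart_dom i -> R^n]; both are total functions of which only the values on
   [chart_dom i] and on its image matter. *)
Record manifold (R : realType) (n : nat) := Manifold {
  mfd_points :> topologicalType;
  chart_index : Type;
  chart_dom : chart_index -> set mfd_points;
  chart : chart_index -> mfd_points -> 'rV[R]_n;
  chart_inv : chart_index -> 'rV[R]_n -> mfd_points;
  mfd_inhabited : [set: mfd_points] !=set0;
  mfd_hausdorff : hausdorff_space mfd_points;
  mfd_second_countable : @second_countable mfd_points;
  mfd_cover : forall x, exists i, chart_dom i x;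
  mfd_dom_open : forall i, open (chart_dom i);
  mfd_img_open : forall i, open (chart i @` chart_dom i);
  mfd_chartK : forall i x, chart_dom i x -> chart_inv i (chart i x) = x;
  mfd_chart_cont : forall i x, chart_dom i x -> {for x, continuous (chart i)};
  mfd_pinv_cont : forall i y, (chart i @` chart_dom i) y -> {for y, continuous (chart_inv i)};
  mfd_smooth : forall i j,
    smooth_on (chart i @` (chart_dom i `&` chart_dom j)) (chart j \o chart_inv i)
}.

Definition smooth_fun (R : realType) (n : nat) (M : manifold R n) (U : set M)
    (f : M -> R) : Prop :=
  forall i : chart_index M,
    smooth_on (W := R^o) (chart i @` (U `&` chart_dom i)) (f \o chart_inv i).

Definition smooth_near (R : realType) (n : nat) (M : manifold R n) (x : M)
    (f : M -> R) : Prop :=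
  exists U : set M, [/\ open U, U x & smooth_fun U f].

(* A tangent vector at x is a directional derivative at x in some chart, acting
   on the functions that are smooth near x; it is extended by 0 to all functions,
   so that vectors are equal when they agree on functions smooth near x. *)
Definition tvec (R : realType) (n : nat) (M : manifold R n) : lmodType R :=
  (M -> R) -> R^o.

Definition dirder (R : realType) (n : nat) (M : manifold R n) (x : M)
    (i : chart_index M) (xi : 'rV[R]_n) : tvec M :=
  fun f => if `[< smooth_near x f >]
           then 'D_xi (f \o chart_inv i : 'rV[R]_n -> R^o) (chart i x) else 0.

Definition tangent (R : realType) (n : nat) (M : manifold R n) (x : M)
    (v : tvec M) : Prop :=
  exists (i : chart_index M) (xi : 'rV[R]_n), chart_dom i x /\ v = dirder x i xi.

Definition apply_vf (R : realType) (n : nat) (M : manifold R n) (X : M -> tvec M)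
    (f : M -> R) : M -> R := fun x => X x f.

(* X restricts to a smooth vector field on the open set U. *)
Definition vfield_on (R : realType) (n : nat) (M : manifold R n) (U : set M)
    (X : M -> tvec M) : Prop :=
  (forall x, U x -> tangent x (X x)) /\
  (forall (O : set M) (f : M -> R), open O -> O `<=` U -> smooth_fun O f ->
     smooth_fun O (apply_vf X f)).

(* [X, Y] f = X (Y f) - Y (X f); as above, extended by 0. *)
Definition lie (R : realType) (n : nat) (M : manifold R n) (X Y : M -> tvec M) :
    M -> tvec M :=
  fun x f => if `[< smooth_near x f >]
             then X x (apply_vf Y f) - Y x (apply_vf X f) else 0.

Definition re_vf (R : realType) (n : nat) (M : manifold R n)
    (Z : M -> cx (tvec M)) : M -> tvec M := fun x => (Z x).1.
Definition im_vf (R : realType) (n : nat) (M : manifold R n)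
    (Z : M -> cx (tvec M)) : M -> tvec M := fun x => (Z x).2.

Definition cvfield_on (R : realType) (n : nat) (M : manifold R n) (U : set M)
    (Z : M -> cx (tvec M)) : Prop :=
  vfield_on U (re_vf Z) /\ vfield_on U (im_vf Z).

Definition clie (R : realType) (n : nat) (M : manifold R n)
    (Z W : M -> cx (tvec M)) : M -> cx (tvec M) :=
  fun x => (lie (re_vf Z) (re_vf W) x - lie (im_vf Z) (im_vf W) x,
            lie (re_vf Z) (im_vf W) x + lie (im_vf Z) (re_vf W) x).

(* The fibrewise subspaces E_x of T form a distribution of rank r over K; [sm U]
   is the predicate of smoothness over U of sections of T. It is used with
   T = [tvec M], K = R and with T = [cx (tvec M)], K = R[i]. *)
Definition distribution (K : fieldType) (M : topologicalType) (T : lmodType K)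
    (sm : set M -> (M -> T) -> Prop) (E : M -> set T) (r : nat) : Prop :=
  forall x : M, exists (U : set M) (X : 'I_r -> M -> T),
    [/\ open U, U x, forall i, sm U (X i)
      & forall y, U y ->
        (forall v, E y v <-> exists c : 'I_r -> K, v = \sum_(i < r) c i *: X i y) /\
        (forall c : 'I_r -> K, \sum_(i < r) c i *: X i y = 0 -> forall i, c i = 0)].

Definition sections (K : fieldType) (M : topologicalType) (T : lmodType K)
    (sm : set M -> (M -> T) -> Prop) (E : M -> set T) : set (M -> T) :=
  [set X | sm [set: M] X /\ forall x, E x (X x)].

(* The fibres spanned by a module of sections. *)
Definition fib (M T : Type) (S : set (M -> T)) (x : M) : set T :=
  [set X x | X in S].

Record crData (R : realType) (n : nat) (M : manifold R n) := CRData {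
  crD : M -> set (tvec M);
  crJ : M -> tvec M -> tvec M
}.

Definition D10 (R : realType) (n : nat) (M : manifold R n) (S : crData M) (x : M) :
    set (cx (tvec M)) :=
  [set z : cx (tvec M) | [/\ crD S x z.1, crD S x z.2 & cx_map (crJ S x) z = imag *: z]].

Definition D01 (R : realType) (n : nat) (M : manifold R n) (S : crData M) (x : M) :
    set (cx (tvec M)) := [set z : cx (tvec M) | D10 S x (cx_conj z)].

Definition sec10 (R : realType) (n : nat) (M : manifold R n) (S : crData M) :
    set (M -> cx (tvec M)) := sections (@cvfield_on R n M) (D10 S).

Definition sec01 (R : realType) (n : nat) (M : manifold R n) (S : crData M) :
    set (M -> cx (tvec M)) := sections (@cvfield_on R n M) (D01 S).

Record cr_structure (R : realType) (n : nat) (M : manifold R n) (S : crData M) :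
    Prop := {
  cr_distribution : exists r : nat, distribution (@vfield_on R n M) (crD S) r.*2;
  cr_J_stable : forall x v, crD S x v -> crD S x (crJ S x v);
  cr_J_linear : forall x (a : R) v w, crD S x v -> crD S x w ->
    crJ S x (a *: v + w) = a *: crJ S x v + crJ S x w;
  cr_J_square : forall x v, crD S x v -> crJ S x (crJ S x v) = - v;
  cr_J_smooth : forall (U : set M) (X : M -> tvec M), open U -> vfield_on U X ->
    (forall x, U x -> crD S x (X x)) -> vfield_on U (fun x => crJ S x (X x));
  cr_involutive : forall Z W, sec10 S Z -> sec10 S W -> sec10 S (clie Z W)
}.

(* [tanaka S k] is the module of the Tanaka sequence of index - (k + 1). *)
Fixpoint tanaka (R : realType) (n : nat) (M : manifold R n) (S : crData M)
    (k : nat) : set (M -> tvec M) :=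
  if k is k'.+1 then
    [set X | exists (X0 : M -> tvec M) (s : seq ((M -> tvec M) * (M -> tvec M))),
       [/\ tanaka S k' X0,
           forall YZ, YZ \in s ->
             sections (@vfield_on R n M) (crD S) YZ.1 /\ tanaka S k' YZ.2
         & X = X0 + \sum_(YZ <- s) lie YZ.1 YZ.2]]
  else sections (@vfield_on R n M) (crD S).

(* [freeman S k] is the module F^{10} of the Freeman sequence of index k - 1. *)
Fixpoint freeman (R : realType) (n : nat) (M : manifold R n) (S : crData M)
    (k : nat) : set (M -> cx (tvec M)) :=
  if k is k'.+1 then
    [set X | freeman S k' X /\
       forall Y, sec01 S Y -> exists A B,
         [/\ freeman S k' A, sec01 S B & clie X Y = A + B]]
  else sec10 S.

Record regular_CR (R : realType) (n : nat) (M : manifold R n) (S : crData M) :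
    Prop := {
  reg_cr : cr_structure S;
  reg_tanaka : forall k, (exists r,
      distribution (@vfield_on R n M) (fib (tanaka S k)) r) /\
    tanaka S k = sections (@vfield_on R n M) (fib (tanaka S k));
  reg_freeman : forall k, (exists r,
      distribution (@cvfield_on R n M) (fib (freeman S k)) r) /\
    freeman S k = sections (@cvfield_on R n M) (fib (freeman S k));
  reg_exhaust : exists mu : nat, forall x v, tangent x v -> fib (tanaka S mu) x v
}.

(* The condition on F_p = F_p^{10} + conj F_p^{10} is one on F_p^{10}. *)
Definition nondegenerate_CR (R : realType) (n : nat) (M : manifold R n)
    (S : crData M) (k : nat) : Prop :=
  (forall j, (j < k)%N -> exists2 X, freeman S j X & X <> 0) /\
  (forall X, freeman S k X -> X = 0).

(* The filtration of T_x M: [D_p] at x for p <= -1 and [Re(F_p)] at x for p >= 0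
   (recall that D_{-1} = D = Re(F_{-1})). The real vectors in F_p^{10} + conj F_p^{10}
   are the real parts of the elements of F_p^{10}. *)
Definition cr_filt (R : realType) (n : nat) (M : manifold R n) (S : crData M)
    (p : int) (x : M) : set (tvec M) :=
  match p with
  | Negz k => fib (tanaka S k) x
  | Posz k => [set z.1 | z in fib (freeman S k.+1) x]
  end.

(* [core_at S x m] : the core m_x of M at x is isomorphic to m. The isomorphism
   m_x^p = cr_filt p x / cr_filt (p + 1) x -> m^p is given by a linear map [pi p] on
   [cr_filt p x] with kernel [cr_filt (p + 1) x]; the last three conditions say
   that it intertwines the structure induced on m_x by crJ and by commutators of
   vector fields with the one of m. *)
Definition core_at (R : realType) (n : nat) (M : manifold R n) (S : crData M)
    (x : M) (m : coreData R) : Prop :=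
  exists pi : int -> tvec M -> amb m,
  [/\ forall p (a : R) v w, cr_filt S p x v -> cr_filt S p x w ->
        pi p (a *: v + w) = a *: pi p v + pi p w,
      forall p u, u \in gr m p <-> exists2 v, cr_filt S p x v & pi p v = u
    & forall p v, cr_filt S p x v -> (pi p v = 0 <-> cr_filt S (p + 1) x v)] /\
  [/\ forall p v, -1 <= p -> cr_filt S p x v -> pi p (crJ S x v) = cJ (pi p v),
      forall (k l : nat) (X Y : M -> tvec M), tanaka S k X -> tanaka S l Y ->
        pi (Negz k + Negz l) (lie X Y x) =
        cbr (pi (Negz k) (X x)) (pi (Negz l) (Y x))
    & forall (p : nat) (X Y A B : M -> cx (tvec M)),
        freeman S p.+1 X -> sec01 S Y -> freeman S p A -> sec01 S B ->
        clie X Y = A + B ->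
        cL p (cx_map (pi p%:Z) (X x)) (cx_map (pi (-1)) (Y x)) =
        cx_map (pi (p%:Z - 1)) (A x)].

Definition strongly_regular (R : realType) (n : nat) (M : manifold R n)
    (S : crData M) (m : coreData R) : Prop :=
  regular_CR S /\ forall x, core_at S x m.

Definition smooth_map (R : realType) (n n' : nat) (M : manifold R n)
    (M' : manifold R n') (U : set M) (phi : M -> M') : Prop :=
  (forall x, U x -> {for x, continuous phi}) /\
  (forall (O : set M') (f : M' -> R), open O -> smooth_fun O f ->
     smooth_fun (U `&` phi @^-1` O) (f \o phi)).

Definition tangent_map (R : realType) (n n' : nat) (M : manifold R n)
    (M' : manifold R n') (phi : M -> M') (v : tvec M) : tvec M' :=
  fun f => v (f \o phi).

(* phi restricts to a CR diffeomorphism from U onto U', with inverse psi. *)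
Definition cr_diffeo_on (R : realType) (n n' : nat) (M : manifold R n)
    (M' : manifold R n') (S : crData M) (S' : crData M') (U : set M) (U' : set M')
    (phi : M -> M') (psi : M' -> M) : Prop :=
  [/\ forall x, U x -> U' (phi x) /\ psi (phi x) = x,
      forall y, U' y -> U (psi y) /\ phi (psi y) = y,
      smooth_map U phi & smooth_map U' psi] /\
  forall x, U x ->
    [set tangent_map phi v | v in crD S x] = crD S' (phi x) /\
    (forall v, crD S x v ->
       tangent_map phi (crJ S x v) = crJ S' (phi x) (tangent_map phi v)).

Definition locally_cr_diffeo (R : realType) (n n' : nat) (M : manifold R n)
    (M' : manifold R n') (S : crData M) (S' : crData M') : Prop :=
  exists (U : set M) (U' : set M') (phi : M -> M') (psi : M' -> M),
    [/\ open U, open U', U !=set0 & cr_diffeo_on S S' U U' phi psi].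

(* Main.v *)
(* Algebra: with zeta_j = y_j + i y_{j+2} the bracket L^2 turns a generator of m^{0(10)} into a
   complex symmetric bilinear form on C^2, well defined up to the unitary group and scaling.
   Takagi factorization diagonalises it with entries s1 >= s2 >= 0, not both 0, which gives
   s1 : s2 = 1 + t : 1 - t; as singular values are unitarily invariant, t is unique.
   Geometry: let th be a local contact form with kernel D and om = - d th, so that
   th [X, Y] = om(X, Y) on sections of D. For X in the first Freeman module and Y, Z of type (0,1),
   om([X, Y], Z) depends only on the values of X, Y, Z at the point: in X because om([X, Y], Z) = 0
   when X is a section of the Levi kernel vanishing there, in Z trivially, and in Y because the Jacobi
   identity makes the expression symmetric in Y and Z. This cubic form is that of the core up to
   scaling, and it is transported by local CR diffeomorphisms (locally, without cutoff functions).
   2-nondegeneracy is a dimension count: the graded pieces of the core exhaust T_x M, so F_1 = 0. *)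

From HB Require Import structures.
Require Import Defs.
From mathcomp Require Import all_boot all_order all_algebra.
From mathcomp Require Import all_classical all_reals all_analysis.
From mathcomp Require Import complex.
From mathcomp Require Import ring lra zify ssrAC.

Set Implicit Arguments.
Unset Strict Implicit.
Unset Printing Implicit Defensive.

Import Order.TTheory GRing.Theory Num.Theory.
Import numFieldNormedType.Exports.
Local Open Scope classical_set_scope.
Local Open Scope ring_scope.

(** * Canonical cores *)

(** The main obstacle is that the core of a CR manifold is visible only through global sections:
    [tanaka], [freeman] and the conditions of [core_at] all speak of fields on the whole manifold,
    while a local CR diffeomorphism produces fields on an open set only. Facts needed on that open
    set are therefore first made pointwise. A dimension count shows that global sections span D at
    every point, and the fibre of the first Freeman module is identified with the (1,0)-part of the
    kernel of om. Global and pulled-back fields then only have to agree at one point. None of th,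
    the generator of m^{-2} and the generator of m^0 is canonical, so forms are compared up to
    nonzero factors; the ratio of two singular values survives this. [canon_S_unique] is stated for
    two abstract coordinate systems in order to serve both core isomorphisms and diffeomorphisms.
    The convention that J acts as -i on the coordinates [Zv] makes them complex linear on
    m^{-1(01)}: the form of L^2 is then complex bilinear without conjugates, and a unitary change of
    coordinates acts on it by congruence, as Takagi factorization requires. *)

Lemma perm_eq2 (T : eqType) (a b : T) s : perm_eq [:: a; b] s -> s = [:: a; b] \/ s = [:: b; a].
Proof.
move=> ps; have := perm_size ps; move: s ps => [|x [|y []]]// ps _.
have : a \in [:: x; y] by rewrite -(perm_mem ps) mem_head.
rewrite !inE => /orP[/eqP xE|/eqP yE].
  by left; move: ps; rewrite -xE perm_cons => /perm_small_eq -/(_ isT)[->].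
right; have : perm_eq [:: a; b] [:: y; x].
  by apply: (perm_trans ps); apply/permPl; exact: (perm_catC [:: x] [:: y]).
by rewrite -yE perm_cons => /perm_small_eq -/(_ isT)[->].
Qed.

(** * Complexified vectors and bilinear maps *)

Section cx.
Context (R : rcfType) (V : lmodType R).
Implicit Types (z w : cx V).

Lemma cx_scaleE (a b : R) z : (Complex a b *: z : cx V) = (a *: z.1 - b *: z.2, a *: z.2 + b *: z.1).
Proof. by []. Qed.

Lemma cx_imagE z : imag *: z = (- z.2, z.1).
Proof. by rewrite cx_scaleE !scale0r !scale1r sub0r add0r. Qed.

Lemma cx_NimagE z : - imag *: z = (z.2, - z.1).
Proof. by rewrite scaleNr cx_imagE; congr pair; rewrite opprK. Qed.

Lemma cx_realE (a : R) z : Complex a 0 *: z = (a *: z.1, a *: z.2).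
Proof. by rewrite cx_scaleE !scale0r subr0 addr0. Qed.

End cx.

Section cx_bil.
Context (R : rcfType) (V : lmodType R).

Lemma cx_bil_linearl (U W : lmodType R) (f : V -> U -> W) (c : R[i]) (z z' : cx V) (w : cx U) :
  (forall (a : R) u u' v, f (a *: u + u') v = a *: f u v + f u' v) ->
  cx_bil f (c *: z + z') w = c *: cx_bil f z w + cx_bil f z' w.
Proof.
move=> fL.
have fD u u' v : f (u + u') v = f u v + f u' v by have := fL 1 u u' v; rewrite !scale1r.
have f0 v : f 0 v = 0 by have := fL (-1) 0 0 v; rewrite !scaleN1r oppr0 addr0 addNr.
have fZ a u v : f (a *: u) v = a *: f u v by have := fL a u 0 v; rewrite !addr0 f0 addr0.
have fN u v : f (- u) v = - f u v by rewrite -scaleN1r fZ scaleN1r.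
case: c z z' w => a b [z1 z2] [z1' z2'] [w1 w2]; rewrite /cx_bil !cx_scaleE /=; congr pair.
  rewrite !fD !fN !fZ !scalerBr !scalerDr !opprD !addrA.
  by rewrite [LHS](ACl (1*4*5*2*3*6))%AC /=.
rewrite !fD !fN !fZ !scalerBr !scalerDr !addrA.
by rewrite [LHS](ACl (1*4*5*2*3*6))%AC /=.
Qed.

Lemma cx_bil_linearr (U W : lmodType R) (f : U -> V -> W) (c : R[i]) (z z' : cx V) (w : cx U) :
  (forall (a : R) u u' v, f v (a *: u + u') = a *: f v u + f v u') ->
  cx_bil f w (c *: z + z') = c *: cx_bil f w z + cx_bil f w z'.
Proof.
move=> fL.
have E x : cx_bil f w x = cx_bil (fun v u => f u v) x w.
  by rewrite /cx_bil; congr pair; rewrite addrC.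
by rewrite !E; apply: cx_bil_linearl => a u u' v; exact: fL.
Qed.

End cx_bil.

(** * Complex coordinates on c^{-1} *)

Section coords.
Context (R : rcfType).
Local Notation C := (R[i]).

(* The point of R^4 with complex coordinates p and q; [sp_J] acts as multiplication by -i. *)
Definition Zv (p q : C) : 'cV[R]_4 :=
  \col_(i < 4) [:: complex.Re p; complex.Re q; complex.Im p; complex.Im q]`_i.

Definition zc1 (v : 'cV[R]_4) : C := Complex (v ord0 0) (v (inord 2) 0).
Definition zc2 (v : 'cV[R]_4) : C := Complex (v (inord 1) 0) (v (inord 3) 0).

Lemma zc1Z p q : zc1 (Zv p q) = p.
Proof. by rewrite /zc1 !mxE /= !inordK//; case: p. Qed.

Lemma zc2Z p q : zc2 (Zv p q) = q.
Proof. by rewrite /zc2 !mxE /= !inordK//; case: q. Qed.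

Lemma ZvK v : Zv (zc1 v) (zc2 v) = v.
Proof.
apply/colP => -[[|[|[|[|//]]]] h]; rewrite !mxE /=; congr (v _ _); apply/val_inj;
  by rewrite /= ?inordK.
Qed.

Lemma ZvD p q p' q' : Zv p q + Zv p' q' = Zv (p + p') (q + q').
Proof.
by case: p q p' q' => [? ?] [? ?] [? ?] [? ?]; apply/colP => -[[|[|[|[|//]]]] h]; rewrite !mxE.
Qed.

Lemma ZvZ (a : R) p q : a *: Zv p q = Zv (Complex a 0 * p) (Complex a 0 * q).
Proof.
by case: p q => [? ?] [? ?]; apply/colP => -[[|[|[|[|//]]]] h]; rewrite !mxE /=; ring.
Qed.

Lemma ZvN p q : - Zv p q = Zv (- p) (- q).
Proof. by case: p q => [? ?] [? ?]; apply/colP => -[[|[|[|[|//]]]] h]; rewrite !mxE. Qed.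

Lemma sp_JZ p q : sp_J R *m Zv p q = Zv (- imag * p) (- imag * q).
Proof.
case: p q => [? ?] [? ?]; apply/colP => -[[|[|[|[|//]]]] h];
  rewrite !mxE !big_ord_recl big_ord0 !mxE /=; ring.
Qed.

(** B is minus the imaginary part of the standard Hermitian form of C^2, so B(J v, w) is its real
    part; the linear maps that respect B and J are then the unitary ones. *)
Lemma sp_BZ p q p' q' : sp_B (Zv p q) (Zv p' q') =
  - complex.Im (p * conjc p' + q * conjc q').
Proof.
case: p q p' q' => [? ?] [? ?] [? ?] [? ?].
rewrite /sp_B -mulmxA mxE !big_ord_recl big_ord0 !mxE !big_ord_recl !big_ord0 !mxE /=; ring.
Qed.

Lemma sp_e0 : sp_e R 0 = Zv 1 0.
Proof. by apply/colP => -[[|[|[|[|//]]]] h]; rewrite !mxE. Qed.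

Lemma sp_e1 : sp_e R 1 = Zv 0 1.
Proof. by apply/colP => -[[|[|[|[|//]]]] h]; rewrite !mxE. Qed.

Lemma sp_BDl u v w : sp_B (u + v) w = sp_B u w + sp_B v w :> R.
Proof. by rewrite /sp_B linearD /= !mulmxDl mxE. Qed.

Lemma sp_BZl (a : R) u w : sp_B (a *: u) w = a * sp_B u w.
Proof. by rewrite /sp_B linearZ /= -!scalemxAl mxE. Qed.

Lemma sp_BDr u v w : sp_B w (u + v) = sp_B w u + sp_B w v :> R.
Proof. by rewrite /sp_B !mulmxDr mxE. Qed.

Lemma sp_BZr (a : R) u w : sp_B w (a *: u) = a * sp_B w u.
Proof. by rewrite /sp_B -!scalemxAr mxE. Qed.

Lemma sp_BNl u w : sp_B (- u) w = - sp_B u w :> R.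
Proof. by rewrite -scaleN1r sp_BZl mulN1r. Qed.

Lemma sp_B_anti u v : sp_B u v = - sp_B v u :> R.
Proof.
rewrite -(ZvK u) -(ZvK v) !sp_BZ.
by move: (zc1 u) (zc2 u) (zc1 v) (zc2 v) => [? ?] [? ?] [? ?] [? ?] /=; ring.
Qed.

Lemma sp_B_J u v : sp_B (sp_J R *m u) (sp_J R *m v) = sp_B u v.
Proof.
rewrite -(ZvK u) -(ZvK v) !sp_JZ !sp_BZ.
by move: (zc1 u) (zc2 u) (zc1 v) (zc2 v) => [? ?] [? ?] [? ?] [? ?] /=; ring.
Qed.

Lemma sp_JJ (v : 'cV[R]_4) : sp_J R *m (sp_J R *m v) = - v.
Proof.
rewrite -(ZvK v) !sp_JZ ZvN.
by move: (zc1 v) (zc2 v) => [? ?] [? ?]; congr Zv; apply/eqP; rewrite eq_complex /=; apply/andP; split; apply/eqP; ring.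
Qed.

Lemma sp_B_Jl u v : sp_B (sp_J R *m u) v = - sp_B u (sp_J R *m v).
Proof. by rewrite -sp_B_J sp_JJ sp_BNl. Qed.

Lemma sp_BJ_ge0 u : u != 0 -> 0 < sp_B (sp_J R *m u) u.
Proof.
rewrite -(ZvK u) sp_JZ sp_BZ.
move: (zc1 u) (zc2 u) => [a c] [b d] u0 /=.
(* The expanded expression is the Hermitian norm |p|^2 + |q|^2 of the coordinates. *)
have -> : - ((- 0 * a - - 1 * c) * - c + (- 0 * c + - 1 * a) * a + ((- 0 * b - - 1 * d) * - d + (- 0 * d + - 1 * b) * b)) = a ^+ 2 + b ^+ 2 + c ^+ 2 + d ^+ 2 by ring.
rewrite lt_neqAle !addr_ge0 ?sqr_ge0// andbT eq_sym.
apply: contra u0; rewrite !paddr_eq0 ?addr_ge0 ?sqr_ge0// !sqrf_eq0.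
move=> /andP[/andP[/andP[/eqP-> /eqP->] /eqP->] /eqP->].
by apply/eqP/colP => -[[|[|[|[|//]]]] h]; rewrite !mxE.
Qed.

Lemma sp_B_nondeg (u : 'cV[R]_4) : (forall v, sp_B u v = 0) -> u = 0.
Proof.
move=> u0; apply/eqP; apply: contraT => /sp_BJ_ge0.
by rewrite sp_B_anti u0 oppr0 ltxx.
Qed.

Lemma sp_odotE v1 v2 w : sp_odot v1 v2 *m w = sp_B v2 w *: v1 + sp_B v1 w *: v2 :> 'cV[R]_4.
Proof.
rewrite /sp_odot /sp_B mulmxDl -!mulmxA; congr (_ + _);
  by rewrite [X in _ *m X]mx11_scalar mul_mx_scalar.
Qed.

End coords.

(** * Generators and graded pieces of m_t *)

Section canon.
Context (R : realType).
Local Notation C := (R[i]).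
Implicit Types (t : R).

Lemma mx_ext (A B : 'M[R]_4) : (forall w : 'cV[R]_4, A *m w = B *m w) -> A = B.
Proof.
move=> AB; apply/matrixP => i j; have /colP/(_ i) := AB (delta_mx j 0).
by rewrite -!colE !mxE.
Qed.

Definition canon_mx t : 'M[R]_4 := (canon_gen t).1.

Lemma eqC (a b : C) : complex.Re a = complex.Re b -> complex.Im a = complex.Im b -> a = b.
Proof. by case: a b => [? ?] [? ?] /= -> ->. Qed.

Lemma cx_odot_mul (z : cx 'cV[R]_4) w :
  (cx_odot z z).1 *m w = 2 *: (sp_B z.1 w *: z.1 - sp_B z.2 w *: z.2) /\
  (cx_odot z z).2 *m w = 2 *: (sp_B z.2 w *: z.1 + sp_B z.1 w *: z.2).
Proof.
have E1 : (cx_odot z z).1 *m w = sp_odot z.1 z.1 *m w - sp_odot z.2 z.2 *m w by exact: mulmxBl.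
have E2 : (cx_odot z z).2 *m w = sp_odot z.1 z.2 *m w + sp_odot z.2 z.1 *m w by exact: mulmxDl.
rewrite E1 E2 !sp_odotE !scaler_nat !mulr2n; split; first by rewrite opprD addrACA.
by congr (_ + _); exact: addrC.
Qed.

(** The two factors 1/2 in [e10] and the factor 2 in v odot v give (1 + t)/2 and (1 - t)/2.
    Conjugates appear because elements of S^2(c^{-1(10)}) kill c^{-1(10)} and send c^{-1(01)} to
    c^{-1(10)}, so that their real and imaginary parts anticommute with J. *)
Lemma canon_gen_mul t p q :
  (canon_gen t).1 *m Zv p q = Zv (Complex 0 ((1 + t) / 2) * conjc p) (Complex 0 ((1 - t) / 2) * conjc q) /\
  (canon_gen t).2 *m Zv p q = Zv (Complex (- (1 + t) / 2) 0 * conjc p) (Complex (- (1 - t) / 2) 0 * conjc q).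
Proof.
have L (a b : R) (A B : 'M[R]_4) (w : 'cV[R]_4) :
    (a *: A + b *: B) *m w = a *: (A *m w) + b *: (B *m w).
  by rewrite mulmxDl -!scalemxAl.
have [X1 X2] := cx_odot_mul (e10 R 0) (Zv p q).
have [Y1 Y2] := cx_odot_mul (e10 R 1) (Zv p q).
rewrite /canon_gen !cx_realE.
move: (cx_odot _ _) (cx_odot _ _) X1 X2 Y1 Y2 => X Y X1 X2 Y1 Y2.
rewrite [X in X = _ /\ _]L [X in _ /\ X = _]L X1 X2 Y1 Y2.
rewrite /e10 sp_e0 sp_e1 !sp_JZ !ZvZ !ZvN /=.
case: p q {X Y X1 X2 Y1 Y2} => [a c] [b d].
rewrite !sp_BZ !ZvZ !ZvN !ZvD !ZvZ !ZvD.
by split; congr Zv; apply: eqC => /=; field.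
Qed.

Lemma canon_mx_mul t p q : canon_mx t *m Zv p q =
  Zv (Complex 0 ((1 + t) / 2) * conjc p) (Complex 0 ((1 - t) / 2) * conjc q).
Proof. by have [] := canon_gen_mul t p q. Qed.

(** The generator has values in c^{-1(10)}, where J is multiplication by i. Hence m^0 is spanned
    over the reals by [canon_mx t] and its product with J. *)
Lemma canon_gen2 t : (canon_gen t).2 = - (sp_J R *m canon_mx t).
Proof.
apply: mx_ext => w; rewrite mulNmx -mulmxA -(ZvK w) canon_mx_mul sp_JZ ZvN.
have [_ ->] := canon_gen_mul t (zc1 w) (zc2 w).
by move: (zc1 w) (zc2 w) => [? ?] [? ?]; congr Zv; apply: eqC => /=; ring.
Qed.

Lemma canon_mx_neq0 t : 0 <= t -> canon_mx t != 0.
Proof.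
move=> t0; apply/eqP => Q0; have := canon_mx_mul t 1 0.
rewrite Q0 mul0mx => /(congr1 (fun v => complex.Im (zc1 v))); rewrite zc1Z /= mxE.
by move: t0 => /=; lra.
Qed.

(* The quadratic form of m_t on the (conjugated) coordinates of c^{-1}. *)
Definition canon_S t (u v : 'cV[R]_4) : C :=
  Complex (1 + t) 0 * (zc1 u * zc1 v) + Complex (1 - t) 0 * (zc2 u * zc2 v).

Lemma gr2_canon t u : u \in gr (canon_core t) (-2) <-> exists r, u = c2_in r.
Proof.
rewrite /gr /= /grB /=; split=> [/vlineP[k ->]|[r ->]].
  exists k; rewrite /c2_in; congr (_, _, _); rewrite ?scaler0//.
  exact: mulr1.
apply/vlineP; exists r; rewrite /c2_in; congr (_, _, _); rewrite ?scaler0//.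
exact/esym/mulr1.
Qed.

Lemma gr1_canon t u : u \in gr (canon_core t) (-1) <-> exists v, u = c1_in v.
Proof.
rewrite /gr /= /grB /=.
pose F : seq (ambB R) := [seq c1_in (sp_e R j) | j <- enum 'I_4].
have c1L : linear (@c1_in R).
  move=> a x y; rewrite /c1_in; congr (_, _, _); rewrite /= ?scaler0 ?addr0//.
pose c1F : {linear 'cV[R]_4 -> ambB R} := HB.pack (@c1_in R) (GRing.isLinear.Build R _ _ _ _ c1L).
have FE : <<F>>%VS = limg (linfun c1F).
  apply/vspaceP => x; apply/idP/idP => [|/memv_imgP[v _ ->]].
    move=> xF; have : (<<F>> <= limg (linfun c1F))%VS.
      by apply/span_subvP => _ /mapP[j _ ->]; apply/memv_imgP; exists (sp_e R j); rewrite ?memvf// lfunE.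
    by move=> /subvP; apply.
  rewrite lfunE (_ : v = \sum_j v j 0 *: sp_e R j); last first.
    by rewrite {1}[v]matrix_sum_delta; apply: eq_bigr => j _; rewrite big_ord1.
  rewrite linear_sum; apply: memv_suml => j _; rewrite linearZ; apply: memvZ.
  by apply: memv_span; apply: map_f; rewrite mem_enum.
rewrite FE; split=> [/memv_imgP[v _ ->]|[v ->]]; first by exists v; rewrite lfunE.
by apply/memv_imgP; exists v; rewrite ?memvf// lfunE.
Qed.

Lemma gr0_canon t u : u \in gr (canon_core t) 0 <->
  exists a b : R, u = m0_in (a *: canon_mx t + b *: (sp_J R *m canon_mx t)).
Proof.
change (gr (canon_core t) 0) with
  <<[:: m0_in (canon_mx t); m0_in (imag *: canon_gen t : cx _).1]>>%VS.
have -> : (imag *: canon_gen t : cx _).1 = sp_J R *m canon_mx t.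
  by rewrite cx_imagE -[RHS]opprK -canon_gen2.
have m0L a b (A B : 'M[R]_4) : a *: m0_in A + b *: m0_in B = m0_in (a *: A + b *: B) :> ambB R.
  by congr (_, _, _); rewrite /= ?scaler0 ?addr0.
split=> [|[a [b ->]]].
  rewrite span_cons span_seq1 => /memv_addP[_ /vlineP[a ->] [_ /vlineP[b ->] ->]].
  by exists a, b; rewrite m0L.
by rewrite -m0L rpredD// memvZ// memv_span// !inE eqxx ?orbT.
Qed.

Lemma gr_canon0 t p : p != -2 -> p != -1 -> p != 0 -> gr (canon_core t) p = 0%VS.
Proof. by rewrite /gr /= /grB; do 3!case: ifP => // _. Qed.

End canon.

Section m10.
Context (R : rcfType) (m : coreData R).

(** The form in which types are used later: a (1,0)-vector is (u, - J u) and a (0,1)-vector is (u, J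
    u), so real parts determine both. *)
Lemma m10P p (z : cx (amb m)) : m10 p z <->
  [/\ z.1 \in gr m p, z.2 \in gr m p, cJ z.1 = - z.2 & cJ z.2 = z.1].
Proof.
split=> [[z1 z2]|[z1 z2 J1 J2]].
  by rewrite cx_imagE => -[J1 J2]; split.
by split=> //; rewrite cx_imagE -J1 -{2}J2.
Qed.

Lemma m01P p (z : cx (amb m)) : m01 p z <->
  [/\ z.1 \in gr m p, z.2 \in gr m p, cJ z.1 = z.2 & cJ z.2 = - z.1].
Proof.
split=> [[z1 z2]|[z1 z2 J1 J2]].
  by rewrite cx_NimagE => -[J1 J2]; split.
by split=> //; rewrite cx_NimagE -J1 -J2.
Qed.

End m10.

(** * The axioms of an abstract core for m_t *)

Section canon_core.
Context (R : realType) (t : R).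
Hypothesis t0 : 0 <= t.
Local Notation m := (canon_core t).

(** This is the real part of (a + i b) times the generator; on the coordinates of [Zv] it is
    conjugation followed by the diagonal matrix with entries (b + i a)(1 + t)/2 and (b + i a)(1 -
    t)/2. *)
Definition m0_mx (a b : R) : 'M[R]_4 := a *: canon_mx t + b *: (sp_J R *m canon_mx t).

Lemma m0_mx_mul a b p q : m0_mx a b *m Zv p q =
  Zv (Complex b a * (Complex ((1 + t) / 2) 0 * conjc p))
     (Complex b a * (Complex ((1 - t) / 2) 0 * conjc q)).
Proof.
have L (c d : R) (A B : 'M[R]_4) (w : 'cV[R]_4) :
    (c *: A + d *: B) *m w = c *: (A *m w) + d *: (B *m w).
  by rewrite mulmxDl -!scalemxAl.
rewrite /m0_mx L -mulmxA canon_mx_mul sp_JZ !ZvZ ZvD.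
by case: p q => [? ?] [? ?]; congr Zv; apply: eqC => /=; ring.
Qed.

Lemma J_m0_mx a b : sp_J R *m m0_mx a b = m0_mx (- b) a.
Proof.
apply: mx_ext => w; rewrite -mulmxA -(ZvK w) !m0_mx_mul sp_JZ.
by move: (zc1 w) (zc2 w) => [? ?] [? ?]; congr Zv; apply: eqC => /=; ring.
Qed.

Lemma m0_mx_J a b : m0_mx a b *m sp_J R = - (sp_J R *m m0_mx a b).
Proof.
apply: mx_ext => w; rewrite J_m0_mx mulNmx -mulmxA -(ZvK w) sp_JZ !m0_mx_mul ZvN.
by move: (zc1 w) (zc2 w) => [? ?] [? ?]; congr Zv; apply: eqC => /=; ring.
Qed.

(** Membership in sp(c^{-1}, B), rewritten with the antisymmetry of B; it is the source of the
    symmetry demanded of L^2. *)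
Lemma m0_mx_sym a b u v : sp_B (m0_mx a b *m u) v = sp_B (m0_mx a b *m v) u.
Proof.
rewrite -(ZvK u) -(ZvK v) !m0_mx_mul !sp_BZ.
by move: (zc1 u) (zc2 u) (zc1 v) (zc2 v) => [? ?] [? ?] [? ?] [? ?] /=; ring.
Qed.

Lemma m0_mxN a b : - m0_mx a b = m0_mx (- a) (- b).
Proof. by rewrite /m0_mx opprD !scaleNr. Qed.

Lemma m0_inN (A : 'M[R]_4) : m0_in (- A) = - m0_in A :> ambB R.
Proof. by congr (_, _, _); rewrite /= ?oppr0. Qed.

Lemma c2_inD (r s : R) : c2_in (r + s) = c2_in r + c2_in s :> ambB R.
Proof. by congr (_, _, _); rewrite /= ?addr0. Qed.

Lemma c2_inN (r : R) : c2_in (- r) = - c2_in r :> ambB R.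
Proof. by congr (_, _, _); rewrite /= ?oppr0. Qed.

Lemma c2_inZ (a r : R) : c2_in (a * r) = a *: c2_in r :> ambB R.
Proof. by congr (_, _, _); rewrite /= ?scaler0. Qed.

Lemma c1_inD (r s : 'cV[R]_4) : c1_in (r + s) = c1_in r + c1_in s :> ambB R.
Proof. by congr (_, _, _); rewrite /= ?addr0. Qed.

Lemma c1_inN (r : 'cV[R]_4) : c1_in (- r) = - c1_in r :> ambB R.
Proof. by congr (_, _, _); rewrite /= ?oppr0. Qed.

Lemma c1_inZ (a : R) (r : 'cV[R]_4) : c1_in (a *: r) = a *: c1_in r :> ambB R.
Proof. by congr (_, _, _); rewrite /= ?scaler0. Qed.

Lemma cJ_c1 (v : 'cV[R]_4) : @cJ R m (c1_in v) = c1_in (sp_J R *m v).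
Proof. by congr (_, _, _); rewrite /= ?mulmx0. Qed.

Lemma cJ_m0 (A : 'M[R]_4) : @cJ R m (m0_in A) = m0_in (sp_J R *m A).
Proof. by congr (_, _, _); rewrite /= ?mulmx0. Qed.

Lemma m10_canon v : m10 0 v <-> exists a b, v = (m0_in (m0_mx a b), m0_in (m0_mx b (- a))) :> cx (amb m).
Proof.
split=> [/m10P[/gr0_canon[a [b E1]] _ J1 _]|[a [b ->]]].
  exists a, b; rewrite [v]surjective_pairing -[v.2]opprK -J1 E1 cJ_m0 -/(m0_mx a b).
  by rewrite -m0_inN J_m0_mx m0_mxN opprK.
apply/m10P; split.
- by apply/gr0_canon; exists a, b.
- by apply/gr0_canon; exists b, (- a).
- by rewrite cJ_m0 J_m0_mx -m0_inN m0_mxN opprK.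
- by rewrite cJ_m0 J_m0_mx opprK.
Qed.

Lemma m01_canon w : m01 (-1) w <-> exists y, w = (c1_in y, c1_in (sp_J R *m y)) :> cx (amb m).
Proof.
split=> [/m01P[/gr1_canon[y E1] _ J1 _]|[y ->]].
  by exists y; rewrite [w]surjective_pairing -J1 E1 cJ_c1.
apply/m01P; split.
- by apply/gr1_canon; exists y.
- by apply/gr1_canon; exists (sp_J R *m y).
- by rewrite cJ_c1.
- by rewrite cJ_c1 sp_JJ c1_inN.
Qed.

(** Since [m0_mx a b] anticommutes with J, the two terms of each component coincide. The bracket in
    [canon_form] doubles once more, whence the 4 there. *)
Lemma canon_L a b y :
  @cL R m 0 (m0_in (m0_mx a b), m0_in (m0_mx b (- a))) (c1_in y, c1_in (sp_J R *m y)) =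
  (c1_in (2 *: (m0_mx a b *m y)), c1_in (2 *: (m0_mx a b *m (sp_J R *m y)))) :> cx (amb m).
Proof.
have E : m0_mx b (- a) = - (sp_J R *m m0_mx a b) by rewrite J_m0_mx m0_mxN opprK.
rewrite [LHS](_ : _ = (c1_in (m0_mx a b *m y) - c1_in (m0_mx b (- a) *m (sp_J R *m y)),
  c1_in (m0_mx a b *m (sp_J R *m y)) + c1_in (m0_mx b (- a) *m y)))//.
rewrite -c1_inN -!c1_inD !scaler_nat !mulr2n; congr (c1_in _, c1_in _); congr (_ + _).
  by rewrite E mulNmx opprK mulmxA -(mulmxA (sp_J R)) m0_mx_J mulmxN mulNmx -!mulmxA sp_JJ opprK.
by rewrite E mulmxA m0_mx_J !mulNmx.
Qed.

Lemma canon_form a b y z :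
  @core_form R m 1 (m0_in (m0_mx a b), m0_in (m0_mx b (- a)))
    [:: (c1_in y, c1_in (sp_J R *m y)); (c1_in z, c1_in (sp_J R *m z))] =
  (c2_in (4 * sp_B (m0_mx a b *m y) z), c2_in (4 * sp_B (m0_mx a b *m y) (sp_J R *m z))) :> cx (amb m).
Proof.
rewrite /core_form canon_L.
rewrite [LHS](_ : _ = (c2_in (sp_B (2 *: (m0_mx a b *m y)) z) -
   c2_in (sp_B (2 *: (m0_mx a b *m (sp_J R *m y))) (sp_J R *m z)),
   c2_in (sp_B (2 *: (m0_mx a b *m y)) (sp_J R *m z)) +
   c2_in (sp_B (2 *: (m0_mx a b *m (sp_J R *m y))) z)))//.
rewrite -c2_inN -!c2_inD !sp_BZl mulmxA m0_mx_J !mulNmx !sp_BNl -mulmxA sp_B_J sp_B_Jl.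
by congr (c2_in _, c2_in _); ring.
Qed.

Lemma cbr_c1 u v : @cbr R m (c1_in u) (c1_in v) = c2_in (sp_B u v).
Proof. by []. Qed.

Lemma gr_canonP p u : u \in gr m p ->
  [\/ p = -2 /\ exists r, u = c2_in r, p = -1 /\ exists v, u = c1_in v,
      p = 0 /\ exists a b, u = m0_in (m0_mx a b) | u = 0].
Proof.
have [->|p2] := eqVneq p (-2); first by move=> /gr2_canon; constructor 1.
have [->|p1] := eqVneq p (-1); first by move=> /gr1_canon; constructor 2.
have [->|p0] := eqVneq p 0; first by move=> /gr0_canon; constructor 3.
by rewrite gr_canon0// memv0 => /eqP; constructor 4.
Qed.

Lemma canon_dims : [/\ \dim (gr m (-2)) = 1%N, \dim (gr m (-1)) = 4%N & \dim (gr m 0) = 2%N].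
Proof.
split.
- rewrite [X in \dim X](_ : _ = <[c2_in 1]>%VS)// dim_vline.
  by rewrite (_ : c2_in 1 != 0)//; apply/eqP => -[/eqP]; rewrite oner_eq0.
- have c1L : linear (@c1_in R) by move=> a x y; rewrite c1_inD c1_inZ.
  pose c1F : {linear 'cV[R]_4 -> ambB R} := HB.pack (@c1_in R) (GRing.isLinear.Build R _ _ _ _ c1L).
  rewrite (_ : gr m (-1) = limg (linfun c1F)); last first.
    apply/vspaceP => u; apply/idP/idP => [/gr1_canon[v ->]|/memv_imgP[v _ ->]].
      by apply/memv_imgP; exists v; rewrite ?memvf// lfunE.
    by rewrite lfunE; apply/gr1_canon; exists v.
  rewrite limg_dim_eq; first by rewrite dimvf.
  apply/eqP; rewrite -subv0; apply/subvP => v.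
  by rewrite memv_cap memv_ker lfunE memv0 => /andP[_ /eqP[->]].
- rewrite [X in \dim X](_ : _ = <<[:: m0_in (m0_mx 1 0); m0_in (m0_mx 0 1)]>>%VS); last first.
    apply/vspaceP => u; apply/idP/idP => [/gr0_canon[a [b ->]]|].
      rewrite [m0_in _](_ : _ = a *: m0_in (m0_mx 1 0) + b *: m0_in (m0_mx 0 1)); last first.
        by congr (_, _, _); rewrite /= ?scaler0 ?addr0// /m0_mx !scale1r !scale0r addr0 add0r.
      by rewrite rpredD// memvZ// memv_span// !inE eqxx ?orbT.
    rewrite span_cons span_seq1 => /memv_addP[_ /vlineP[a ->] [_ /vlineP[b ->] ->]].
    apply/gr0_canon; exists a, b.
    by congr (_, _, _); rewrite /= ?scaler0 ?addr0// /m0_mx !scale1r !scale0r addr0 add0r.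
  have /eqP : free [:: m0_in (m0_mx 1 0); m0_in (m0_mx 0 1)].
    have Q0 : m0_mx 1 0 != 0 by rewrite /m0_mx scale1r scale0r addr0 canon_mx_neq0.
    have Q01 : m0_mx 0 1 = sp_J R *m m0_mx 1 0 by rewrite J_m0_mx oppr0.
    have Q02 : m0_mx 1 0 = - (sp_J R *m m0_mx 0 1) by rewrite J_m0_mx m0_mxN opprK oppr0.
    rewrite free_cons seq1_free span_seq1; apply/andP; split.
      apply/vlineP => -[k /(congr1 snd) E0]; have E : m0_mx 1 0 = k *: m0_mx 0 1 := E0.
      have E2 : m0_mx 0 1 = - (k *: m0_mx 1 0) by rewrite {1}Q01 {1}E -scalemxAr -[sp_J R *m _]opprK -Q02 scalerN.
      move: E; rewrite E2 scalerN scalerA => /eqP; rewrite -addr_eq0 -{1}[m0_mx 1 0]scale1r -scalerDl.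
      rewrite scaler_eq0 (negPf Q0) orbF => /eqP E.
      have := sqr_ge0 k; rewrite expr2; lra.
    apply/eqP => /(congr1 snd) E; move/eqP: Q0; apply; rewrite Q02 [m0_mx 0 1]E.
    by rewrite mulmx0 oppr0.
  by [].
Qed.

(** Projection onto degree p; applied to a vanishing sum of homogeneous vectors it isolates one
    term, which gives directness. *)
Definition ambB_comp (p : int) (u : ambB R) : ambB R :=
  if p == -2 then c2_in u.1.1 else if p == -1 then c1_in u.1.2
  else if p == 0 then m0_in u.2 else 0.

Lemma ambB_comp_id p u : u \in gr m p -> ambB_comp p u = u.
Proof.
rewrite /ambB_comp => /gr_canonP[[-> [r ->]]|[-> [v ->]]|[-> [a [b ->]]]|->] //.
by do 3!case: ifP => // _.
Qed.

Lemma ambB_comp0 p p' u : p != p' -> u \in gr m p -> ambB_comp p' u = 0.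
Proof.
rewrite /ambB_comp eq_sym => pp /gr_canonP[[pE [r ->]]|[pE [v ->]]|[pE [a [b ->]]]|->] //.
- by rewrite pE in pp; rewrite (negPf pp); do 2!case: ifP => // _.
- by rewrite pE in pp; rewrite (negPf pp); do 2!case: ifP => // _.
- by rewrite pE in pp; rewrite (negPf pp); do 2!case: ifP => // _.
- by do 3!case: ifP => // _.
Qed.

Lemma ambB_compD p u v : ambB_comp p (u + v) = ambB_comp p u + ambB_comp p v.
Proof.
rewrite /ambB_comp; case: ifP => _; first exact: c2_inD.
case: ifP => _; first exact: c1_inD.
case: ifP => _; last by rewrite addr0.
by congr (_, _, _); rewrite /= ?addr0.
Qed.

Lemma canon_direct N : directv (\sum_(i < N.*2.+1) gr m (i%:Z - N%:Z)).
Proof.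
apply/directv_sum_independent => us usV us0 i _.
have comp_sum p (s : seq 'I_(N.*2.+1)) (P : pred 'I_(N.*2.+1)) :
    ambB_comp p (\sum_(j <- s | P j) us j) = \sum_(j <- s | P j) ambB_comp p (us j).
  apply: (big_morph (ambB_comp p)) => [u v|]; first exact: ambB_compD.
  by rewrite /ambB_comp; do 3!case: ifP => // _.
have := congr1 (ambB_comp (i%:Z - N%:Z)) us0.
rewrite comp_sum (bigD1 i)//= big1 => [|j ji]; last first.
  apply: ambB_comp0 (usV j isT); apply: contra ji => /eqP/addIr[/val_inj ->].
  exact: eqxx.
rewrite addr0 ambB_comp_id; last exact: usV.
by move=> ->; rewrite /ambB_comp; do 3!case: ifP => // _.
Qed.

Lemma canon_typeB : type_B m.
Proof. by have [? ? ?] := canon_dims; split=> // p; exact: gr_canon0. Qed.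

Lemma canon_dim : core_dim m 7.
Proof.
exists 2%N => [p p2|]; first by apply: gr_canon0; apply: contraTneq p2 => ->.
have /directvP /= -> := canon_direct 2.
have [d2 d1 d0] := canon_dims.
pose d (z : int) := \dim (gr m z).
change ((\sum_(i < 5) d (Posz i - Posz 2)%R)%N = 7%N); rewrite !big_ord_recl big_ord0.
change ((d (-2)%R + (d (-1)%R + (d 0%R + (d 1%R + (d 2%R + 0)))))%N = 7%N).
by rewrite /d d2 d1 d0 !gr_canon0// dimv0.
Qed.

Lemma canon_signature : core_signature m 2 0.
Proof.
exists (c2_in 1), (fun u v : ambB R => sp_B u.1.2 v.1.2); split.
- by apply/eqP => -[/eqP]; rewrite oner_eq0.
- by [].
- by move=> v w _ _; rewrite -c2_inZ mulr1.
exists (gr m (-1)), 0%VS; split; split.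
- by rewrite addv0.
- by apply/directv_addP; rewrite capv0.
- by have [] := canon_dims.
- by rewrite dimv0.
- move=> _ /gr1_canon[v ->] v0; rewrite cJ_c1; apply: sp_BJ_ge0.
  by apply: contra v0 => /eqP ->; apply/eqP.
- by move=> v; rewrite memv0 => /eqP ->; rewrite eqxx.
- move=> v w _; rewrite memv0 => /eqP ->; split.
    by rewrite /sp_B mulmx0 mxE.
  by rewrite /= mulmx0 /sp_B linear0 !mul0mx mxE.
Qed.

Lemma canon_abstract : abstract_core m.
Proof.
have L0 (p : nat) (v w : cx (amb m)) : p != 0%N -> cL p v w = 0 by case: p.
have m0 (p : nat) (v : cx (amb m)) : p != 0%N -> m10 p%:Z v -> v = 0.
  case: p => // p _ [v1 v2 _]; move: v1 v2; rewrite gr_canon0// !memv0 => /eqP E1 /eqP E2.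
  by rewrite [v]surjective_pairing E1 E2.
have cbl (a : R) (u v w : amb m) : cbr (a *: u + v) w = a *: cbr u w + cbr v w.
  by rewrite -c2_inZ -c2_inD -sp_BZl -sp_BDl.
have cbrr (a : R) (u v w : amb m) : cbr w (a *: u + v) = a *: cbr w u + cbr w v.
  by rewrite -c2_inZ -c2_inD -sp_BZr -sp_BDr.
have cb0l w : @cbr R m 0 w = 0 by congr (_, _, _); rewrite /= /sp_B linear0 !mul0mx mxE.
have cb0r w : @cbr R m w 0 = 0 by congr (_, _, _); rewrite /= /sp_B mulmx0 mxE.
have cb2l r w : @cbr R m (c2_in r) w = 0.
  by congr (_, _, _); rewrite /= /sp_B linear0 !mul0mx mxE.
have cb2r r w : @cbr R m w (c2_in r) = 0.
  by congr (_, _, _); rewrite /= /sp_B mulmx0 mxE.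
have c2gr r : c2_in r \in gr m (-2) by apply/gr2_canon; exists r.
have c1gr r : c1_in r \in gr m (-1) by apply/gr1_canon; exists r.
split.
- exists 2%N => p p2; apply: gr_canon0; by apply: contraTneq p2 => ->.
- exact: canon_direct.
- move=> p a u v _ _ _; congr (_, _, _); rewrite /= ?scaler0 ?addr0// mulmxDr -scalemxAr//.
- move=> p v p1 /gr_canonP[[pE [r ->]]|[-> [y ->]]|[-> [a [b ->]]]|->]; first by rewrite pE in p1.
  + by rewrite cJ_c1.
  + by rewrite cJ_m0 J_m0_mx; apply/gr0_canon; exists (- b), a.
  + by rewrite [cJ _](_ : _ = 0) ?mem0v//; congr (_, _, _); rewrite /= mulmx0.
- move=> p v p1 /gr_canonP[[pE [r ->]]|[_ [y ->]]|[_ [a [b ->]]]|->]; first by rewrite pE in p1.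
  + by rewrite !cJ_c1 sp_JJ c1_inN.
  + by rewrite !cJ_m0 !J_m0_mx -m0_inN m0_mxN.
  + by congr (_, _, _); rewrite /= ?mulmx0 ?oppr0.
- exact: cbl.
- exact: cbrr.
- move=> p q u v p0 q0.
  move=> /gr_canonP[[-> [r ->]]|[-> [x ->]]|[pE _]|->]; rewrite ?cb2l ?cb0l ?mem0v//; last by rewrite pE in p0.
  move=> /gr_canonP[[-> [r ->]]|[-> [y ->]]|[qE _]|->]; rewrite ?cb2r ?cb0r ?mem0v//; last by rewrite qE in q0.
  exact: c2gr.
- move=> p q u v p0 q0.
  move=> /gr_canonP[[_ [r ->]]|[_ [x ->]]|[pE _]|->]; rewrite ?cb2l ?cb0l ?cb2r ?cb0r ?oppr0//; last by rewrite pE in p0.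
  move=> /gr_canonP[[_ [r ->]]|[_ [y ->]]|[qE _]|->]; rewrite ?cb2r ?cb2l ?cb0l ?cb0r ?oppr0//; last by rewrite qE in q0.
  by rewrite !cbr_c1 -c2_inN -sp_B_anti.
- move=> p q r u v w _ _ _ _ _ _.
  have J0 x y z : @cbr R m x (cbr y z) = 0 by exact: cb2r.
  by rewrite !J0 !addr0.
- move=> _ _ /gr1_canon[v ->] /gr1_canon[w ->].
  by rewrite !cJ_c1 !cbr_c1 sp_B_J.
- move=> W W1 Wb p p0; apply/subvP => u.
  move=> /gr_canonP[[pE [r ->]]|[pE [x ->]]|[pE _]|->]; last exact: mem0v.
  (* Here [Zv (Complex 0 r) 0] is r e_3, so r e^{-2} is written as the bracket [e_1, r e_3]. *)
  + have -> : c2_in r = @cbr R m (c1_in (Zv 1 0)) (c1_in (Zv (Complex 0 r) 0)).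
      by rewrite cbr_c1 sp_BZ /=; congr c2_in; ring.
    by apply: Wb; apply: (subvP W1).
  + exact: (subvP W1).
  + by rewrite pE in p0.
- move=> _ /gr1_canon[v ->] v0; suff -> : v = 0 by [].
  by apply: sp_B_nondeg => w; have [] := v0 (c1_in w) (c1gr w).
- move=> p a u v w mu mv mw; have [p0|pN0] := eqVneq p 0%N; last by rewrite !L0// scaler0 addr0.
  subst p; apply: cx_bil_linearl => b x y z.
  by rewrite -c1_inZ -c1_inD scalemxAl -mulmxDl.
- move=> p a u v w mu mv mw; have [p0|pN0] := eqVneq p 0%N; last by rewrite !L0// scaler0 addr0.
  subst p; apply: cx_bil_linearr => b x y z.
  by rewrite -c1_inZ -c1_inD scalemxAr -mulmxDr.
- move=> p v w mv mw; have [p0|pN0] := eqVneq p 0%N; last first.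
    rewrite L0//; apply/m10P; rewrite !mem0v; split=> //; congr (_, _, _); rewrite /= ?mulmx0 ?oppr0//.
  subst p; move: mv mw => /m10_canon[a [b ->]] /m01_canon[y ->].
  have JQy z : sp_J R *m (m0_mx a b *m z) = - (m0_mx a b *m (sp_J R *m z)).
    by rewrite !mulmxA m0_mx_J mulNmx opprK.
  rewrite canon_L; apply/m10P; split.
  + exact: c1gr.
  + exact: c1gr.
  + by rewrite cJ_c1 -c1_inN -scalemxAr JQy scalerN.
  + by rewrite cJ_c1 -scalemxAr JQy sp_JJ mulmxN opprK.
- move=> p v ws ws' mv mws sws pws.
  have [p0|pN0] := eqVneq p 0%N; last first.
    have cL0 k w : @cL R m k 0 w = 0.
      case: k => // ; congr pair; rewrite /= !mul0mx; congr (_, _, _);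
        by rewrite /= ?subr0 ?addr0.
    have form0 k s : @core_form R m k 0 s = 0.
      elim: k s => [|k IH] [|w s] //; last first.
        by rewrite [LHS](_ : _ = @core_form R m k (cL k 0 w) s)// cL0 IH.
      by rewrite [LHS](_ : _ = (cbr 0 w.1 - cbr 0 w.2, cbr 0 w.2 + cbr 0 w.1))// !cb0l subrr addr0.
    by rewrite (m0 p v)// !form0.
  subst p; move: mv => /m10_canon[a [b vE]].
  have sym w1 w2 : m01 (-1) w1 -> m01 (-1) w2 ->
      core_form 1 v [:: w1; w2] = core_form 1 v [:: w2; w1].
    move=> /m01_canon[y ->] /m01_canon[z ->]; rewrite vE !canon_form.
    rewrite m0_mx_sym; congr (_, c2_in (4 * _)).
    have QJz : m0_mx a b *m (sp_J R *m z) = - (sp_J R *m (m0_mx a b *m z)) by rewrite !mulmxA m0_mx_J mulNmx.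
    by rewrite m0_mx_sym QJz sp_BNl sp_B_Jl opprK.
  move: ws sws mws pws => [|w1 [|w2 []]]// _ mws pws.
  have m1 : m01 (-1) w1 by apply: mws; rewrite mem_head.
  have m2 : m01 (-1) w2 by apply: mws; rewrite mem_behead// mem_head.
  by have [->|->] := perm_eq2 pws; [|exact: sym].
- move=> p v mv; have [p0|pN0] := eqVneq p 0%N; last by move=> _; exact: m0 mv.
  subst p; move: mv => /m10_canon[a [b ->]] L.
  have Q0 : m0_mx a b = 0.
    apply: mx_ext => y; rewrite mul0mx.
    have : m01 (-1) ((c1_in y, c1_in (sp_J R *m y)) : cx (amb m)) by apply/m01_canon; exists y.
    move=> /L; rewrite canon_L => -[E _]; have {}E : 2 *: (m0_mx a b *m y) = 0 := E.
    by move/eqP: E; rewrite scaler_eq0 pnatr_eq0 => /eqP.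
  have Q0' : m0_mx b (- a) = 0 by rewrite -[m0_mx b _]opprK m0_mxN opprK -J_m0_mx Q0 mulmx0 oppr0.
  by rewrite Q0 Q0'.
Qed.

End canon_core.

(** * Takagi factorization *)

Section closed_field.
Context (C : numClosedFieldType).

(* With [G = (x z; y w)] unitary up to scale, [G^T diag(1 + t', 1 - t') G = mu diag(1 + t, 1 - t)]
   forces [t = t']: the singular values of both sides agree up to a common factor. *)
Lemma diag_congruence_unique (x y z w mu lam t t' : C) :
  0 <= t <= 1 -> 0 <= t' <= 1 -> lam != 0 -> mu != 0 ->
  `|x| ^+ 2 + `|y| ^+ 2 = lam -> `|z| ^+ 2 + `|w| ^+ 2 = lam ->
  `|x| ^+ 2 * `|z| ^+ 2 = `|y| ^+ 2 * `|w| ^+ 2 ->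
  (1 + t') * x ^+ 2 + (1 - t') * y ^+ 2 = mu * (1 + t) ->
  (1 + t') * z ^+ 2 + (1 - t') * w ^+ 2 = mu * (1 - t) ->
  (1 + t') * (x * z) + (1 - t') * (y * w) = 0 -> t = t'.
Proof.
move=> /andP[t0 t1] /andP[t'0 t'1] lam0 mu0 h1 h2 h3 s1 s2 s3.
have n1 u : 0 <= u -> `|1 + u| = 1 + u :> C by move=> u0; rewrite ger0_norm// addr_ge0.
have n2 u : u <= 1 -> `|1 - u| = 1 - u :> C by move=> u0; rewrite ger0_norm// subr_ge0.
have two : 2 != 0 :> C by rewrite pnatr_eq0.
have m0 : `|mu| != 0 by rewrite normr_eq0.
have E1 : `|mu| * (1 + t) = `|(1 + t') * x ^+ 2 + (1 - t') * y ^+ 2|.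
  by rewrite s1 normrM n1.
have E2 : `|mu| * (1 - t) = `|(1 + t') * z ^+ 2 + (1 - t') * w ^+ 2|.
  by rewrite s2 normrM n2.
set X := `|x| ^+ 2 in h1 h3; set Y := `|y| ^+ 2 in h1 h3.
set Z := `|z| ^+ 2 in h2 h3; set W := `|w| ^+ 2 in h2 h3.
(* lam X = X Z + X W = Y W + X W = lam W: up to scale the matrix is unitary, so opposite entries
   have equal moduli. *)
have XW : X = W.
  apply: (mulfI lam0); rewrite -{1}h2 -h1 !mulrDl [Z * X]mulrC [W * X]mulrC h3 addrC.
  by [].
have YZ : Y = Z.
  by apply: (addrI X); rewrite h1 -h2 XW addrC.
have half (u v : C) : 2 * u = 2 * v -> u = v by exact: (mulfI two).
have finish (a : C) : a != 0 -> (1 + t') * a = `|mu| * (1 + t) -> (1 - t') * a = `|mu| * (1 - t) -> t = t'.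
  move=> a0 e1 e2; have aE : a = `|mu|.
    apply: half; transitivity ((1 + t') * a + (1 - t') * a); first by ring.
    by rewrite e1 e2; ring.
  by move: e1; rewrite mulrC -aE => /(mulfI a0)/addrI.
have finish' (a : C) : a != 0 -> (1 + t') * a = `|mu| * (1 - t) -> (1 - t') * a = `|mu| * (1 + t) -> t = t'.
  move=> a0 e1 e2; have aE : a = `|mu|.
    apply: half; transitivity ((1 + t') * a + (1 - t') * a); first by ring.
    by rewrite e1 e2; ring.
  move: e1; rewrite mulrC -aE => /(mulfI a0)/addrI tE.
  have t00 : t = 0 by apply/le_anti; rewrite t0 andbT -oppr_ge0 -tE.
  by rewrite tE t00 oppr0.
have nx (u : C) : `|(1 + t') * u ^+ 2 + (1 - t') * 0 ^+ 2| = (1 + t') * `|u| ^+ 2.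
  by rewrite expr0n mulr0 addr0 normrM n1// normrX.
have ny (u : C) : `|(1 + t') * 0 ^+ 2 + (1 - t') * u ^+ 2| = (1 - t') * `|u| ^+ 2.
  by rewrite expr0n mulr0 add0r normrM n2// normrX.
have X0P (u : C) : (`|u| ^+ 2 == 0) = (u == 0) by rewrite sqrf_eq0 normr_eq0.
(* If x = 0 then w = 0, and the matrix exchanges the two singular values; [finish'] shows that this
   is possible only for t = t' = 0. *)
have [x0|x0] := eqVneq x 0.
  have w0 : w = 0 by apply/eqP; rewrite -X0P -/W -XW /X x0 normr0 expr0n.
  apply: (finish' Y).
  - by apply: contra lam0 => /eqP Y0; rewrite -h1 Y0 /X x0 normr0 expr0n addr0.
  - by rewrite E2 w0 nx// YZ.
  - by rewrite E1 x0 ny.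
have [y0|y0] := eqVneq y 0.
  have z0 : z = 0 by apply/eqP; rewrite -X0P -/Z -YZ /Y y0 normr0 expr0n.
  apply: (finish X).
  - by rewrite X0P.
  - by rewrite E1 y0 nx.
  - by rewrite E2 z0 ny XW.
(* With x and y nonzero, the moduli of the two terms of [s3] give (1 + t')^2 = (1 - t')^2. *)
have t'0E : t' = 0.
  have : (1 + t') ^+ 2 * (X * Y) = (1 - t') ^+ 2 * (X * Y).
    have : `|(1 + t') * (x * z)| ^+ 2 = `|(1 - t') * (y * w)| ^+ 2.
      by congr (_ ^+ 2); move/eqP: s3; rewrite addr_eq0 => /eqP ->; rewrite normrN.
    rewrite !normrM n1// n2// !exprMn -/X -/Z -/Y -/W -YZ -XW => ->.
    by rewrite [Y * X]mulrC.
  have XY0 : X * Y != 0 by rewrite mulf_neq0// X0P.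
  move=> /(mulIf XY0) E.
  have /eqP : 4 * t' = 0.
    by transitivity ((1 + t') ^+ 2 - (1 - t') ^+ 2); [ring|rewrite E subrr].
  by rewrite mulf_eq0 pnatr_eq0 => /eqP.
(* Since x z = - y w when t' = 0, one has x^2 (z^2 + w^2) = w^2 (x^2 + y^2); then |x| = |w| equates
   the two diagonal moduli, so t = 0 too. *)
have F : X * `|z ^+ 2 + w ^+ 2| = X * `|x ^+ 2 + y ^+ 2|.
  rewrite {2}XW /X /W -!normrX -!normrM; congr `|_|.
  have E : (x * z) = - (y * w).
    by apply/eqP; rewrite -addr_eq0; apply/eqP; rewrite -s3 t'0E; ring.
  rewrite mulrDr -exprMn E; ring.
have X0 : X != 0 by rewrite X0P.
move: F => /(mulfI X0) F.
have F1 : `|mu| * (1 - t) = `|mu| * (1 + t).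
  rewrite E1 E2 t'0E addr0 subr0 !mul1r.
  by rewrite F.
move: F1 => /(mulfI m0)/addrI tE; rewrite t'0E.
apply: half; rewrite mulr0; transitivity (t - - t); first by ring.
by rewrite tE subrr.
Qed.

(* Coefficients of a unitary frame that diagonalises the complex symmetric form (a b; b c)
   with ordered nonnegative diagonal entries (Takagi factorisation). The orthogonality condition
   for the frame (1, u r), (- conj u r, 1) with r real is a real quadratic equation
   once the phase u is chosen to make its linear coefficient real. *)
Lemma takagi2 (a b c : C) : exists x y z w s1 s2 : C,
  [/\ x * x^* + y * y^* = 1, z * z^* + w * w^* = 1, x * z^* + y * w^* = 0, 0 <= s2 <= s1 &
   [/\ a * (x * x) + b * (x * y + y * x) + c * (y * y) = s1,
       a * (z * z) + b * (z * w + w * z) + c * (w * w) = s2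
     & a * (x * z) + b * (x * w + y * z) + c * (y * w) = 0]].
Proof.
have [q qE] : exists q : C, c * q - a * q^* + b * (1 - q * q^*) = 0.
  have [->|b0] := eqVneq b 0; first by exists 0; rewrite rmorph0 !mulr0 mul0r subrr addr0.
  pose c' := c / b; pose a' := a / b; pose k := c' + a'^*.
  (* Once k u is real, so is K = k u - 2 Re(a' conj u). For q = r u the equation becomes r^2 - K r -
     1 = 0, whose discriminant K^2 + 4 is nonnegative. *)
  have [u [uu ku]] : exists u : C, u * u^* = 1 /\ k * u \is Num.real.
    have [k0|k0] := eqVneq k 0; first by exists 1; rewrite conjC1 mulr1 k0 mul0r.
    have nk : `|k| != 0 by rewrite normr_eq0.
    exists (k^* / `|k|); split.
      rewrite rmorphM /= conjCK fmorphV /= conj_normC mulrACA -invfM -expr2 -normCKC.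
      by rewrite divff// sqrf_eq0.
    by rewrite mulrA -normCK expr2 mulfK// normr_real.
  pose K := c' * u - a' * u^*.
  have KR : K \is Num.real.
    have -> : K = k * u - (a' * u^* + (a' * u^*)^*).
      by rewrite rmorphM /= conjCK /K /k; ring.
    rewrite rpredB//; apply/CrealP; rewrite rmorphD /= conjCK addrC.
    by [].
  have dpos : 0 <= K ^+ 2 + 4 by rewrite addr_ge0// real_exprn_even_ge0.
  pose r := (K + sqrtC (K ^+ 2 + 4)) / 2.
  have rR : r^* = r.
    apply/CrealP; rewrite rpredM//; first by rewrite rpredD// ger0_real// sqrtC_ge0.
    by rewrite rpredV realn.
  have rE : K * r + 1 - r ^+ 2 = 0.
    have s2 := sqrtCK (K ^+ 2 + 4).
    rewrite /r; set s := sqrtC _ in s2 *.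
    have -> : K * ((K + s) / 2) + 1 - ((K + s) / 2) ^+ 2 = (K ^+ 2 + 4 - s ^+ 2) / 4 by field.
    by rewrite s2 subrr mul0r.
  exists (r * u); rewrite rmorphM /= rR.
  have -> : r * u * (r * u^*) = r ^+ 2 by rewrite mulrACA uu mulr1.
  have -> : c * (r * u) - a * (r * u^*) + b * (1 - r ^+ 2) = b * (K * r + 1 - r ^+ 2).
    by rewrite /K /c' /a'; field.
  by rewrite rE mulr0.
pose n := sqrtC (1 + q * q^*).
have n2 : n * n = 1 + q * q^* by rewrite -expr2 sqrtCK.
have npos : 0 < 1 + q * q^* by rewrite ltr_pwDl// mul_conjC_ge0.
have n0 : n != 0 by rewrite sqrtC_eq0 lt0r_neq0.
have nR : n^* = n by apply/CrealP; rewrite ger0_real// sqrtC_ge0 ltW.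
(* Scaling a frame vector by om multiplies its diagonal entry by om^2, so an inverse square root of
   s / |s| makes the entry equal to |s|. *)
have phase (s : C) : exists om : C, om * om^* = 1 /\ om * om * s = `|s|.
  have [->|s0] := eqVneq s 0; first by exists 1; rewrite conjC1 !mulr1 mul1r normr0.
  have ns : `|s| != 0 by rewrite normr_eq0.
  exists (sqrtC (s / `|s|))^-1.
  have n1 : `|sqrtC (s / `|s|)| = 1.
    by apply/eqP; rewrite -sqrp_eq1// -normrX sqrtCK normrM normfV normr_id divff.
  split; first by rewrite -normCK normfV n1 invr1 expr1n.
  rewrite -invfM -expr2 sqrtCK invf_div divfK//.
have wlog_frame : exists x y z w : C,
    [/\ x * x^* + y * y^* = 1, z * z^* + w * w^* = 1, x * z^* + y * w^* = 0
     & a * (x * z) + b * (x * w + y * z) + c * (y * w) = 0].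
  exists n^-1, (q / n), (- q^* / n), n^-1.
  rewrite !rmorphM !rmorphN !fmorphV /= nR conjCK; split.
  - have -> : n^-1 / n + q / n * (q^* / n) = (1 + q * q^*) / (n * n) by field.
    by rewrite n2 divff// lt0r_neq0.
  - have -> : - q^* / n * (- q / n) + n^-1 / n = (1 + q * q^*) / (n * n) by field.
    by rewrite n2 divff// lt0r_neq0.
  - by field.
  - have -> : a * (n^-1 * (- q^* / n)) + b * (n^-1 / n + q / n * (- q^* / n)) + c * (q / n / n)
      = (c * q - a * q^* + b * (1 - q * q^*)) / (n * n) by field.
    by rewrite qE mul0r.
move: wlog_frame => [x [y [z [w [h1 h2 h3 h4]]]]].
pose S1 := a * (x * x) + b * (x * y + y * x) + c * (y * y).
pose S2 := a * (z * z) + b * (z * w + w * z) + c * (w * w).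
have [p1 [p1u p1E]] := phase S1; have [p2 [p2u p2E]] := phase S2.
have [X [Y [Z [W [H1 H2 H3 H4 [A1 A2]]]]]] : exists X Y Z W : C,
    [/\ X * X^* + Y * Y^* = 1, Z * Z^* + W * W^* = 1, X * Z^* + Y * W^* = 0,
        a * (X * Z) + b * (X * W + Y * Z) + c * (Y * W) = 0 &
        a * (X * X) + b * (X * Y + Y * X) + c * (Y * Y) = `|S1| /\ 
        a * (Z * Z) + b * (Z * W + W * Z) + c * (W * W) = `|S2|].
  exists (p1 * x), (p1 * y), (p2 * z), (p2 * w); rewrite !rmorphM; split.
  - by rewrite mulrACA [X in _ + X]mulrACA -mulrDr p1u h1 mulr1.
  - by rewrite mulrACA [X in _ + X]mulrACA -mulrDr p2u h2 mulr1.
  - by rewrite mulrACA [X in _ + X]mulrACA -mulrDr h3 mulr0.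
  - by rewrite -[RHS](mulr0 (p1 * p2)) -h4; ring.
  - by rewrite -p1E -p2E /S1 /S2; split; ring.
have [le21|/ltW le12] := real_leP (normr_real S2) (normr_real S1).
  by exists X, Y, Z, W, `|S1|, `|S2|; rewrite normr_ge0; split.
exists Z, W, X, Y, `|S2|, `|S1|; rewrite normr_ge0; split => //.
  by have := congr1 (fun u => u^*) H3; rewrite rmorphD !rmorphM /= !conjCK rmorph0 mulrC => <-; ring.
by split=> //; rewrite -H4; ring.
Qed.

End closed_field.

(** * Uniqueness of the canonical form *)

Section unique.
Context (R : realType).
Local Notation C := (R[i]).

Lemma sp_BJZ (p q p' q' : C) : sp_B (sp_J R *m Zv p q) (Zv p' q') =
  complex.Re (p * conjc p' + q * conjc q').
Proof. by rewrite sp_JZ sp_BZ; case: p q p' q' => [? ?] [? ?] [? ?] [? ?] /=; ring. Qed.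

(** The vectors with [p]-coordinates (1, 0) and (0, 1) have [p']-coordinates forming the columns of
    the matrix of [diag_congruence_unique]. Real parts of Hermitian products are reached through J,
    imaginary parts through B. The maps [p] and [p'] are related only on [D], so that [V] may be a
    core or a space of tangent vectors. *)
Lemma canon_S_unique (t t' lam : R) (mu : C) (V : Type) (D : set V) (p p' : V -> 'cV[R]_4) :
  0 <= t <= 1 -> 0 <= t' <= 1 -> lam != 0 -> mu != 0 ->
  (forall y, exists2 v, D v & p v = y) ->
  (forall v, D v -> exists w, [/\ D w, p w = sp_J R *m p v & p' w = sp_J R *m p' v]) ->
  (forall v w, D v -> D w -> sp_B (p' v) (p' w) = lam * sp_B (p v) (p w)) ->
  (forall v w, D v -> D w -> canon_S t' (p' v) (p' w) = mu * canon_S t (p v) (p w)) ->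
  t = t'.
Proof.
move=> t01 t'01 lam0 mu0 psurj pJ pB pS.
have [v1 D1 e1] := psurj (Zv 1 0); have [v2 D2 e2] := psurj (Zv 0 1).
pose x := zc1 (p' v1); pose y := zc2 (p' v1); pose z := zc1 (p' v2); pose w := zc2 (p' v2).
have u1 : p' v1 = Zv x y by rewrite ZvK.
have u2 : p' v2 = Zv z w by rewrite ZvK.
clearbody x y z w.
have H v v' : D v -> D v' ->
    complex.Re (zc1 (p' v) * conjc (zc1 (p' v')) + zc2 (p' v) * conjc (zc2 (p' v'))) =
    lam * complex.Re (zc1 (p v) * conjc (zc1 (p v')) + zc2 (p v) * conjc (zc2 (p v'))).
  move=> Dv Dv'; rewrite -!sp_BJZ !ZvK.
  by have [w' [Dw <- <-]] := pJ v Dv; exact: pB.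
have h11 := H _ _ D1 D1; have h22 := H _ _ D2 D2; have h12 := H _ _ D1 D2.
have b12 := pB _ _ D1 D2.
have s11 := pS _ _ D1 D1; have s22 := pS _ _ D2 D2; have s12 := pS _ _ D1 D2.
move: h11 h22 h12 b12 s11 s22 s12; rewrite /canon_S e1 e2 u1 u2 !sp_BZ !zc1Z !zc2Z => h11 h22 h12 b12 s11 s22 s12.
have nE (c : C) : `|c| ^+ 2 = Complex (complex.Re c ^+ 2 + complex.Im c ^+ 2) 0.
  by rewrite sqr_normc; case: c => ? ?; apply: eqC => /=; ring.
have cI (u v : R) : u <= v -> Complex u 0 <= Complex v 0 by rewrite lecR.
have cD (u : R) : Complex (1 + u) 0 = 1 + Complex u 0 by apply: eqC; rewrite /= ?addr0.
have cB (u : R) : Complex (1 - u) 0 = 1 - Complex u 0 by apply: eqC; rewrite /= ?subr0.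
rewrite !(cD t, cB t) in s11 s22 s12.
apply: (@complexI R); change (Complex t 0 = Complex t' 0).
apply: (@diag_congruence_unique _ x y z w mu (Complex lam 0)) => //.
- by rewrite -[1]/(Complex 1 0) !lecR.
- by rewrite -[1]/(Complex 1 0) !lecR.
- by apply: contra lam0 => /eqP[->].
- rewrite !nE; apply: eqC => /=; last by ring.
  move: h11; case: x {u1 h12 b12 s11 s12} => ? ?; case: y => ? ? /=.
  by lra.
- rewrite !nE; apply: eqC => /=; last by ring.
  move: h22; case: z {u2 h12 b12 s22 s12} => ? ?; case: w => ? ? /=.
  by lra.
- rewrite !nE; apply: eqC => /=; last by ring.
  move: h12 b12; case: x {u1 h11 s11 s12} => a b; case: y => c d; case: z {u2 h22 s22} => a' b'; case: w => c' d' /=.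
  move=> h b12.
  (* Real and imaginary parts of x conj z = - y conj w; taking squared moduli gives the claim. *)
  have E1 : a * a' + b * b' = - (c * c' + d * d') by lra.
  have E2 : a * b' - b * a' = - (c * d' - d * c') by lra.
  transitivity ((a * a' + b * b') ^+ 2 + (a * b' - b * a') ^+ 2); first by ring.
  by rewrite E1 E2; ring.
- by rewrite !expr2 -(cD t') -(cB t') s11; ring.
- by rewrite !expr2 -(cD t') -(cB t') s22; ring.
- by rewrite -(cD t') -(cB t') s12; ring.
Qed.

End unique.

(** * The symmetric form of L^2 on m_t *)

Section canon_formC.
Context (R : realType) (t : R).
Local Notation C := (R[i]).
Local Notation m := (canon_core t).

Lemma scale_c2 (k : C) : k *: ((c2_in 1, 0) : cx (amb m)) = (c2_in (complex.Re k), c2_in (complex.Im k)).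
Proof. by case: k => a b; rewrite cx_scaleE /= !scaler0 subr0 add0r -!c2_inZ !mulr1. Qed.

Lemma canon_formC (v : cx (amb m)) : m10 0 v -> exists c : C, (v <> 0 -> c != 0) /\
  forall y z, core_form 1 v [:: (c1_in y, c1_in (sp_J R *m y)); (c1_in z, c1_in (sp_J R *m z))] =
    (c * canon_S t y z) *: ((c2_in 1, 0) : cx (amb m)).
Proof.
(* For S = [canon_S t y z], [canon_form] gives 4 B([m0_mx a b] y, z) = -2 Im((b + i a) conj S) =
   Re(-2 (a + i b) S), and the second component is the matching imaginary part. *)
move=> /m10_canon[a [b ->]]; exists (Complex (- 2 * a) (- 2 * b)); split.
  apply: contra_not_neq => -[a0 b0].
  have -> : a = 0 by lra.
  have -> : b = 0 by lra.
  by rewrite oppr0 /m0_mx !scale0r addr0.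
move=> y z; rewrite canon_form scale_c2.
rewrite -(ZvK y) -(ZvK z) sp_JZ m0_mx_mul !sp_BZ /canon_S !zc1Z !zc2Z.
move: (zc1 y) (zc2 y) (zc1 z) (zc2 z) => [? ?] [? ?] [? ?] [? ?].
by congr (c2_in _, c2_in _); rewrite /=; field.
Qed.

End canon_formC.

Section core_maps.
Context (R : realType).
Local Notation C := (R[i]).

Lemma abstract_m01 (m : coreData R) v : abstract_core m -> v \in gr m (-1) ->
  m01 (-1) ((v, cJ v) : cx (amb m)).
Proof.
move=> mA vV; apply/m01P; split=> //=; first exact: core_J_graded mA _ _ _ vV.
exact: core_J_square mA _ _ _ vV.
Qed.

Lemma abstract_m10 (m : coreData R) p v : abstract_core m -> -1 <= p -> v \in gr m p ->
  m10 p ((v, - cJ v) : cx (amb m)).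
Proof.
move=> mA p1 vV; have JV : cJ v \in gr m p by exact: core_J_graded mA _ _ _ vV.
have J2 := core_J_square mA p1 vV.
have JN : cJ (- cJ v) = v.
  have := core_J_linear mA (-1) p1 JV (mem0v _).
  have J0 : cJ (0 : amb m) = 0.
    have := core_J_linear mA (-1) p1 (mem0v (gr m p)) (mem0v _).
    by rewrite scaleN1r oppr0 addr0 scaleN1r addNr.
  by rewrite J0 !addr0 !scaleN1r J2 opprK.
by apply/m10P; split; rewrite ?memvN//= opprK.
Qed.

(** Each isomorphism gives a coordinate system on m^{-1}. The bracket and the form of one fixed
    vector of m^{0(10)} are expressed in both, and [canon_S_unique] compares them. *)
Lemma core_iso_unique (m : coreData R) t t' : abstract_core m -> type_B m ->
  0 <= t <= 1 -> 0 <= t' <= 1 ->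
  core_iso m (canon_core t) -> core_iso m (canon_core t') -> t = t'.
Proof.
move=> mA [d2 d1 d0 _] t01 t'01 [f [fg fi fJ fb fL]] [f' [fg' fi' fJ' fb' fL']].
have [/andP[t0 _] /andP[t'0 _]] := (t01, t'01).
have [e e2 e0] : exists2 e, e \in gr m (-2) & e != 0.
  exists (vpick (gr m (-2))); first exact: memv_pick.
  by rewrite vpick0 -dimv_eq0 d2.
have E2 u : u \in gr m (-2) -> exists r, u = r *: e.
  have eE : <[e]>%VS = gr m (-2) by apply/eqP; rewrite eqEdim d2 dim_vline e0 andbT -memvE.
  by rewrite -eE => /vlineP.
have [a a0 an0] : exists2 a, a \in gr m 0 & a != 0.
  exists (vpick (gr m 0)); first exact: memv_pick.
  by rewrite vpick0 -dimv_eq0 d0.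
pose v0 : cx (amb m) := (a, - cJ a).
have v0m : m10 0 v0 by exact: abstract_m10.
(* What one isomorphism contributes: r is its scale on m^{-2} and c the factor of [canon_formC] for
   the image of [v0]. *)
have step s (g : 'Hom(amb m, amb (canon_core s))) : 0 <= s ->
    (forall p, (g @: gr m p)%VS = gr (canon_core s) p) ->
    (forall p v, v \in gr m p -> g v = 0 -> v = 0) ->
    (forall p v, -1 <= p -> v \in gr m p -> g (cJ v) = cJ (g v)) ->
    (forall p q v w, p < 0 -> q < 0 -> v \in gr m p -> w \in gr m q -> g (cbr v w) = cbr (g v) (g w)) ->
    (forall (p : nat) v w, m10 p%:Z v -> m01 (-1) w -> cx_map g (cL p v w) = cL p (cx_map g v) (cx_map g w)) ->
    exists (r : R) (c : C), [/\ r != 0, c != 0 &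
     forall v w, v \in gr m (-1) -> w \in gr m (-1) ->
      [/\ g v = c1_in (g v).1.2,
       (forall k, cbr v w = k *: e -> sp_B (g v).1.2 (g w).1.2 = k * r) &
       (forall k : C, core_form 1 v0 [:: ((v, cJ v) : cx (amb m)); (w, cJ w)] = k *: ((e, 0) : cx (amb m)) ->
        c * canon_S s (g v).1.2 (g w).1.2 = k * Complex r 0)]].
  move=> s0 gg gi gJ gb gL.
  have [r rE] : exists r, g e = c2_in r by apply/gr2_canon; rewrite -gg memv_img.
  have r0 : r != 0.
    by apply: contra e0 => /eqP r0; apply/eqP; apply: (gi _ _ e2); rewrite rE r0.
  have gv0 : m10 0 (cx_map g v0 : cx (amb (canon_core s))).
    have [v1 v2 J1 J2] := (m10P _ _).1 v0m.
    apply/m10P; split.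
    - by rewrite -gg memv_img.
    - by rewrite -gg memv_img.
    - by change (cJ (g v0.1) = - g v0.2); rewrite -(gJ 0)// J1 linearN.
    - by change (cJ (g v0.2) = g v0.1); rewrite -(gJ 0)// J2.
  have [c [c0 cE]] := canon_formC gv0.
  exists r, c; split=> //.
    apply: c0 => -[ga _]; have /eqP := gi _ _ a0 ga.
    by rewrite (negPf an0).
  have g1 v : v \in gr m (-1) -> g v = c1_in (g v).1.2.
    by move=> vV; have [x ->] : exists x, g v = c1_in x by apply/gr1_canon; rewrite -gg memv_img.
  move=> v w vV wV; split=> [|k kE|k kE]; first exact: g1.
    have := gb _ _ _ _ _ _ vV wV; rewrite kE linearZ /= rE => /(_ isT isT).
    rewrite -c2_inZ => E; have := congr1 (fun u : ambB R => u.1.1) E.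
    by [].
  have gJv u : u \in gr m (-1) -> cx_map g ((u, cJ u) : cx (amb m)) =
      (c1_in (g u).1.2, c1_in (sp_J R *m (g u).1.2)).
    by move=> uV; rewrite /cx_map /= (gJ _ _ _ uV)// {1 2}(g1 _ uV) cJ_c1.
  have mv := abstract_m01 mA vV; have mw := abstract_m01 mA wV.
  have := cE (g v).1.2 (g w).1.2; rewrite -!gJv//.
  have -> : core_form 1 (cx_map g v0 : cx (amb (canon_core s)))
      [:: cx_map g ((v, cJ v) : cx (amb m)); cx_map g ((w, cJ w) : cx (amb m))] =
      cx_map g (core_form 1 v0 [:: ((v, cJ v) : cx (amb m)); (w, cJ w)]).
    have [u1 u2 _ _] := (m10P _ _).1 (core_L_target mA v0m mv).
    have [w1 w2 _ _] := (m01P _ _).1 mw.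
    rewrite /core_form -gL//; move: (cL 0 v0 _) u1 u2 => u u1 u2.
    rewrite /cx_map /cx_bil /= linearB linearD /=.
    by rewrite !(gb _ _ _ _ _ _ u1 w1)// !(gb _ _ _ _ _ _ u1 w2)// !(gb _ _ _ _ _ _ u2 w1)// !(gb _ _ _ _ _ _ u2 w2).
  rewrite kE => E; rewrite scale_c2 in E.
  have : cx_map g (k *: ((e, 0) : cx (amb m))) = (k * Complex r 0) *: ((c2_in 1, 0) : cx (amb (canon_core s))).
    rewrite scale_c2; case: k {kE E} => k1 k2; rewrite cx_scaleE /cx_map /= !scaler0 subr0 add0r !linearZ /= rE.
    by rewrite -!c2_inZ; congr (c2_in _, c2_in _); ring.
  rewrite E scale_c2 => -[]; move: (c * _) (k * _) => z z' F1 F2.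
  by apply: eqC.
have [r [c [r0 c0 H]]] := step _ f t0 fg fi fJ fb fL.
have [r' [c' [r'0 c'0 H']]] := step _ f' t'0 fg' fi' fJ' fb' fL'.
(* From c S = k r and c' S' = k r', with k the value of the form on m, one gets S' = (c r' / (c' r))
   S; the brackets scale by r' / r. *)
apply: (@canon_S_unique _ t t' (r' / r) (c * Complex r' 0 / (c' * Complex r 0)) _
  [set v | v \in gr m (-1)] (fun v => (f v).1.2) (fun v => (f' v).1.2)) => //.
- by rewrite mulf_neq0// invr_eq0.
- have nC (u : R) : u != 0 -> Complex u 0 != 0 :> C by apply: contra => /eqP[->].
  by rewrite !mulf_neq0// ?invr_eq0 ?mulf_neq0// nC.
- move=> y; have : c1_in y \in gr (canon_core t) (-1) by apply/gr1_canon; exists y.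
  by rewrite -fg => /memv_imgP[v vV ve]; exists v => //; rewrite -ve.
- move=> v vV; have JV : cJ v \in gr m (-1) by exact: core_J_graded mA _ _ _ vV.
  exists (cJ v); split; first exact: JV.
    by rewrite (fJ (-1)).
  by rewrite (fJ' (-1)).
- move=> v w vV wV; have [_ B _] := H v w vV wV; have [_ B' _] := H' v w vV wV.
  have [k kE] : exists k, cbr v w = k *: e.
    by apply: E2; have := core_br_graded mA _ _ vV wV; apply.
  by rewrite (B _ kE) (B' _ kE); field.
- move=> v w vV wV; have [_ _ S] := H v w vV wV; have [_ _ S'] := H' v w vV wV.
  have [k kE] : exists k : C,
      core_form 1 v0 [:: ((v, cJ v) : cx (amb m)); (w, cJ w)] = k *: ((e, 0) : cx (amb m)).
    have [u1 u2 _ _] := (m10P _ _).1 (core_L_target mA v0m (abstract_m01 mA vV)).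
    have JW : cJ w \in gr m (-1) by exact: core_J_graded mA _ _ _ wV.
    have b2 x y : x \in gr m (-1) -> y \in gr m (-1) -> cbr x y \in gr m (-2).
      by move=> xV yV; have := core_br_graded mA _ _ xV yV; apply.
    rewrite /core_form; move: (cL 0 v0 _) u1 u2 => u u1 u2.
    have [k1 E1] := E2 _ (rpredB (b2 _ _ u1 wV) (b2 _ _ u2 JW)).
    have [k2 E3] := E2 _ (rpredD (b2 _ _ u1 JW) (b2 _ _ u2 wV)).
    by exists (Complex k1 k2); rewrite cx_scaleE /cx_bil !scaler0 subr0 add0r -E1 -E3.
  have rC : Complex r 0 != 0 :> C by apply: contra r0 => /eqP[->].
  have := S' _ kE; have := S _ kE.
  move: (canon_S t' _ _) (canon_S t _ _) => s' s f1 f2.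
  apply: (mulfI c'0); rewrite f2; apply: (mulIf rC).
  transitivity (k * Complex r 0 * Complex r' 0); first by ring.
  by rewrite -f1; field; rewrite rC c'0.
Qed.

End core_maps.

(** * Existence of the canonical form *)

Section frames.
Context (R : realType) (m : coreData R).
Local Notation C := (R[i]).
Hypothesis mA : abstract_core m.

Lemma core_J0 : cJ (0 : amb m) = 0.
Proof.
have := core_J_linear mA (-1) (lexx (-1)) (mem0v (gr m (-1))) (mem0v _).
by rewrite scaleN1r oppr0 addr0 scaleN1r addNr.
Qed.

Lemma core_JZ p (a : R) u : -1 <= p -> u \in gr m p -> cJ (a *: u) = a *: cJ u.
Proof.
by move=> p1 up; have := core_J_linear mA a p1 up (mem0v _); rewrite !addr0 core_J0 addr0.
Qed.

Lemma core_JD p u v : -1 <= p -> u \in gr m p -> v \in gr m p -> cJ (u + v) = cJ u + cJ v.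
Proof.
by move=> p1 up vp; have := core_J_linear mA 1 p1 up vp; rewrite !scale1r.
Qed.

Lemma core_JN p u : -1 <= p -> u \in gr m p -> cJ (- u) = - cJ u.
Proof. by move=> p1 up; rewrite -scaleN1r (core_JZ _ p1 up) scaleN1r. Qed.

Lemma core_brDl u v w : @cbr R m (u + v) w = cbr u w + cbr v w.
Proof. by have := core_br_linearl mA 1 u v w; rewrite !scale1r. Qed.

Lemma core_brDr u v w : @cbr R m w (u + v) = cbr w u + cbr w v.
Proof. by have := core_br_linearr mA 1 u v w; rewrite !scale1r. Qed.

Lemma core_br0l w : @cbr R m 0 w = 0.
Proof. by have := core_br_linearl mA (-1) 0 0 w; rewrite scaleN1r oppr0 addr0 scaleN1r addNr. Qed.

Lemma core_br0r w : @cbr R m w 0 = 0.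
Proof. by have := core_br_linearr mA (-1) 0 0 w; rewrite scaleN1r oppr0 addr0 scaleN1r addNr. Qed.

Lemma core_brZl a u w : @cbr R m (a *: u) w = a *: cbr u w.
Proof. by have := core_br_linearl mA a u 0 w; rewrite !addr0 core_br0l addr0. Qed.

Lemma core_brZr a u w : @cbr R m w (a *: u) = a *: cbr w u.
Proof. by have := core_br_linearr mA a u 0 w; rewrite !addr0 core_br0r addr0. Qed.

Lemma core_brNl u w : @cbr R m (- u) w = - cbr u w.
Proof. by rewrite -scaleN1r core_brZl scaleN1r. Qed.

Lemma core_brNr u w : @cbr R m w (- u) = - cbr w u.
Proof. by rewrite -scaleN1r core_brZr scaleN1r. Qed.

Let V1 : (-1 : int) <= -1 := lexx _.

Lemma core_br_JN v w : v \in gr m (-1) -> w \in gr m (-1) -> cbr (cJ v) w = - cbr v (cJ w).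
Proof.
move=> vV wV; have JV := core_J_graded mA V1 vV.
by rewrite -(core_br_J mA JV wV) (core_J_square mA V1 vV) core_brNl.
Qed.

(** An identification of c^{-1} with m^{-1} as complex symplectic spaces, relative to the generator
    e of m^{-2}. That it is onto is derived in [frame_onto]. *)
Definition frame (e : amb m) (psi : 'cV[R]_4 -> amb m) : Prop :=
  [/\ forall a x y, psi (a *: x + y) = a *: psi x + psi y, forall x, psi x \in gr m (-1),
     forall x, psi (sp_J R *m x) = cJ (psi x)
   & forall x y, cbr (psi x) (psi y) = sp_B x y *: e].

(** Gram-Schmidt for the positive definite Hermitian form with real part B(J v, w). *)
Lemma frame_exists (e : amb m) (B : amb m -> amb m -> R) : e != 0 -> \dim (gr m (-1)) = 4%N ->
  (forall v w, v \in gr m (-1) -> w \in gr m (-1) -> cbr v w = B v w *: e) ->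
  (forall v, v \in gr m (-1) -> v != 0 -> 0 < B (cJ v) v) ->
  exists psi, frame e psi.
Proof.
move=> e0 d1 BE Bpos; set V := gr m (-1) in d1 BE Bpos *.
have JV v : v \in V -> cJ v \in V by move=> vV; exact: (@core_J_graded _ _ mA (-1) v V1 vV).
have J2 v : v \in V -> cJ (cJ v) = - v by move=> vV; exact: (@core_J_square _ _ mA (-1) v V1 vV).
have brA v w : v \in V -> w \in V -> cbr v w = - cbr w v.
  by move=> vV wV; exact: (@core_br_anti _ _ mA (-1) (-1) v w isT isT vV wV).
have br0 v : v \in V -> cbr v v = 0.
  move=> vV; have := brA v v vV vV => /eqP; rewrite -addr_eq0 -mulr2n -scaler_nat scaler_eq0.
  by rewrite pnatr_eq0 => /eqP.
have unit v : v \in V -> v != 0 -> exists2 k : R, k != 0 & cbr (cJ (k *: v)) (k *: v) = e.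
  move=> vV v0; have Bv := Bpos v vV v0; exists (Num.sqrt (B (cJ v) v))^-1.
    by rewrite invr_eq0 lt0r_neq0// sqrtr_gt0.
  rewrite (core_JZ _ V1 vV) core_brZl core_brZr BE ?JV// !scalerA -invfM -expr2 sqr_sqrtr ?ltW//.
  by rewrite mulVf ?scale1r// lt0r_neq0.
have [y1 y1V [y10 h1]] : exists2 y1, y1 \in V & y1 != 0 /\ cbr (cJ y1) y1 = e.
  have p0 : vpick V != 0 by rewrite vpick0 -dimv_eq0 d1.
  have [k k0 kE] := unit _ (memv_pick V) p0; exists (k *: vpick V); first by rewrite memvZ ?memv_pick.
  by rewrite scaler_eq0 negb_or k0.
(* Two vectors cannot span the four-dimensional m^{-1}. *)
have [w wV wN] : exists2 w, w \in V & w \notin <<[:: y1; cJ y1]>>%VS.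
  apply/subvPn; apply/negP => /dimvS; rewrite d1 => h.
  by have := leq_trans h (dim_span _).
(* These are the real and imaginary parts of the Hermitian product with the unit vector y1;
   subtracting both makes w' orthogonal to the complex line of y1. *)
pose c1 := B (cJ w) y1; pose c2 := B w y1.
pose w' := w - c1 *: y1 - c2 *: cJ y1.
have w'V : w' \in V by rewrite !rpredB ?rpredZ ?JV.
have w'0 : w' != 0.
  apply: contra wN => /eqP w'0.
  have -> : w = c1 *: y1 + c2 *: cJ y1 by apply/eqP; rewrite -subr_eq0 opprD addrA -/w' w'0.
  by rewrite rpredD// rpredZ// memv_span// !inE eqxx ?orbT.
have h1' : cbr y1 (cJ y1) = - e by rewrite brA ?JV// h1.
have o1 : cbr w' y1 = 0.
  rewrite /w' !core_brDl !core_brNl !core_brZl br0// scaler0 oppr0 addr0 h1 BE//.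
  by rewrite subrr.
have o2 : cbr (cJ w') y1 = 0.
  have -> : cJ w' = cJ w - c1 *: cJ y1 + c2 *: y1.
    rewrite /w' (core_JD V1) ?rpredB ?rpredN ?rpredZ ?JV// (core_JD V1) ?rpredN ?rpredZ//.
    rewrite !(core_JN V1) ?rpredZ ?JV// !(core_JZ _ V1) ?JV// J2// scalerN opprK.
    by [].
  rewrite !core_brDl !core_brNl !core_brZl br0// scaler0 addr0 h1 BE ?JV//.
  by rewrite subrr.
have [k k0 h2] := unit _ w'V w'0.
pose y2 := k *: w'.
have y2V : y2 \in V by rewrite rpredZ.
have {}o1 : cbr y2 y1 = 0 by rewrite core_brZl o1 scaler0.
have {}o2 : cbr (cJ y2) y1 = 0 by rewrite (core_JZ _ V1 w'V) core_brZl o2 scaler0.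
have h2' : cbr y2 (cJ y2) = - e by rewrite brA ?JV// h2.
have o3 : cbr y2 (cJ y1) = 0 by rewrite -[LHS]opprK -core_br_JN// o2 oppr0.
have o4 : cbr (cJ y2) (cJ y1) = 0 by rewrite core_br_J.
have o5 : cbr y1 y2 = 0 by rewrite brA// o1 oppr0.
have o6 : cbr y1 (cJ y2) = 0 by rewrite brA ?JV// o2 oppr0.
have o7 : cbr (cJ y1) y2 = 0 by rewrite brA ?JV// o3 oppr0.
have o8 : cbr (cJ y1) (cJ y2) = 0 by rewrite core_br_J.
have z1 := br0 _ y1V; have z2 := br0 _ y2V.
have z3 := br0 _ (JV _ y1V); have z4 := br0 _ (JV _ y2V).
(* Multiplication by i is - J in these coordinates, hence the minus signs. *)
pose psi (x : 'cV[R]_4) : amb m := complex.Re (zc1 x) *: y1 - complex.Im (zc1 x) *: cJ y1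
   + (complex.Re (zc2 x) *: y2 - complex.Im (zc2 x) *: cJ y2).
exists psi; split.
- move=> a x y; rewrite /psi /= !mxE !scalerDl !scalerDr -!scalerA !opprD -!scalerN.
  by rewrite [LHS](AC ((2*2)*(2*2)) (((1*3)*(5*7))*((2*4)*(6*8))))%AC.
- by move=> x; rewrite rpredD ?rpredB ?rpredZ ?JV.
- move=> x; rewrite -(ZvK x) sp_JZ /psi !zc1Z !zc2Z.
  have JL a b y : y \in V -> cJ (a *: y - b *: cJ y) = b *: y + a *: cJ y.
    move=> yV; rewrite (core_JD V1) ?rpredN ?rpredZ ?JV// (core_JN V1) ?rpredZ ?JV//.
    by rewrite !(core_JZ _ V1) ?JV// J2// scalerN opprK addrC.
  rewrite (core_JD V1) ?rpredB ?rpredZ ?JV// !JL//.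
  move: (zc1 x) (zc2 x) => [a b] [c d] /=.
  rewrite -[- (_ *: cJ y1)]scaleNr -[- (_ *: cJ y2)]scaleNr.
  by congr (_ *: y1 + _ *: cJ y1 + (_ *: y2 + _ *: cJ y2)); ring.
- move=> x y.
  have L v : cbr (psi x) v = complex.Re (zc1 x) *: cbr y1 v - complex.Im (zc1 x) *: cbr (cJ y1) v
     + (complex.Re (zc2 x) *: cbr y2 v - complex.Im (zc2 x) *: cbr (cJ y2) v).
    by rewrite /psi !core_brDl !core_brNl !core_brZl.
  have Rr v : cbr v (psi y) = complex.Re (zc1 y) *: cbr v y1 - complex.Im (zc1 y) *: cbr v (cJ y1)
     + (complex.Re (zc2 y) *: cbr v y2 - complex.Im (zc2 y) *: cbr v (cJ y2)).
    by rewrite /psi !core_brDr !core_brNr !core_brZr.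
  rewrite L !Rr h1 h2 h1' h2' o1 o2 o3 o4 o5 o6 o7 o8 z1 z2 z3 z4.
  rewrite !(scaler0, oppr0, addr0, add0r, sub0r, scalerN, opprK) -!(scalerBr, scalerA, scalerBl, scalerDl, scaleNr).
  rewrite -(ZvK x) -(ZvK y) sp_BZ !zc1Z !zc2Z.
  move: (zc1 x) (zc2 x) (zc1 y) (zc2 y) => [? ?] [? ?] [? ?] [? ?] /=.
  by rewrite !scalerA -!scalerDl; congr (_ *: _); ring.
Qed.

(** Nondegeneracy of B makes psi injective, and both spaces have dimension 4. *)
Lemma frame_onto e psi v : e != 0 -> \dim (gr m (-1)) = 4%N -> frame e psi ->
  v \in gr m (-1) -> exists x, v = psi x.
Proof.
move=> e0 d1 [psiL psiV psiJ psiB] vV.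
have lin : linear psi by exact: psiL.
pose P : {linear 'cV[R]_4 -> amb m} := HB.pack psi (GRing.isLinear.Build R _ _ _ _ lin).
have : v \in limg (linfun P).
  have /eqP -> // : limg (linfun P) == gr m (-1).
  rewrite eqEdim; apply/andP; split.
    by apply/subvP => _ /memv_imgP[x _ ->]; rewrite lfunE psiV.
  rewrite d1 limg_dim_eq ?dimvf//; apply/eqP; rewrite -subv0; apply/subvP => x.
  rewrite memv_cap memv_ker lfunE memv0 => /andP[_ /eqP x0].
  apply/eqP; apply: sp_B_nondeg => y; have := psiB x y.
  rewrite [psi x]x0 core_br0l => /esym/eqP; rewrite scaler_eq0 (negPf e0) orbF.
  by move/eqP.
by move=> /memv_imgP[x _ ->]; exists x; rewrite lfunE.
Qed.

(* The vector of m^{-1(01)} with real part [psi x]. *)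
Definition bar (psi : 'cV[R]_4 -> amb m) (x : 'cV[R]_4) : cx (amb m) :=
  (psi x, psi (sp_J R *m x)).

Definition gen (a : amb m) : cx (amb m) := (a, - cJ a).

Lemma bar_m01 e psi x : frame e psi -> m01 (-1) (bar psi x).
Proof. by move=> [_ psiV psiJ _]; rewrite /bar psiJ; exact: abstract_m01. Qed.

(** J acts as -i both on the coordinates and on m^{-1(01)}, so [bar psi] is complex linear although
    psi is only assumed real linear. *)
Lemma barZv e psi p q : frame e psi ->
  bar psi (Zv p q) = p *: bar psi (Zv 1 0) + q *: bar psi (Zv 0 1).
Proof.
move=> [psiL _ _ _].
have psiD x y : psi (x + y) = psi x + psi y by have := psiL 1 x y; rewrite !scale1r.
have psi0 : psi 0 = 0 by have := psiL (-1) 0 0; rewrite scaleN1r oppr0 addr0 scaleN1r addNr.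
have psiZ a x : psi (a *: x) = a *: psi x by have := psiL a x 0; rewrite !addr0 psi0 addr0.
case: p q => [a b] [c d]; rewrite /bar !cx_scaleE /=.
have psiN x : psi (- x) = - psi x by rewrite -scaleN1r psiZ scaleN1r.
rewrite !sp_JZ; congr pair; rewrite /= -!psiZ -?psiN -!psiD; congr psi;
  rewrite !ZvZ ?ZvN !ZvD; congr Zv; apply: eqC => /=; ring.
Qed.

(** Linearity in the last argument comes from the bracket; linearity in the first is obtained from
    it by the symmetry axiom [core_L_sym]. *)
Lemma core_form_linear v psi e p q p' q' : frame e psi -> m10 0 v ->
  let T i j := core_form 1 v [:: bar psi i; bar psi j] in
  T (Zv p q) (Zv p' q') = (p * p') *: T (Zv 1 0) (Zv 1 0)
    + (p * q' + q * p') *: T (Zv 1 0) (Zv 0 1) + (q * q') *: T (Zv 0 1) (Zv 0 1).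
Proof.
move=> F vm T.
have sym i j : T i j = T j i.
  apply: (core_L_sym mA vm) => //.
    by move=> w; rewrite !inE => /orP[] /eqP ->; exact: bar_m01 F.
  by apply/permPl; exact: (perm_catC [:: bar psi i] [:: bar psi j]).
have Lr i : T i (Zv p' q') = p' *: T i (Zv 1 0) + q' *: T i (Zv 0 1).
  rewrite /T /core_form (barZv p' q' F) cx_bil_linearr; last by move=> *; exact: core_br_linearr mA _ _ _ _.
  rewrite -[q' *: bar _ _]addr0 cx_bil_linearr; last by move=> *; exact: core_br_linearr mA _ _ _ _.
  by rewrite [cx_bil _ _ 0](_ : _ = 0) ?addr0// /cx_bil !core_br0r subrr addr0.
have Ll j : T (Zv p q) j = p *: T (Zv 1 0) j + q *: T (Zv 0 1) j.
  have m1 := bar_m01 (Zv 1 0) F; have m2 := bar_m01 (Zv 0 1) F.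
  rewrite sym; rewrite /T /core_form (barZv p q F) cx_bil_linearr; last by move=> *; exact: core_br_linearr mA _ _ _ _.
  rewrite -[q *: bar _ _]addr0 cx_bil_linearr; last by move=> *; exact: core_br_linearr mA _ _ _ _.
  rewrite [cx_bil _ _ 0](_ : _ = 0) ?addr0; last by rewrite /cx_bil !core_br0r subrr addr0.
  by rewrite -!/(core_form 1 v [:: _; _]) -!/(T _ _) !(sym j).
rewrite Ll !Lr (sym (Zv 0 1) (Zv 1 0)) !scalerDr !scalerA !scalerDl.
by rewrite [LHS](AC (2*2) ((1*(2*3))*4))%AC.
Qed.

End frames.

(** * Diagonalisation of the form of L^2 *)

Section normal_form.
Context (R : realType) (m : coreData R).
Local Notation C := (R[i]).
Hypothesis mA : abstract_core m.

Definition unitary_map (x y z w : C) (v : 'cV[R]_4) : 'cV[R]_4 :=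
  Zv (x * zc1 v + z * zc2 v) (y * zc1 v + w * zc2 v).

(** The columns (x, y) and (z, w) are orthonormal, so the change of coordinates preserves the
    Hermitian form; being complex linear, it commutes with J. *)
Lemma unitary_frame e psi x y z w : frame e psi ->
  x * conjc x + y * conjc y = 1 -> z * conjc z + w * conjc w = 1 ->
  x * conjc z + y * conjc w = 0 -> frame e (psi \o unitary_map x y z w : 'cV[R]_4 -> amb m).
Proof.
move=> [psiL psiV psiJ psiB] h1 h2 h3; split=> [a u v|u|u|u v] /=.
- rewrite -psiL; congr psi; rewrite -(ZvK u) -(ZvK v) ZvZ ZvD /unitary_map !zc1Z !zc2Z ZvZ ZvD.
  by congr Zv; ring.
- exact: psiV.
- rewrite -psiJ; congr psi; rewrite -(ZvK u) sp_JZ /unitary_map !zc1Z !zc2Z sp_JZ.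
  by congr Zv; ring.
rewrite psiB; congr (_ *: _); rewrite -(ZvK u) -(ZvK v) /unitary_map !zc1Z !zc2Z !sp_BZ; congr (- complex.Im _).
move: (zc1 u) (zc2 u) (zc1 v) (zc2 v) => p q p' q'; rewrite !rmorphD !rmorphM /=.
have h4 : z * conjc x + w * conjc y = 0.
  have : conjc (x * conjc z + y * conjc w) = 0 by rewrite h3 conjc0.
  by rewrite rmorphD !rmorphM /= !conjcK => <-; ring.
transitivity ((x * conjc x + y * conjc y) * (p * conjc p') + (z * conjc z + w * conjc w) * (q * conjc q')
  + (x * conjc z + y * conjc w) * (p * conjc q') + (z * conjc x + w * conjc y) * (q * conjc p')); first by ring.
by rewrite h1 h2 h3 h4; ring.
Qed.

Lemma gr2C e (u : cx (amb m)) : gr m (-2) = <[e]>%VS -> u.1 \in gr m (-2) -> u.2 \in gr m (-2) ->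
  exists k : C, u = k *: ((e, 0) : cx (amb m)).
Proof.
move=> eE; rewrite eE => /vlineP[k1 E1] /vlineP[k2 E2]; exists (Complex k1 k2).
by rewrite cx_scaleE /= !scaler0 subr0 add0r -E1 -E2; case: u {E1 E2}.
Qed.

Lemma core_form_gr2 e psi v x y : frame e psi -> gr m (-2) = <[e]>%VS -> m10 0 v ->
  exists k : C, core_form 1 v [:: bar psi x; bar psi y] = k *: ((e, 0) : cx (amb m)).
Proof.
move=> F eE vm; have [_ psiV psiJ _] := F.
have [u1 u2 _ _] := (m10P _ _).1 (core_L_target mA vm (bar_m01 mA x F)).
have b2 a b : a \in gr m (-1) -> b \in gr m (-1) -> cbr a b \in gr m (-2).
  by move=> aV bV; have := core_br_graded mA _ _ aV bV; apply.
rewrite /core_form; move: (cL 0 v _) u1 u2 => u u1 u2.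
apply: (gr2C eE).
  exact: rpredB (b2 _ _ u1 (psiV _)) (b2 _ _ u2 (psiV _)).
exact: rpredD (b2 _ _ u1 (psiV _)) (b2 _ _ u2 (psiV _)).
Qed.

(** Excludes that both singular values vanish. A (1,0)-vector u paired with a (0,1)-vector w has
    bracket with real part 2 [Re u, Re w], so a zero form makes L^2(a) zero by nondegeneracy,
    against injectivity of L^2. *)
Lemma gen_neq0_form e psi a : frame e psi -> e != 0 -> \dim (gr m (-1)) = 4%N ->
  a \in gr m 0 -> a != 0 ->
  (forall x y, core_form 1 (gen a) [:: bar psi x; bar psi y] = 0) -> False.
Proof.
move=> F e0 d1 a0 an0 T0; have [_ psiV psiJ psiB] := F.
have gm : m10 0 (gen a) by exact: abstract_m10.
case/eqP: an0; suff : gen a = 0 by case.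
apply: (core_L_inj mA gm) => w /m01P[w1 _ J1 _].
have [x xE] := frame_onto mA e0 d1 F w1.
have -> : w = bar psi x by rewrite /bar psiJ -xE J1; case: w {w1 J1 xE}.
have [u1 u2 J3 J4] := (m10P _ _).1 (core_L_target mA gm (bar_m01 mA x F)).
have := T0 x; rewrite /core_form; move: (cL 0 (gen a) (bar psi x)) u1 u2 J3 J4 => u u1 u2 J3 J4 uT.
have u10 : u.1 = 0.
  apply: (core_nondegenerate mA u1) => v vV.
  have [y ->] := frame_onto mA e0 d1 F vV.
  have := congr1 (fun z => z.1) (uT y); rewrite /cx_bil /= psiJ => E.
  have : cbr u.1 (psi y) + cbr u.1 (psi y) = 0.
    rewrite -{2}[cbr u.1 _](core_br_J mA u1 (psiV y)) J3 core_brNl//.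
  by move/eqP; rewrite -mulr2n -scaler_nat scaler_eq0 pnatr_eq0 => /eqP.
case: u u10 J3 {u1 u2 J4 uT} => v1 v2 /= -> J3.
by rewrite -[v2]opprK -J3 core_J0// oppr0.
Qed.

(** The factor -2 is the one that [canon_formC] produces for [canon_gen t] itself (a = 1, b = 0), so
    that the vector found here can be sent to that generator. *)
Lemma core_normal e psi : frame e psi -> e != 0 -> gr m (-2) = <[e]>%VS ->
  \dim (gr m (-1)) = 4%N -> \dim (gr m 0) = 2%N ->
  exists t a psi', [/\ 0 <= t <= 1, a \in gr m 0, a != 0, frame e psi' &
    forall x y, core_form 1 (gen a) [:: bar psi' x; bar psi' y] =
      (Complex (- 2) 0 * canon_S t x y) *: ((e, 0) : cx (amb m))].
Proof.
move=> F e0 eE d1 d0.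
have [a a0 an0] : exists2 a, a \in gr m 0 & a != 0.
  exists (vpick (gr m 0)); first exact: memv_pick.
  by rewrite vpick0 -dimv_eq0 d0.
have gm : m10 0 (gen a) by exact: abstract_m10.
have [T11 E11] := core_form_gr2 (Zv 1 0) (Zv 1 0) F eE gm.
have [T12 E12] := core_form_gr2 (Zv 1 0) (Zv 0 1) F eE gm.
have [T22 E22] := core_form_gr2 (Zv 0 1) (Zv 0 1) F eE gm.
have TE p q p' q' : core_form 1 (gen a) [:: bar psi (Zv p q); bar psi (Zv p' q')] =
    (T11 * (p * p') + T12 * (p * q' + q * p') + T22 * (q * q')) *: ((e, 0) : cx (amb m)).
  rewrite (core_form_linear mA _ _ _ _ F gm) E11 E12 E22 !scalerA -!scalerDl.
  by congr (_ *: _); ring.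
have [x [y [z [w [s1 [s2 [h1 h2 h3 /andP[s20 s12] [k1 k2 k3]]]]]]]] := takagi2 T11 T12 T22.
pose psi' : 'cV[R]_4 -> amb m := psi \o unitary_map x y z w.
have F' : frame e psi' by exact: unitary_frame.
have T'E u v : core_form 1 (gen a) [:: bar psi' u; bar psi' v] =
    (s1 * (zc1 u * zc1 v) + s2 * (zc2 u * zc2 v)) *: ((e, 0) : cx (amb m)).
  have barE r : bar psi' r = bar psi (unitary_map x y z w r).
    have [_ _ psiJ _] := F; have [_ _ psiJ' _] := F'.
    by rewrite /bar psiJ' psiJ.
  rewrite !barE TE -k1 -k2; congr (_ *: _).
  transitivity (T11 * ((x * zc1 u + z * zc2 u) * (x * zc1 v + z * zc2 v)) +
    T12 * ((x * zc1 u + z * zc2 u) * (y * zc1 v + w * zc2 v) + (y * zc1 u + w * zc2 u) * (x * zc1 v + z * zc2 v)) +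
    T22 * ((y * zc1 u + w * zc2 u) * (y * zc1 v + w * zc2 v))
    - (T11 * (x * z) + T12 * (x * w + y * z) + T22 * (y * w)) * (zc1 u * zc2 v + zc2 u * zc1 v)).
    by rewrite k3; ring.
  by ring.
have [r2 [r20 r2E]] : exists r : R, 0 <= r /\ s2 = Complex r 0.
  move: s20; case: s2 {k2 s12 T'E} => r i; rewrite lecE /= => /andP[/eqP -> r0].
  by exists r.
have [r1 [r12 r1E]] : exists r : R, r2 <= r /\ s1 = Complex r 0.
  move: s12; rewrite r2E; case: s1 {k1 T'E} => r i; rewrite lecE /= => /andP[/eqP -> r0].
  by exists r.
have rpos : 0 < r1 + r2.
  rewrite lt_neqAle addr_ge0 ?(le_trans r20)// andbT; apply/negP => /eqP r0.
  apply: (gen_neq0_form F' e0 d1 a0 an0) => u v; rewrite T'E.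
  have -> : s1 = 0 by rewrite r1E; congr Complex; lra.
  have -> : s2 = 0 by rewrite r2E; congr Complex; lra.
  by rewrite !mul0r addr0 scale0r.
have rn0 : r1 + r2 != 0 by rewrite lt0r_neq0.
(* For t = (r1 - r2) / (r1 + r2) one has 1 + t = 2 r1 / (r1 + r2) and 1 - t = 2 r2 / (r1 + r2), so k
   r1 = -2 (1 + t) and k r2 = -2 (1 - t). *)
pose k := - 4 / (r1 + r2).
have k0 : k != 0 by rewrite mulf_neq0 ?invr_eq0// oppr_eq0 pnatr_eq0.
exists ((r1 - r2) / (r1 + r2)), (k *: a), psi'; split=> //.
- apply/andP; split; first by apply: divr_ge0; [rewrite subr_ge0|exact: ltW].
  by rewrite ler_pdivrMr// mul1r; lra.
- exact: memvZ.
- by rewrite scaler_eq0 negb_or k0.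
move=> u v.
have -> : gen (k *: a) = Complex k 0 *: gen a :> cx (amb m).
  have p0 : (-1 : int) <= 0 by [].
  by rewrite /gen (core_JZ mA _ p0 a0) cx_realE /= scalerN.
have L0 w' : m01 (-1) w' -> cL 0 (Complex k 0 *: gen a) w' = Complex k 0 *: cL 0 (gen a) w'.
  move=> mw; have m0 : m10 0 (0 : cx (amb m)).
    by apply/m10P; rewrite !mem0v /= core_J0// oppr0.
  have c0 : cL 0 (0 : cx (amb m)) w' = 0.
    by have := core_L_linearl mA (-1) m0 m0 mw; rewrite scaler0 addr0 scaleN1r addNr.
  by have := core_L_linearl mA (Complex k 0) gm m0 mw; rewrite !addr0 c0 addr0.
rewrite /core_form L0; last exact: (bar_m01 mA _ F').
rewrite -[_ *: cL _ _ _]addr0 cx_bil_linearl; last by move=> *; exact: core_br_linearl mA _ _ _ _.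
rewrite [cx_bil _ 0 _](_ : _ = 0) ?addr0; last by rewrite /cx_bil !core_br0l// subrr addr0.
rewrite -/(core_form 1 (gen a) [:: _; _]) T'E scalerA; congr (_ *: _).
rewrite r1E r2E /canon_S.
move: (zc1 u * zc1 v) (zc2 u * zc2 v) => [? ?] [? ?].
by apply: eqC; rewrite /= /k; field.
Qed.

End normal_form.

(** * The isomorphism with m_t *)

Section iso.
Context (R : realType) (m : coreData R).
Local Notation C := (R[i]).
Hypothesis mA : abstract_core m.

Lemma gr0_span a : a \in gr m 0 -> a != 0 -> \dim (gr m 0) = 2%N ->
  gr m 0 = <<[:: a; cJ a]>>%VS.
Proof.
move=> a0 an0 d0; have p0 : (-1 : int) <= 0 by [].
have Ja := core_J_graded mA p0 a0.
apply/esym/eqP; rewrite eqEdim; apply/andP; split.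
  by apply/span_subvP => u; rewrite !inE => /orP[] /eqP ->.
suff /eqP -> : free [:: a; cJ a] by rewrite d0.
rewrite free_cons seq1_free span_seq1; apply/andP; split; last first.
  apply: contra an0 => /eqP J0; rewrite -[a]opprK -(core_J_square mA p0 a0) J0.
  by rewrite core_J0// oppr0.
apply/vlineP => -[k E].
have E2 : cJ a = - (k *: a) by rewrite {1}E (core_JZ mA _ p0 Ja) (core_J_square mA p0 a0) scalerN.
move: E; rewrite E2 scalerN scalerA => /eqP; rewrite -addr_eq0 -{1}[a]scale1r -scalerDl.
rewrite scaler_eq0 (negPf an0) orbF => /eqP E.
by have := sqr_ge0 k; rewrite expr2; lra.
Qed.

(** A basis adapted to the frame and to a, J a is sent to its counterpart in m_t. Only compatibility
    with L^2 needs the normal form of [core_normal]. *)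
Lemma core_iso_normal t a e psi : 0 <= t -> core_dim m 7 -> type_B m ->
  e != 0 -> gr m (-2) = <[e]>%VS -> frame e psi -> a \in gr m 0 -> a != 0 ->
  (forall x y, core_form 1 (gen a) [:: bar psi x; bar psi y] =
      (Complex (- 2) 0 * canon_S t x y) *: ((e, 0) : cx (amb m))) ->
  core_iso m (canon_core t).
Proof.
move=> t0 [N Nb N7] [d2 d1 d0 dp] e0 eE F a0 an0 T.
have [psiL psiV psiJ psiB] := F.
have p0 : (-1 : int) <= 0 by [].
have psiD x y : psi (x + y) = psi x + psi y by have := psiL 1 x y; rewrite !scale1r.
have psi0 : psi 0 = 0 by have := psiL (-1) 0 0; rewrite scaleN1r oppr0 addr0 scaleN1r addNr.
have psiZ k x : psi (k *: x) = k *: psi x by have := psiL k x 0; rewrite !addr0 psi0 addr0.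
have onto v : v \in gr m (-1) -> exists x, v = psi x by move=> vV; exact: (frame_onto mA e0 d1 F vV).
have gr0 := gr0_span a0 an0 d0.
have gr0P u : u \in gr m 0 -> exists al be, u = al *: a + be *: cJ a.
  rewrite gr0 span_cons span_seq1 => /memv_addP[_ /vlineP[al ->] [_ /vlineP[be ->] ->]].
  by exists al, be.
have gr_cases p u : u \in gr m p -> [\/ p = -2 /\ exists k, u = k *: e, p = -1 /\ exists x, u = psi x,
    p = 0 /\ exists al be, u = al *: a + be *: cJ a | u = 0].
  have [->|h2] := eqVneq p (-2); first by rewrite eE => /vlineP; constructor 1.
  have [->|h1] := eqVneq p (-1); first by move=> /onto; constructor 2.
  have [->|h0] := eqVneq p 0; first by move=> /gr0P; constructor 3.
  by rewrite dp// memv0 => /eqP; constructor 4.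
pose I := Complex 0 1 : C.
have ZvE p q : Zv p q = complex.Re p *: Zv 1 0 + complex.Re q *: Zv 0 1
     + (complex.Im p *: Zv I 0 + complex.Im q *: Zv 0 I) :> 'cV[R]_4.
  by rewrite !ZvZ !ZvD; case: p q => [? ?] [? ?]; congr Zv; apply: eqC => /=; ring.
pose b := [:: e; psi (Zv 1 0); psi (Zv 0 1); psi (Zv I 0); psi (Zv 0 I); a; cJ a].
have bspan u : u \in b -> u \in <<b>>%VS by exact: memv_span.
have grb p : (gr m p <= <<b>>)%VS.
  apply/subvP => u /gr_cases[[_ [k ->]]|[_ [x ->]]|[_ [al [be ->]]]|->].
  - by rewrite memvZ// bspan// mem_head.
  - rewrite -(ZvK x) ZvE !psiD !psiZ.
    by rewrite !rpredD// memvZ// bspan// !inE eqxx ?orbT.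
  - by rewrite rpredD// memvZ// bspan// !inE eqxx ?orbT.
  - exact: mem0v.
(* The seven vectors span every graded piece, and the sum of these has dimension 7. *)
have bfree : free b.
  rewrite /free eqn_leq dim_span /= -N7; apply: dimvS.
  by apply/subv_sumP => i _; exact: grb.
have [f fE] := linear_of_free b [:: c2_in 1; c1_in (Zv 1 0); c1_in (Zv 0 1); c1_in (Zv I 0);
  c1_in (Zv 0 I); m0_in (m0_mx t 1 0); m0_in (m0_mx t 0 1) : ambB R].
have {fE} [fe f1 f2 f3 f4 fa fJa] := fE bfree erefl.
have fpsi x : f (psi x) = c1_in x.
  rewrite -(ZvK x); move: (zc1 x) (zc2 x) => p q.
  by rewrite ZvE !psiD !psiZ !linearD !linearZ /= f1 f2 f3 f4 !c1_inD !c1_inZ.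
have fk k : f (k *: e) = c2_in k by rewrite linearZ /= fe -c2_inZ mulr1.
have fab al be : f (al *: a + be *: cJ a) = m0_in (m0_mx t al be).
  rewrite linearD !linearZ /= fa fJa; congr (_, _, _); rewrite /= ?scaler0 ?addr0//.
  by rewrite /m0_mx !scale1r !scale0r addr0 add0r.
have FE u : linfun f u = f u by rewrite lfunE.
have Jab al be : cJ (al *: a + be *: cJ a) = (- be) *: a + al *: cJ a.
  have Ja := core_J_graded mA p0 a0.
  rewrite (core_JD mA p0) ?rpredZ// !(core_JZ mA _ p0)//.
  by rewrite (core_J_square mA p0 a0) scalerN addrC scaleNr.
exists (linfun f); split.
- move=> p; apply/vspaceP => u; apply/idP/idP.
    move=> /memv_imgP[v /gr_cases[[-> [k ->]]|[-> [x ->]]|[-> [al [be ->]]]|->] ->]; rewrite FE.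
    + by rewrite fk; apply/gr2_canon; exists k.
    + by rewrite fpsi; apply/gr1_canon; exists x.
    + by rewrite fab; apply/gr0_canon; exists al, be.
    + by rewrite linear0 mem0v.
  move=> /gr_canonP[[-> [k ->]]|[-> [x ->]]|[-> [al [be ->]]]|->].
  + by apply/memv_imgP; exists (k *: e); rewrite ?FE ?fk// eE memvZ// memv_line.
  + by apply/memv_imgP; exists (psi x); rewrite ?FE ?fpsi.
  + apply/memv_imgP; exists (al *: a + be *: cJ a); rewrite ?FE ?fab//.
    by rewrite gr0 rpredD// memvZ// memv_span// !inE eqxx ?orbT.
  + exact: mem0v.
- move=> p v /gr_cases[[_ [k ->]]|[_ [x ->]]|[_ [al [be ->]]]|->]; rewrite FE //.
  + by rewrite fk => -[->]; rewrite scale0r.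
  + by rewrite fpsi => /(congr1 (fun u : ambB R => u.1.2)) /= ->.
  + rewrite fab => /(congr1 (fun u : ambB R => u.2 *m Zv 1 0)); rewrite [RHS]mul0mx.
    change (m0_mx t al be *m Zv 1 0 = 0 -> al *: a + be *: cJ a = 0).
    rewrite m0_mx_mul => /(congr1 (@zc1 R)); rewrite zc1Z.
    have t2 : (1 + t) / 2 != 0 by rewrite lt0r_neq0// divr_gt0// ltr_pwDl.
    move=> [/=]; rewrite !mxE; move: ((1 + t) / 2) t2 => k t2 E1 E2.
    have /eqP : be * k = 0 by lra.
    have /eqP : al * k = 0 by lra.
    by rewrite !mulf_eq0 (negPf t2) !orbF => /eqP -> /eqP ->; rewrite !scale0r addr0.
- move=> p v p1 /gr_cases[[pE [k ->]]|[_ [x ->]]|[_ [al [be ->]]]|->]; first by rewrite pE in p1.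
  + by rewrite -psiJ !FE !fpsi cJ_c1.
  + by rewrite Jab !FE !fab cJ_m0 J_m0_mx.
  + by rewrite core_J0// !FE linear0; congr (_, _, _); rewrite /= mulmx0.
- move=> p q v w pn qn vp wq; rewrite !FE.
  have cb2l r (z : amb (canon_core t)) : cbr (c2_in r : amb (canon_core t)) z = 0.
    by congr (_, _, _); rewrite /= /sp_B linear0 !mul0mx mxE.
  have cb2r r (z : amb (canon_core t)) : cbr z (c2_in r : amb (canon_core t)) = 0.
    by congr (_, _, _); rewrite /= /sp_B mulmx0 mxE.
  have low z : p + q != -2 -> z \in gr m (p + q) -> z = 0.
    by move=> pq; rewrite dp//; [rewrite memv0 => /eqP|lia|lia].
  have := core_br_graded mA pn qn vp wq.
  move: vp wq => /gr_cases[[pE [k ->]]|[pE [x ->]]|[pE _]|->]; last 2 first.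
  + by rewrite pE in pn.
  + by move=> _ _; rewrite core_br0l// !linear0; congr (_, _, _); rewrite /= /sp_B linear0 !mul0mx mxE.
  + by move=> _ /low ->; [rewrite linear0 fk cb2l|rewrite pE; lia].
  move=> /gr_cases[[qE [k ->]]|[qE [y ->]]|[qE _]|->].
  + by move=> /low ->; [rewrite linear0 fk cb2r|rewrite qE; lia].
  + by move=> _; rewrite psiB fk !fpsi cbr_c1.
  + by rewrite qE in qn.
  + by move=> _; rewrite core_br0r// !linear0; congr (_, _, _); rewrite /= /sp_B mulmx0 mxE.
- move=> p v w mv mw; have [pz|pN0] := eqVneq p 0%N; last first.
    have v0 : v = 0.
      case: p pN0 mv => // p _ [v1 v2 _]; move: v1 v2; rewrite dp// !memv0 => /eqP E1 /eqP E2.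
      by rewrite [v]surjective_pairing E1 E2.
    have m0 : m10 p%:Z (0 : cx (amb m)).
      by apply/m10P; rewrite !mem0v; split=> //; rewrite core_J0// oppr0.
    have -> : cL p v w = 0.
      by rewrite v0; have := core_L_linearl mA (-1) m0 m0 mw; rewrite scaler0 addr0 scaleN1r addNr.
    by case: p pN0 {mv m0} => // p _; rewrite /cx_map !FE !linear0.
  subst p.
  have [x wE] : exists x, w = bar psi x.
    have [w1 _ J1 _] := (m01P _ _).1 mw.
    by have [x xE] := onto _ w1; exists x; rewrite [w]surjective_pairing -J1 xE -psiJ.
  have [al [be vE]] : exists al be, v = Complex al be *: gen a.
    have [v1 _ J1 _] := (m10P _ _).1 mv.
    have [al [be v1E]] := gr0P _ v1; exists al, be.
    rewrite [v]surjective_pairing -[v.2]opprK -J1 v1E Jab cx_scaleE; congr pair.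
      by rewrite scalerN opprK.
    by rewrite opprD scaleNr opprK scalerN addrC.
  have gm : m10 0 (gen a) by exact: abstract_m10.
  have fv : cx_map (linfun f) v = (m0_in (m0_mx t al be), m0_in (m0_mx t be (- al))) :> cx (amb (canon_core t)).
    have gE : Complex al be *: gen a = (al *: a + be *: cJ a, be *: a + (- al) *: cJ a) :> cx (amb m).
      by rewrite cx_scaleE /gen /=; congr pair; rewrite !scalerN ?opprK// addrC scaleNr.
    by rewrite vE gE /cx_map !FE !fab.
  have fw y : cx_map (linfun f) (bar psi y) = (c1_in y, c1_in (sp_J R *m y)) :> cx (amb (canon_core t)).
    by rewrite /cx_map /bar /= !FE !fpsi.
  have [u1 u2 J1 J2] := (m10P _ _).1 (core_L_target mA mv mw).
  have [r rE] := onto _ u1.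
  have uE : cL 0 v w = (psi r, - psi (sp_J R *m r)) :> cx (amb m).
    by rewrite [cL 0 v w]surjective_pairing -[(cL 0 v w).2]opprK -J1 rE psiJ.
  pose r' := 2 *: (m0_mx t al be *m x).
  rewrite wE fw fv canon_L -wE uE /cx_map /= !FE linearN /= !fpsi.
  have QJx : 2 *: (m0_mx t al be *m (sp_J R *m x)) = - (sp_J R *m r').
    by rewrite /r' -scalemxAr !mulmxA m0_mx_J mulNmx scalerN.
  rewrite QJx c1_inN.
  suff -> : r = r' by [].
  (* Both candidates for L^2(v)(w) are of type (1,0), so their real parts r and r' suffice; B is
     nondegenerate, and 2 B(r, z) is the real part of the form already known. *)
  apply/eqP; rewrite -subr_eq0; apply/eqP; apply: sp_B_nondeg => z.
  rewrite sp_BDl sp_BNl; apply/eqP; rewrite subr_eq0; apply/eqP.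
  have core_v : core_form 1 v [:: w; bar psi z] =
      (Complex al be * (Complex (- 2) 0 * canon_S t x z)) *: ((e, 0) : cx (amb m)).
    have m0 : m10 0 (0 : cx (amb m)).
      by apply/m10P; rewrite !mem0v; split=> //; rewrite core_J0// oppr0.
    have c0 : cL 0 (0 : cx (amb m)) w = 0.
      by have := core_L_linearl mA (-1) m0 m0 mw; rewrite scaler0 addr0 scaleN1r addNr.
    have Lv : cL 0 v w = Complex al be *: cL 0 (gen a) w.
      by have := core_L_linearl mA (Complex al be) gm m0 mw; rewrite !addr0 c0 addr0 -vE.
    rewrite /core_form Lv -[_ *: cL _ _ _]addr0 cx_bil_linearl; last by move=> *; exact: core_br_linearl mA _ _ _ _.
    rewrite [cx_bil _ 0 _](_ : _ = 0) ?addr0; last by rewrite /cx_bil !core_br0l// subrr addr0.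
    by rewrite wE -/(core_form 1 (gen a) [:: _; _]) T scalerA.
  have scE (k : C) : (k *: ((e, 0) : cx (amb m))).1 = complex.Re k *: e.
    by case: k => k1 k2; rewrite cx_scaleE /= scaler0 subr0.
  have E1 : (core_form 1 v [:: w; bar psi z]).1 = (2 * sp_B r z) *: e.
    rewrite /core_form uE /cx_bil /= psiB core_brNl// psiB sp_B_J opprK -scalerDl.
    by congr (_ *: _); ring.
  have : 2 * sp_B r z = 2 * sp_B r' z.
    have := E1; rewrite core_v scE => /eqP; rewrite -subr_eq0 -scalerBl scaler_eq0 (negPf e0) orbF.
    rewrite subr_eq0 => /eqP <-; rewrite /r' sp_BZl -(ZvK x) -(ZvK z) m0_mx_mul sp_BZ /canon_S !zc1Z !zc2Z.
    by move: (zc1 x) (zc2 x) (zc1 z) (zc2 z) => [? ?] [? ?] [? ?] [? ?] /=; field.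
  by move/(@mulfI _ 2); apply; rewrite pnatr_eq0.
Qed.

End iso.

Section normal_form_existence.
Context (R : realType).

Lemma canon_gen_S2 (t : R) : S2c10 (canon_gen t).
Proof.
have ce j : c10 (e10 R j).
  rewrite /c10 cx_imagE /e10 /cx_map /=; congr pair.
    by rewrite opprK scalemxAr.
  by rewrite mulmxN -scalemxAr sp_JJ scalerN opprK.
have cZ (c : R[i]) z : c10 z -> c10 (c *: z : cx 'cV[R]_4).
  rewrite /c10 !cx_imagE; case: c z => a b [z1 z2]; rewrite cx_scaleE /cx_map /= => -[E1 E2].
  rewrite mulmxBr mulmxDr -!scalemxAr E1 E2; congr pair.
    by rewrite scalerN opprD.
  by rewrite scalerN.
have odotZ (c : R[i]) (z w : cx 'cV[R]_4) : cx_odot (c *: z) w = c *: cx_odot z w.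
  have L : forall (a : R) (u u' v : 'cV[R]_4), sp_odot (a *: u + u') v = a *: sp_odot u v + sp_odot u' v.
    move=> a u u' v; apply: mx_ext => x.
    rewrite [RHS]mulmxDl -scalemxAl !sp_odotE sp_BDl sp_BZl !scalerDr !scalerDl !scalerA.
    by rewrite [sp_B v x * a]mulrC addrACA.
  have := cx_bil_linearl c z 0 w L; rewrite addr0 /cx_odot => ->.
  rewrite [cx_bil _ 0 _](_ : _ = 0) ?addr0//.
  have L0 v : @sp_odot R 0 v = 0 by rewrite /sp_odot trmx0 mulmx0 !mul0mx addr0.
  by rewrite /cx_bil /= !L0 subrr addr0.
exists [:: (Complex (1 + t) 0 *: e10 R 0, e10 R 0); (Complex (1 - t) 0 *: e10 R 1, e10 R 1)].
  by move=> x; rewrite !inE => /orP[] /eqP ->; split=> //=; exact: cZ.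
by rewrite big_cons big_seq1 !odotZ.
Qed.

Lemma normal_form_exists (m : coreData R) :
  abstract_core m -> core_dim m 7 -> type_B m -> core_signature m 2 0 ->
  exists t, 0 <= t <= 1 /\ core_iso m (canon_core t).
Proof.
move=> mA m7 mB [e [B [e0 eE BE [P [N [[PN _ dP dN] [Ppos _ _]]]]]]].
have [d2 d1 d0 _] := mB.
(* Signature (2,0) leaves no negative part, so the form is positive definite on all of m^{-1}. *)
have P1 : P = gr m (-1).
  have N0 : N = 0%VS by apply/eqP; rewrite -dimv_eq0 dN.
  by rewrite -PN N0 addv0.
have [psi F] : exists psi, frame e psi.
  by apply: (frame_exists mA e0 d1 BE) => v; rewrite -P1; exact: Ppos.
have [t [a [psi' [t01 a0 an0 F' T]]]] := core_normal mA F e0 eE d1 d0.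
exists t; split=> //; have /andP[t0 _] := t01.
exact: (core_iso_normal mA t0 m7 mB e0 eE F' a0 an0 T).
Qed.

Lemma canon_gen_neq0 (t : R) : 0 <= t -> canon_gen t != 0.
Proof.
by move=> t0; apply: contra (canon_mx_neq0 t0) => /eqP E; rewrite /canon_mx E.
Qed.

End normal_form_existence.

(** * Symmetry of second derivatives *)

(** Write g = f + (g - f): the second summand vanishes near x and so has differential 0. *)
Lemma near_eq_differentiable (R : numFieldType) (V W : normedModType R)
    (f g : V -> W) (x : V) :
  (\near x, f x = g x) -> differentiable f x -> differentiable g x.
Proof.
move=> fg df.
have -> : g = f + (g - f) by rewrite addrC subrK.
apply: differentiableD => //.
have h0 : (g - f) \o shift x = cst ((g - f) x) + (\0 : {linear V -> W}) +o_ 0 id.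
  apply/eqaddoP => _/posnumP[e].
  have -> : cst ((g - f) x) + (\0 : {linear V -> W}) = cst 0 :> (V -> W).
    apply/funext => y; rewrite /= [LHS]addr0 /cst.
    by have /= := nbhs_singleton fg; rewrite !fctE => ->; rewrite subrr.
  have : \forall y \near 0, f (y + x) = g (y + x).
    by have := fg; rewrite (near_shift 0) /= subr0.
  move=> fg0; near=> y.
  have -> : ((g - f) \o shift x - cst 0) y = 0.
    have : f (y + x) = g (y + x) by near: y.
    by rewrite !fctE /= => ->; rewrite subrr subr0.
  by rewrite normr0 mulr_ge0.
have c0 : continuous (\0 : {linear V -> W}) by exact: cst_continuous.
apply/diff_locallyP; have -> := diff_unique c0 h0; split=> //.
Unshelve. all: by end_near. Qed.

Lemma derive_comp (R : numFieldType) (V V' W : normedModType R)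
    (g : V -> V') (f : V' -> W) (a v : V) :
  differentiable g a -> differentiable f (g a) ->
  'D_v (f \o g) a = 'D_('D_v g a) f (g a).
Proof.
move=> dg df; rewrite !deriveE//; last exact: differentiable_comp.
by rewrite diff_comp.
Qed.

Lemma is_derive_line (R : numFieldType) (V W : normedModType R)
    (f : V -> W) (a v : V) (s : R) :
  differentiable f (a + s *: v) ->
  is_derive s (1 : R) (fun s => f (a + s *: v)) ('D_v f (a + s *: v)).
Proof.
move=> df; have dv := @diff_derivable _ _ _ _ _ v df.
have E : (fun h : R => h^-1 *: (((fun s => f (a + s *: v)) \o shift s) (h *: 1) - f (a + s *: v)))
       = (fun h : R => h^-1 *: ((f \o shift (a + s *: v)) (h *: v) - f (a + s *: v))).
  by apply/funext => h /=; rewrite scalerDl [h *: 1]mulr1 addrCA.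
by constructor; rewrite /derivable /derive E.
Qed.

(** Mean value theorem twice: in s for f(p + h w + s v) - f(p + s v), then in t for the v-derivative
    of f along w. *)
Lemma mixed_difference (R : realType) (V : normedModType R) (f : V -> R)
    (p v w : V) (h : R) : 0 < h ->
  (forall s t, 0 <= s <= h -> 0 <= t <= h ->
     differentiable f (p + s *: v + t *: w) /\
     differentiable ('D_v f) (p + s *: v + t *: w)) ->
  exists s t, [/\ 0 <= s <= h, 0 <= t <= h
    & f (p + h *: v + h *: w) - f (p + h *: v) - f (p + h *: w) + f p =
      'D_w ('D_v f) (p + s *: v + t *: w) * h * h].
Proof.
move=> h0 df.
have hh : 0 <= h <= h by rewrite ltW /=.
have h00 : (0:R) <= 0 <= h by rewrite lexx ltW.
pose g (s : R) : R := f (p + h *: w + s *: v) - f (p + s *: v).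
pose dg s : R := 'D_v f (p + h *: w + s *: v) - 'D_v f (p + s *: v).
have dG (s : R) : 0 <= s <= h -> is_derive s (1 : R) g (dg s).
  move=> sh; apply: is_deriveB; apply: is_derive_line.
    by have [+ _] := df s h sh hh; rewrite addrAC.
  by have [+ _] := df s 0 sh h00; rewrite scale0r addr0.
have [s] : exists2 s, s \in `]0, h[ & g h - g 0 = dg s * (h - 0).
  apply: MVT => // [s|]; first by rewrite in_itv /= => /andP[s0 sh]; apply: dG; rewrite !ltW.
  apply: derivable_within_continuous => s; rewrite in_itv /= => sh.
  by have [] := dG s sh.
rewrite in_itv /= => /andP[s0 sh] gE.
have sh' : 0 <= s <= h by rewrite !ltW.
pose k (t : R) : R := 'D_v f (p + s *: v + t *: w).
pose dk t : R := 'D_w ('D_v f) (p + s *: v + t *: w).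
have dK (t : R) : 0 <= t <= h -> is_derive t (1 : R) k (dk t).
  by move=> th; apply: is_derive_line; have [] := df s t sh' th.
have [t] : exists2 t, t \in `]0, h[ & k h - k 0 = dk t * (h - 0).
  apply: MVT; [exact: h0|move=> t|].
    by rewrite in_itv /= => /andP[t0 th]; apply: dK; rewrite !ltW.
  apply: derivable_within_continuous => t; rewrite in_itv /= => th.
  by have [] := dK t th.
rewrite in_itv /= => /andP[t0 th] kE.
exists s, t; split; rewrite ?ltW//.
have : g h - g 0 = (k h - k 0) * h.
  by rewrite gE subr0 /dg /k scale0r addr0 [p + h *: w + _]addrAC.
rewrite kE subr0 => <-; rewrite /g !scale0r !addr0 [p + h *: w + _]addrAC.
by ring.
Qed.

(* Clairaut: both mixed derivatives are limits of the second difference quotient. *)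
Lemma derive_comm (R : realType) (V : normedModType R) (f : V -> R) (U : set V)
    (p v w : V) :
  open U -> U p -> (forall x, U x -> differentiable f x) ->
  (forall x, U x -> differentiable ('D_v f) x) ->
  (forall x, U x -> differentiable ('D_w f) x) ->
  {for p, continuous ('D_w ('D_v f))} -> {for p, continuous ('D_v ('D_w f))} ->
  'D_w ('D_v f) p = 'D_v ('D_w f) p.
Proof.
move=> oU Up df dfv dfw c1 c2; apply/eqP; rewrite -subr_eq0 -normr_eq0.
apply/eqP/le_anti; rewrite normr_ge0 andbT; apply/ler_addgt0Pr => e e0; rewrite add0r.
have e20 : 0 < e / 2 by rewrite divr_gt0.
have B : \forall y \near p, `|'D_w ('D_v f) p - 'D_w ('D_v f) y| < e / 2.
  by have /cvgrPdist_lt := c1; apply.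
have C : \forall y \near p, `|'D_v ('D_w f) p - 'D_v ('D_w f) y| < e / 2.
  by have /cvgrPdist_lt := c2; apply.
have /nbhs_ballP [d /= d0 dP] : \forall y \near p, [/\ U y,
    `|'D_w ('D_v f) p - 'D_w ('D_v f) y| < e / 2
    & `|'D_v ('D_w f) p - 'D_v ('D_w f) y| < e / 2].
  by apply: filterS3 (open_nbhs_nbhs (conj oU Up)) B C => y Uy By Cy; split.
pose N := `|v| + `|w| + 1.
have N0 : 0 < N by rewrite ltr_wpDl// addr_ge0.
(* Since |v| + |w| < N and h N = d / 2, the parallelogram with sides h v and h w stays in the ball
   of radius d. *)
pose h := d / N / 2.
have h0 : 0 < h by rewrite !divr_gt0.
have near_p s t : 0 <= s <= h -> 0 <= t <= h -> ball p d (p + s *: v + t *: w).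
  move=> /andP[s0 sh] /andP[t0 th].
  rewrite -ball_normE /= -addrA opprD addNKr normrN.
  apply: (le_lt_trans (ler_normD _ _)); rewrite !normrZ !ger0_norm//.
  apply: (@le_lt_trans _ _ (h * `|v| + h * `|w|)); first by rewrite lerD// ler_wpM2r.
  rewrite -mulrDr; apply: (@le_lt_trans _ _ (h * N)).
    by rewrite ler_pM2l// lerDl.
  by rewrite /h mulrAC divfK ?lt0r_neq0// ltr_pdivrMr// mulr2n mulrDr mulr1 ltrDl.
have [|s [t [sh th E1]]] := @mixed_difference _ _ f p v w h h0.
  by move=> s t sh th; have [Uy _ _] := dP _ (near_p s t sh th); split; [exact: df|exact: dfv].
have near_p' a b : 0 <= a <= h -> 0 <= b <= h -> ball p d (p + a *: w + b *: v).
  by move=> ? ?; rewrite addrAC; exact: near_p.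
have [|s' [t' [sh' th' E2]]] := @mixed_difference _ _ f p w v h h0.
  by move=> s' t' sh' th'; have [Uy _ _] := dP _ (near_p' s' t' sh' th'); split; [exact: df|exact: dfw].
have hN0 : h != 0 by rewrite lt0r_neq0.
have E : 'D_w ('D_v f) (p + s *: v + t *: w) = 'D_v ('D_w f) (p + s' *: w + t' *: v).
  apply: (mulIf hN0); apply: (mulIf hN0).
  rewrite -E1 -E2; congr (_ + _); rewrite addrAC; congr (_ - _ - _).
  by rewrite addrAC.
have [_ L1 _] := dP _ (near_p s t sh th).
have [_ _ L2] := dP _ (near_p' s' t' sh' th').
rewrite E in L1.
move: L1 L2; generalize ('D_w ('D_v f) p) ('D_v ('D_w f) p)
  ('D_v ('D_w f) (p + s' *: w + t' *: v)) => a b c L1 L2.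
rewrite (splitr e); apply: le_trans (ler_distD c a b) _.
by apply: lerD; [exact: ltW|rewrite distrC; exact: ltW].
Qed.

(** * Calculus of [Ck] and smooth functions on open sets *)

Section smooth_on.
Context (R : realType) (n : nat).
Local Notation rV := ('rV[R]_n).
Implicit Types (W : normedModType R) (U V : set rV).

Lemma near_open (T : topologicalType) (U : set T) (P : T -> Prop) x :
  open U -> U x -> (forall y, U y -> P y) -> \forall y \near x, P y.
Proof. by move=> oU Ux UP; apply: filterS UP _; exact: open_nbhs_nbhs. Qed.

Lemma Ck_ext W k U (f g : rV -> W) : open U ->
  (forall x, U x -> f x = g x) -> Ck k U f -> Ck k U g.
Proof.
move=> oU; elim: k f g => [|k IH] f g fg /=.
  move=> cf x Ux; have := cf x Ux; rewrite /prop_for /continuous_at (fg x Ux).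
  have gf : \forall y \near x, f y = g y by apply: near_open oU Ux _ => y Uy; rewrite fg.
  exact: cvg_trans (near_eq_cvg gf).
move=> [df cf]; split=> [x Ux|v].
  apply: near_eq_differentiable (df x Ux); exact: near_open oU Ux fg.
apply: IH (cf v) => x Ux; apply: near_eq_derive; exact: near_open oU Ux fg.
Qed.

Lemma derive_ext W U (f g : rV -> W) p v : open U -> U p ->
  (forall x, U x -> f x = g x) -> 'D_v f p = 'D_v g p.
Proof. by move=> oU Up fg; apply: near_eq_derive; exact: near_open oU Up fg. Qed.

Lemma Ck_sub W k U V (f : rV -> W) : V `<=` U -> Ck k U f -> Ck k V f.
Proof.
move=> VU; elim: k f => [|k IH] f /=; first by move=> cf x /VU; exact: cf.
by move=> [df cf]; split=> [x /VU|v]; [exact: df|exact: IH].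
Qed.

Lemma CkW W k U (f : rV -> W) : Ck k.+1 U f -> Ck k U f.
Proof.
elim: k f => [|k IH] f [df cf] /=; last by split=> // v; exact: IH.
by move=> x Ux; apply: differentiable_continuous; exact: df.
Qed.

Lemma Ck_cst W k U (c : W) : open U -> Ck k U (fun=> c).
Proof.
move=> oU; elim: k c => [|k IH] c /=; first by move=> x _; exact: cst_continuous.
split=> [x _|v]; first exact: differentiable_cst.
by apply: Ck_ext (IH 0) => // x _; rewrite derive_cst.
Qed.

Lemma CkD W k U (f g : rV -> W) : open U ->
  Ck k U f -> Ck k U g -> Ck k U (fun x => f x + g x).
Proof.
move=> oU; elim: k f g => [|k IH] f g /=.
  by move=> cf cg x Ux; exact: (cvgD (cf x Ux) (cg x Ux)).
move=> [df cf] [dg cg]; split=> [x Ux|v].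
  by apply: differentiableD; [exact: df|exact: dg].
apply: Ck_ext (IH _ _ (cf v) (cg v)) => // x Ux; rewrite -deriveD//.
  exact/diff_derivable/df.
exact/diff_derivable/dg.
Qed.

Lemma CkM k U (f g : rV -> R^o) : open U ->
  Ck k U f -> Ck k U g -> Ck k U (fun x => f x * g x : R^o).
Proof.
move=> oU; elim: k f g => [|k IH] f g.
  by move=> cf cg x Ux; exact: (cvgM (cf x Ux) (cg x Ux)).
move=> Cf Cg; have [df cf] := Cf; have [dg cg] := Cg; split=> [x Ux|v].
  by apply: differentiableM; [exact: df|exact: dg].
apply: Ck_ext (CkD oU (IH _ _ (CkW Cf) (cg v)) (IH _ _ (CkW Cg) (cf v))) => // x Ux.
by rewrite -deriveM//; [exact/diff_derivable/df|exact/diff_derivable/dg].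
Qed.

Lemma Ck_coord m k U (f : rV -> 'rV[R]_m) (j : 'I_m) : open U ->
  Ck k U f -> Ck k U (fun x => f x ord0 j : R^o).
Proof.
move=> oU; elim: k f => [|k IH] f.
  move=> cf x Ux; apply: (@continuous_comp _ _ _ f (fun M : 'rV[R]_m => M ord0 j : R^o)).
    exact: cf.
  exact: coord_continuous.
move=> [df cf]; split=> [x Ux|v].
  apply: (@differentiable_comp _ _ _ _ f (fun M : 'rV[R]_m => M ord0 j : R^o)).
    exact: df.
  exact: differentiable_coord.
apply: Ck_ext (IH _ (cf v)) => // x Ux.
by rewrite derive_mx ?mxE//; exact/diff_derivable/df.
Qed.

Lemma smooth_on_ext W U (f g : rV -> W) : open U ->
  (forall x, U x -> f x = g x) -> smooth_on U f -> smooth_on U g.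
Proof. by move=> oU fg sf k; exact: Ck_ext (sf k). Qed.

Lemma smooth_on_sub W U V (f : rV -> W) : V `<=` U -> smooth_on U f -> smooth_on V f.
Proof. by move=> VU sf k; exact: Ck_sub (sf k). Qed.

Lemma smooth_on_diff W U (f : rV -> W) x : smooth_on U f -> U x -> differentiable f x.
Proof. by move=> sf Ux; have [+ _] := sf 1%N; exact. Qed.

Lemma smooth_on_derive W U (f : rV -> W) v : smooth_on U f -> smooth_on U (fun x => 'D_v f x).
Proof. by move=> sf k; have [_] := sf k.+1; exact. Qed.

Lemma smooth_derive_comm U (f : rV -> R^o) p v w : open U -> U p -> smooth_on U f ->
  'D_w (fun x => 'D_v f x) p = 'D_v (fun x => 'D_w f x) p.
Proof.
move=> oU Up sf; apply: (@derive_comm _ _ f U p v w oU Up).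
- by move=> x Ux; exact: smooth_on_diff sf Ux.
- by move=> x Ux; exact: smooth_on_diff (smooth_on_derive v sf) Ux.
- by move=> x Ux; exact: smooth_on_diff (smooth_on_derive w sf) Ux.
- apply: differentiable_continuous.
  exact: smooth_on_diff (smooth_on_derive w (smooth_on_derive v sf)) Up.
- apply: differentiable_continuous.
  exact: smooth_on_diff (smooth_on_derive v (smooth_on_derive w sf)) Up.
Qed.

End smooth_on.

(** * Tangent vectors and vector fields on manifolds *)

Section manifold.
Context (R : realType) (n : nat) (M : manifold R n).
Implicit Types (x y : M) (U V : set M) (f g : M -> R) (i j : chart_index M) (v w : tvec M).

Lemma chart_img_open i U : open U -> open (chart i @` (U `&` chart_dom i)).
Proof.
move=> oU; rewrite openE => _ [x [Ux ix] <-].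
have im : (chart i @` chart_dom i) (chart i x) by exists x.
have A : \forall y \near chart i x, (chart i @` chart_dom i) y.
  by apply: open_nbhs_nbhs; split=> //; exact: mfd_img_open.
have B : \forall y \near chart i x, U (chart_inv i y).
  have := mfd_pinv_cont im; apply; rewrite (mfd_chartK ix).
  exact: open_nbhs_nbhs.
apply: filterS2 A B => y [z iz <-]; rewrite (mfd_chartK iz) => Uz.
by exists z.
Qed.

Arguments chart_img_open i [U].

Lemma smooth_fun_sub U V f : V `<=` U -> smooth_fun U f -> smooth_fun V f.
Proof.
move=> VU sf i; apply: smooth_on_sub (sf i).
by apply: image_subset; exact: setSI.
Qed.

Lemma smooth_fun_ext U f g : open U -> (forall x, U x -> f x = g x) ->
  smooth_fun U f -> smooth_fun U g.
Proof.
move=> oU fg sf i; apply: smooth_on_ext (sf i); first exact: chart_img_open.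
by move=> _ [x [Ux ix] <-]; rewrite /= (mfd_chartK ix) fg.
Qed.

Lemma smooth_fun_cst U (c : R) : open U -> smooth_fun U (fun=> c).
Proof. by move=> oU i k; apply: Ck_cst; exact: chart_img_open. Qed.

Lemma smooth_funD U f g : open U -> smooth_fun U f -> smooth_fun U g ->
  smooth_fun U (fun x => f x + g x).
Proof. by move=> oU sf sg i k; apply: CkD; [exact: chart_img_open|exact: sf|exact: sg]. Qed.

Lemma smooth_funM U f g : open U -> smooth_fun U f -> smooth_fun U g ->
  smooth_fun U (fun x => f x * g x).
Proof. by move=> oU sf sg i k; apply: CkM; [exact: chart_img_open|exact: sf|exact: sg]. Qed.

Lemma smooth_fun_sum (I : Type) (s : seq I) (P : pred I) U (f : I -> M -> R) : open U ->
  (forall b, smooth_fun U (f b)) -> smooth_fun U (fun x => \sum_(b <- s | P b) f b x).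
Proof.
move=> oU sf; elim: s => [|a s IH].
  by under eq_fun do rewrite big_nil; exact: smooth_fun_cst.
under eq_fun do rewrite big_cons.
by case: (P a) => //; exact: smooth_funD.
Qed.

Lemma smooth_fun_prod (I : Type) (s : seq I) (P : pred I) U (f : I -> M -> R) : open U ->
  (forall b, smooth_fun U (f b)) -> smooth_fun U (fun x => \prod_(b <- s | P b) f b x).
Proof.
move=> oU sf; elim: s => [|a s IH].
  by under eq_fun do rewrite big_nil; exact: smooth_fun_cst.
under eq_fun do rewrite big_cons.
by case: (P a) => //; exact: smooth_funM.
Qed.

Lemma smooth_funN U f : open U -> smooth_fun U f -> smooth_fun U (fun x => - f x).
Proof.
move=> oU sf; under eq_fun do rewrite -mulN1r.
by apply: smooth_funM => //; exact: smooth_fun_cst.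
Qed.

Lemma smooth_funB U f g : open U -> smooth_fun U f -> smooth_fun U g ->
  smooth_fun U (fun x => f x - g x).
Proof. by move=> oU sf sg; apply: smooth_funD => //; exact: smooth_funN. Qed.

Lemma smooth_near_fun U x f : open U -> U x -> smooth_fun U f -> smooth_near x f.
Proof. by move=> oU Ux sf; exists U. Qed.

Lemma smooth_near_ext U x f g : open U -> U x -> (forall y, U y -> f y = g y) ->
  smooth_near x f -> smooth_near x g.
Proof.
move=> oU Ux fg [V [oV Vx sf]]; exists (U `&` V); split=> //; first exact: openI.
apply: smooth_fun_ext (smooth_fun_sub (@subIsetr _ U V) sf); first exact: openI.
by move=> y [/fg].
Qed.

Lemma smooth_nearD x f g : smooth_near x f -> smooth_near x g ->
  smooth_near x (fun y => f y + g y).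
Proof.
move=> [U [oU Ux sf]] [V [oV Vx sg]]; exists (U `&` V); split=> //; first exact: openI.
by apply: smooth_funD; [exact: openI|exact: smooth_fun_sub sf|exact: smooth_fun_sub sg].
Qed.

Lemma smooth_nearM x f g : smooth_near x f -> smooth_near x g ->
  smooth_near x (fun y => f y * g y).
Proof.
move=> [U [oU Ux sf]] [V [oV Vx sg]]; exists (U `&` V); split=> //; first exact: openI.
by apply: smooth_funM; [exact: openI|exact: smooth_fun_sub sf|exact: smooth_fun_sub sg].
Qed.

Lemma smooth_near_cst x (c : R) : smooth_near x (fun=> c).
Proof. by exists setT; split=> //; [exact: openT|apply: smooth_fun_cst; exact: openT]. Qed.

Definition chart_coord i (k : 'I_n) : M -> R := fun y => chart i y ord0 k.

Lemma smooth_coord i k : smooth_fun (chart_dom i) (chart_coord i k).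
Proof.
move=> j m; have oi := mfd_dom_open i.
apply: (@Ck_coord _ _ _ _ _ (chart i \o chart_inv j) k).
  exact: chart_img_open.
by have := @mfd_smooth _ _ M j i m; rewrite setIC.
Qed.

Lemma smooth_near_coord i k x : chart_dom i x -> smooth_near x (chart_coord i k).
Proof. by move=> ix; exists (chart_dom i); split=> //; [exact: mfd_dom_open|exact: smooth_coord]. Qed.

Lemma smooth_near_chart i x f : chart_dom i x -> smooth_near x f ->
  exists V : set 'rV[R]_n, [/\ open V, V (chart i x), V `<=` chart i @` chart_dom i
    & smooth_on (W := R^o) V (f \o chart_inv i)].
Proof.
move=> ix [U [oU Ux sf]]; exists (chart i @` (U `&` chart_dom i)); split.
- exact: chart_img_open.
- by exists x.
- by apply: image_subset => y [].
- exact: sf.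
Qed.

Lemma dirderE x i xi f : smooth_near x f ->
  dirder x i xi f = 'D_xi (f \o chart_inv i : 'rV[R]_n -> R^o) (chart i x).
Proof. by move=> sf; rewrite /dirder; case: asboolP. Qed.

Lemma dirder0 x i xi f : ~ smooth_near x f -> dirder x i xi f = 0.
Proof. by move=> sf; rewrite /dirder; case: asboolP. Qed.

Lemma smooth_near_diff i x f : chart_dom i x -> smooth_near x f ->
  differentiable (f \o chart_inv i : 'rV[R]_n -> R^o) (chart i x).
Proof.
by move=> ix sf; have [V [oV Vx _ sV]] := smooth_near_chart ix sf; exact: smooth_on_diff sV Vx.
Qed.

Lemma chart_change_diff i j x : chart_dom i x -> chart_dom j x ->
  differentiable (chart i \o chart_inv j) (chart j x).
Proof.
move=> ix jx; apply: smooth_on_diff (@mfd_smooth _ _ M j i) _.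
by exists x.
Qed.

(** Chain rule through the transition map. The default value 0 depends only on smoothness near x, so
    it is the same in both charts. *)
Lemma dirder_chart i j x xi : chart_dom i x -> chart_dom j x ->
  dirder x j xi = dirder x i ('D_xi (chart i \o chart_inv j) (chart j x)).
Proof.
move=> ix jx; apply/funext => f.
case: (pselect (smooth_near x f)) => sf; last by rewrite !dirder0.
rewrite !dirderE//.
have E : (chart i \o chart_inv j) (chart j x) = chart i x by rewrite /= (mfd_chartK jx).
rewrite -E -derive_comp; last 2 first.
- exact: chart_change_diff.
- by rewrite E; exact: smooth_near_diff.
apply: (derive_ext _ (chart_img_open j (mfd_dom_open i))).
  by exists x.
by move=> _ [y [iy jy] <-]; rewrite /= (mfd_chartK jy) (mfd_chartK iy).
Qed.

Lemma tangentP i x v : chart_dom i x -> tangent x v -> exists xi, v = dirder x i xi.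
Proof.
move=> ix [j [xi [jx ->]]]; exists ('D_xi (chart i \o chart_inv j) (chart j x)).
exact: dirder_chart.
Qed.

Lemma tangent_dirder i x xi : chart_dom i x -> tangent x (dirder x i xi).
Proof. by move=> ix; exists i, xi. Qed.

Lemma dirder_linear i x (a : R) xi eta : chart_dom i x ->
  dirder x i (a *: xi + eta) = a *: dirder x i xi + dirder x i eta.
Proof.
move=> ix; apply/funext => f /=; rewrite !fctE.
case: (pselect (smooth_near x f)) => sf; last by rewrite !dirder0// scaler0 addr0.
by rewrite !dirderE// !deriveE ?linearP//; exact: smooth_near_diff.
Qed.

Lemma tangent_linear x (a : R) v w : tangent x v -> tangent x w -> tangent x (a *: v + w).
Proof.
have [i ix] := mfd_cover x.
move=> /(tangentP ix)[xi ->] /(tangentP ix)[eta ->].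
by rewrite -dirder_linear//; exact: tangent_dirder.
Qed.

Lemma tangent0 x : tangent x 0.
Proof.
have [i ix] := mfd_cover x.
have := @tangent_linear x (-1) _ _ (tangent_dirder 0 ix) (tangent_dirder 0 ix).
by rewrite scaleN1r addNr.
Qed.

Lemma tangentD x v w : tangent x v -> tangent x w -> tangent x (v + w).
Proof. by move=> tv tw; rewrite -[v]scale1r; exact: tangent_linear. Qed.

Lemma tangentZ x a v : tangent x v -> tangent x (a *: v).
Proof. by move=> tv; rewrite -[X in tangent _ X]addr0; apply: tangent_linear => //; exact: tangent0. Qed.

Lemma tangent_sum x (I : Type) (s : seq I) (P : pred I) (F : I -> tvec M) :
  (forall b, P b -> tangent x (F b)) -> tangent x (\sum_(b <- s | P b) F b).
Proof.
move=> tF; elim/big_ind: _ => //; [exact: tangent0|].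
by move=> v w; exact: tangentD.
Qed.

Lemma tan_nonsmooth x v f : tangent x v -> ~ smooth_near x f -> v f = 0.
Proof. by move=> [i [xi [ix ->]]] sf; exact: dirder0. Qed.

Lemma tanD x v f g : tangent x v -> smooth_near x f -> smooth_near x g ->
  v (fun y => f y + g y) = v f + v g.
Proof.
move=> [i [xi [ix ->]]] sf sg; rewrite !dirderE//; last exact: smooth_nearD.
by apply: deriveD; apply: diff_derivable; exact: smooth_near_diff.
Qed.

Lemma tanM x v f g : tangent x v -> smooth_near x f -> smooth_near x g ->
  v (fun y => f y * g y) = f x * v g + g x * v f.
Proof.
move=> [i [xi [ix ->]]] sf sg; rewrite !dirderE//; last exact: smooth_nearM.
have dv h : smooth_near x h -> derivable (h \o chart_inv i : _ -> R^o) (chart i x) xi.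
  by move=> sh; apply: diff_derivable; exact: smooth_near_diff.
by have := deriveM (dv _ sf) (dv _ sg); rewrite /= (mfd_chartK ix).
Qed.

Lemma tan_cst x v c : tangent x v -> v (fun=> c) = 0.
Proof.
by move=> [i [xi [ix ->]]]; rewrite !dirderE; [exact: derive_cst|exact: smooth_near_cst].
Qed.

Lemma tanN x v f : tangent x v -> smooth_near x f -> v (fun y => - f y) = - v f.
Proof.
move=> tv sf; under [X in v X]eq_fun do rewrite -mulN1r.
rewrite (tanM tv)//; last exact: smooth_near_cst.
by rewrite (tan_cst _ tv) mulr0 addr0 mulN1r.
Qed.

Lemma smooth_nearN x f : smooth_near x f -> smooth_near x (fun y => - f y).
Proof.
move=> sf; under eq_fun do rewrite -mulN1r.
by apply: smooth_nearM => //; exact: smooth_near_cst.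
Qed.

Lemma tanB x v f g : tangent x v -> smooth_near x f -> smooth_near x g ->
  v (fun y => f y - g y) = v f - v g.
Proof. by move=> tv sf sg; rewrite (tanD tv)// ?(tanN tv)//; exact: smooth_nearN. Qed.

Lemma smooth_near_sum (I : Type) (s : seq I) (P : pred I) x (f : I -> M -> R) :
  (forall b, smooth_near x (f b)) -> smooth_near x (fun y => \sum_(b <- s | P b) f b y).
Proof.
move=> sf; elim: s => [|a s IH].
  by under eq_fun do rewrite big_nil; exact: smooth_near_cst.
under eq_fun do rewrite big_cons.
by case: (P a) => //; exact: smooth_nearD.
Qed.

Lemma tan_sum (I : Type) (s : seq I) (P : pred I) x v (f : I -> M -> R) : tangent x v ->
  (forall b, smooth_near x (f b)) ->
  v (fun y => \sum_(b <- s | P b) f b y) = \sum_(b <- s | P b) v (f b).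
Proof.
move=> tv sf; elim: s => [|a s IH].
  by under [X in v X]eq_fun do rewrite big_nil; rewrite big_nil (tan_cst _ tv).
under [X in v X]eq_fun do rewrite big_cons; rewrite big_cons.
by case: (P a) => //; rewrite (tanD tv)// ?IH//; exact: smooth_near_sum.
Qed.

(** Locality, including the default value on functions that are not smooth near x. It lets
    identities that hold only near x be used under a tangent vector, which acts on functions of the
    whole manifold. *)
Lemma tan_ext U x v f g : tangent x v -> open U -> U x -> (forall y, U y -> f y = g y) ->
  v f = v g.
Proof.
move=> tv oU Ux fg; case: (pselect (smooth_near x f)) => sf; last first.
  rewrite !(tan_nonsmooth tv)// => sg; apply: sf.
  by apply: smooth_near_ext sg; [exact: oU|by []|move=> y /fg].
have sg := smooth_near_ext oU Ux fg sf.
move: tv => [i [xi [ix ->]]]; rewrite !dirderE//; 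
apply: (derive_ext _ (chart_img_open i oU)); first by exists x.
by move=> _ [y [Uy iy] <-]; rewrite /= (mfd_chartK iy) fg.
Qed.

(** The components of v in the chart i; on tangent vectors this inverts [dirder x i]. *)
Definition kappa i v : 'rV[R]_n := \row_k v (chart_coord i k).

Lemma kappa_dirder i x xi : chart_dom i x -> kappa i (dirder x i xi) = xi.
Proof.
move=> ix; apply/rowP => k; rewrite !mxE dirderE; last exact: smooth_near_coord.
have -> : xi ord0 k = ('D_xi id (chart i x) : 'rV[R]_n) ord0 k by rewrite derive_id.
rewrite (derive_mx (M := id)) ?mxE; last exact: derivable_id.
apply: (derive_ext _ (@mfd_img_open _ _ _ i)); first by exists x.
by move=> _ [y iy <-]; rewrite /chart_coord /= (mfd_chartK iy).
Qed.

Lemma tangent_kappa i x v : chart_dom i x -> tangent x v -> v = dirder x i (kappa i v).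
Proof. by move=> ix /(tangentP ix)[xi ->]; rewrite kappa_dirder. Qed.

Lemma kappa_inj i x v w : chart_dom i x -> tangent x v -> tangent x w ->
  kappa i v = kappa i w -> v = w.
Proof. by move=> ix tv tw E; rewrite (tangent_kappa ix tv) (tangent_kappa ix tw) E. Qed.

End manifold.
Arguments chart_img_open {R n M} i [U].

Lemma derive_rowE (R : realType) n (F : 'rV[R]_n -> R^o) p (u : 'rV[R]_n) :
  differentiable F p -> 'D_u F p = \sum_(k < n) u ord0 k * 'D_(delta_mx ord0 k) F p.
Proof.
move=> dF; rewrite deriveE// {1}[u]row_sum_delta linear_sum.
by apply: eq_bigr => k _; rewrite linearZ deriveE.
Qed.

(** * Vector fields and their commutators *)

Section vfield.
Context (R : realType) (n : nat) (M : manifold R n).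
Implicit Types (x y : M) (U V : set M) (f g : M -> R) (i j : chart_index M) (v w : tvec M).
Implicit Types (X Y Z : M -> tvec M).

Lemma vfield_on_sub U V X : V `<=` U -> vfield_on U X -> vfield_on V X.
Proof.
move=> VU [tX sX]; split=> [x /VU|O f oO OV]; first exact: tX.
by apply: sX => //; exact: subset_trans VU.
Qed.

Lemma vfield_on_ext U X Y : open U -> (forall x, U x -> X x = Y x) ->
  vfield_on U X -> vfield_on U Y.
Proof.
move=> oU XY [tX sX]; split=> [x Ux|O f oO OU sf]; first by rewrite -XY//; exact: tX.
apply: smooth_fun_ext (sX O f oO OU sf) => // x /OU Ux.
by rewrite /apply_vf XY.
Qed.

Lemma vfield_on_linear U (a : R) X Y : open U -> vfield_on U X -> vfield_on U Y ->
  vfield_on U (fun x => a *: X x + Y x).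
Proof.
move=> oU [tX sX] [tY sY]; split=> [x Ux|O f oO OU sf].
  by apply: tangent_linear; [exact: tX|exact: tY].
apply: (@smooth_funD _ _ _ _ (fun x => a * X x f) (fun x => Y x f)) => //; last exact: sY.
by apply: smooth_funM => //; [exact: smooth_fun_cst|exact: sX].
Qed.

Lemma vfield_on0 U : open U -> vfield_on U (fun=> 0 : tvec M).
Proof.
move=> oU; split=> [x _|O f oO OU sf]; first exact: tangent0.
exact: smooth_fun_cst.
Qed.

Lemma vfield_onD U X Y : open U -> vfield_on U X -> vfield_on U Y ->
  vfield_on U (fun x => X x + Y x).
Proof.
move=> oU vX vY; apply: (vfield_on_ext oU) (vfield_on_linear 1 oU vX vY) => x _.
by rewrite scale1r.
Qed.

Lemma vfield_onB U X Y : open U -> vfield_on U X -> vfield_on U Y ->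
  vfield_on U (fun x => X x - Y x).
Proof.
move=> oU vX vY; apply: (vfield_on_ext oU) (vfield_on_linear (-1) oU vY vX) => x _.
by rewrite scaleN1r addrC.
Qed.

Lemma smooth_near_apply U X x f : open U -> U x -> vfield_on U X -> smooth_near x f ->
  smooth_near x (apply_vf X f).
Proof.
move=> oU Ux [_ sX] [V [oV Vx sf]]; exists (V `&` U); split=> //; first exact: openI.
by apply: sX; [exact: openI|exact: subIsetr|exact: smooth_fun_sub sf].
Qed.

Lemma lieE X Y x f : smooth_near x f ->
  lie X Y x f = X x (apply_vf Y f) - Y x (apply_vf X f).
Proof. by move=> sf; rewrite /lie; case: asboolP. Qed.

Lemma lie_nonsmooth X Y x f : ~ smooth_near x f -> lie X Y x f = 0.
Proof. by move=> sf; rewrite /lie; case: asboolP. Qed.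

Lemma lieN X Y x : lie X Y x = - lie Y X x.
Proof.
apply/funext => f; rewrite !fctE; case: (pselect (smooth_near x f)) => sf.
  by rewrite !lieE// opprB.
by rewrite !lie_nonsmooth// oppr0.
Qed.

(** Product rule for Y f = sum Y^k d_k f. The first term has frozen components and is symmetric in v
    and Y x by Clairaut, so it cancels in a commutator; the second is of first order. *)
Lemma tan_apply_vf i x v Y U f : chart_dom i x -> tangent x v ->
  open U -> U x -> vfield_on U Y -> smooth_near x f ->
  let F : 'rV[R]_n -> R^o := f \o chart_inv i in
  v (apply_vf Y f) = 'D_(kappa i (Y x)) (fun q => 'D_(kappa i v) F q) (chart i x)
    + 'D_(\row_k v (apply_vf Y (chart_coord i k))) F (chart i x).
Proof.
move=> ix tv oU Ux vY sf F.
have [U0 [oU0 U0x sU0]] := sf.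
pose V := chart i @` (U0 `&` chart_dom i).
have oV : open V by exact: chart_img_open.
have Vx : V (chart i x) by exists x.
have sV : smooth_on V F by exact: sU0.
have sYc k : smooth_near x (apply_vf Y (chart_coord i k)).
  exact: smooth_near_apply vY (smooth_near_coord k ix).
have vE g : smooth_near x g -> v g = 'D_(kappa i v) (g \o chart_inv i : _ -> R^o) (chart i x).
  by move=> sg; rewrite {1}(tangent_kappa ix tv) dirderE.
rewrite vE; last exact: smooth_near_apply vY sf.
pose d k : 'rV[R]_n := delta_mx ord0 k.
(* The coordinate expression of Y f, which agrees with Y f only near x. *)
pose G := \sum_(k < n) (fun q => (apply_vf Y (chart_coord i k) (chart_inv i q)) * 'D_(d k) F q : R^o).
have -> : 'D_(kappa i v) (apply_vf Y f \o chart_inv i : _ -> R^o) (chart i x)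
  = 'D_(kappa i v) G (chart i x).
  apply: (@derive_ext _ _ _ (V `&` chart i @` (U `&` chart_dom i))).
  - by apply: openI => //; exact: chart_img_open.
  - by split=> //; exists x.
  move=> q [Vq [y [Uy iy] qy]]; move: Vq; rewrite -{q}qy => -[z [U0z iz] zy].
  have {zy} yz : y = z by rewrite -(mfd_chartK iy) -zy (mfd_chartK iz).
  rewrite -{}yz in U0z.
  rewrite /G fct_sumE /= (mfd_chartK iy).
  have sfy : smooth_near y f.
    exact: smooth_near_fun sU0.
  rewrite /apply_vf (tangent_kappa iy (vY.1 _ Uy)) dirderE//.
  rewrite derive_rowE; last exact: smooth_near_diff.
  apply: eq_bigr => k _; congr (_ * _).
  by rewrite -{1}(kappa_dirder (kappa i (Y y)) iy) mxE.
have dF q : V q -> differentiable F q by move=> Vq; exact: smooth_on_diff sV Vq.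
have dD (u : 'rV[R]_n) q : V q -> differentiable (fun q => 'D_u F q) q.
  by move=> Vq; exact: smooth_on_diff (smooth_on_derive u sV) Vq.
rewrite derive_sum; last first.
  move=> k; apply: derivableM; first exact/diff_derivable/smooth_near_diff.
  exact/diff_derivable/dD.
rewrite [in X in _ = X + _]derive_rowE; last exact: dD.
rewrite [in X in _ = _ + X]derive_rowE; last exact: dF.
rewrite -big_split; apply: eq_bigr => k _ /=.
have := @deriveM _ _ (fun q => apply_vf Y (chart_coord i k) (chart_inv i q)) (fun q => 'D_(d k) F q)
  (chart i x) (kappa i v).
move=> ->; last 2 first.
- exact/diff_derivable/smooth_near_diff.
- exact/diff_derivable/dD.
rewrite (mfd_chartK ix) mxE (smooth_derive_comm _ _ oV Vx sV) mxE vE//.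
by rewrite [X in _ + X]mulrC.
Qed.

(** The second-order terms of the two applications of [tan_apply_vf] cancel, leaving a directional
    derivative. *)
Lemma tangent_lie U X Y x : open U -> U x -> vfield_on U X -> vfield_on U Y ->
  tangent x (lie X Y x).
Proof.
move=> oU Ux vX vY; have [i ix] := mfd_cover x.
suff -> : lie X Y x = dirder x i (kappa i (lie X Y x)) by exact: tangent_dirder.
apply/funext => f; case: (pselect (smooth_near x f)) => sf; last first.
  by rewrite lie_nonsmooth// dirder0.
rewrite lieE// dirderE//.
rewrite (tan_apply_vf ix (vX.1 _ Ux) oU Ux vY sf) (tan_apply_vf ix (vY.1 _ Ux) oU Ux vX sf).
have [V [oV Vx _ sV]] := smooth_near_chart ix sf.
rewrite (smooth_derive_comm _ _ oV Vx sV) opprD addrACA subrr add0r.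
have dF := smooth_near_diff ix sf.
rewrite !deriveE// -linearB; congr ('d _ _ _).
by apply/rowP => k; rewrite !mxE lieE//; exact: smooth_near_coord.
Qed.

Lemma vfield_lie U X Y : open U -> vfield_on U X -> vfield_on U Y -> vfield_on U (lie X Y).
Proof.
move=> oU vX vY; split=> [x Ux|O f oO OU sf]; first exact: tangent_lie vX vY.
apply: (@smooth_fun_ext _ _ _ _ (fun x => X x (apply_vf Y f) - Y x (apply_vf X f))) => //.
  by move=> x Ox; rewrite /apply_vf lieE//; exact: smooth_near_fun sf.
apply: smooth_funB => //.
  by apply: vX.2 => //; exact: vY.2.
by apply: vY.2 => //; exact: vX.2.
Qed.

Lemma lie_linearl U (a : R) X X' Y x : open U -> U x ->
  vfield_on U X -> vfield_on U X' -> vfield_on U Y ->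
  lie (fun y => a *: X y + X' y) Y x = a *: lie X Y x + lie X' Y x.
Proof.
move=> oU Ux vX vX' vY; apply/funext => f; rewrite !fctE.
case: (pselect (smooth_near x f)) => sf; last by rewrite !lie_nonsmooth// scaler0 addr0.
have tY := vY.1 _ Ux.
rewrite !lieE// /apply_vf !fctE.
rewrite (@tanD _ _ _ x (Y x) (fun y => a * X y f) (fun y => X' y f))//; last 2 first.
- apply: smooth_nearM; [exact: smooth_near_cst|exact: smooth_near_apply vX sf].
- exact: smooth_near_apply vX' sf.
rewrite (@tanM _ _ _ x (Y x) (fun=> a) (fun y => X y f))//; last 2 first.
- exact: smooth_near_cst.
- exact: smooth_near_apply vX sf.
rewrite (tan_cst _ tY) mulr0 addr0 scalerBr opprD addrACA.
by [].
Qed.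

Lemma lieDl U X X' Y x : open U -> U x ->
  vfield_on U X -> vfield_on U X' -> vfield_on U Y ->
  lie (fun y => X y + X' y) Y x = lie X Y x + lie X' Y x.
Proof.
move=> oU Ux vX vX' vY; rewrite -[lie X Y x]scale1r -(lie_linearl _ oU Ux vX vX' vY).
by congr (lie _ _ _); apply/funext => y; rewrite scale1r.
Qed.

Lemma lieBl U X X' Y x : open U -> U x ->
  vfield_on U X -> vfield_on U X' -> vfield_on U Y ->
  lie (fun y => X y - X' y) Y x = lie X Y x - lie X' Y x.
Proof.
move=> oU Ux vX vX' vY; rewrite -scaleN1r addrC -(lie_linearl _ oU Ux vX' vX vY).
by congr (lie _ _ _); apply/funext => y; rewrite scaleN1r addrC.
Qed.

Lemma lieDr U X X' Y x : open U -> U x ->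
  vfield_on U X -> vfield_on U X' -> vfield_on U Y ->
  lie Y (fun y => X y + X' y) x = lie Y X x + lie Y X' x.
Proof. by move=> oU Ux vX vX' vY; rewrite lieN (lieDl oU Ux vX vX' vY) opprD -!lieN. Qed.

Lemma lieBr U X X' Y x : open U -> U x ->
  vfield_on U X -> vfield_on U X' -> vfield_on U Y ->
  lie Y (fun y => X y - X' y) x = lie Y X x - lie Y X' x.
Proof. by move=> oU Ux vX vX' vY; rewrite lieN (lieBl oU Ux vX vX' vY) opprB (lieN Y X) (lieN Y X') opprK addrC. Qed.

Lemma lie_jacobi U X Y Z x : open U -> U x ->
  vfield_on U X -> vfield_on U Y -> vfield_on U Z ->
  lie X (lie Y Z) x = lie (lie X Y) Z x + lie Y (lie X Z) x.
Proof.
move=> oU Ux vX vY vZ; apply/funext => f; rewrite !fctE.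
case: (pselect (smooth_near x f)) => sf; last by rewrite !lie_nonsmooth// addr0.
have [V [oV Vx sV]] := sf.
have lieV v A B : vfield_on U A -> vfield_on U B -> tangent x v ->
    v (apply_vf (lie A B) f) = v (apply_vf A (apply_vf B f)) - v (apply_vf B (apply_vf A f)).
  move=> vA vB tv.
  rewrite -(tanB tv); last 2 first.
  - exact: smooth_near_apply vA (smooth_near_apply oU Ux vB sf).
  - exact: smooth_near_apply vB (smooth_near_apply oU Ux vA sf).
  apply: (tan_ext tv oV Vx) => y Vy; rewrite {1}/apply_vf lieE//.
  exact: smooth_near_fun sV.
have tX := vX.1 _ Ux; have tY := vY.1 _ Ux; have tZ := vZ.1 _ Ux.
have sA A : vfield_on U A -> smooth_near x (apply_vf A f).
  by move=> vA; exact: smooth_near_apply vA sf.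
rewrite !lieE//; [|exact: sA..].
by rewrite !lieV//; ring.
Qed.

End vfield.

(** * Transport of vector fields by diffeomorphisms *)

Lemma differentiable_row (R : realType) n m (G : 'rV[R]_n -> 'rV[R]_m) p :
  (forall k, differentiable (fun q => G q ord0 k : R^o) p) -> differentiable G p.
Proof.
move=> dG; have -> : G = \sum_(k < m) (fun q => G q ord0 k *: (delta_mx ord0 k : 'rV[R]_m)).
  by apply/funext => q; rewrite fct_sumE {1}[G q]row_sum_delta.
by apply: differentiable_sum => k; exact: differentiableZl.
Qed.

(** The part of [cr_diffeo_on] that does not involve the CR structures, symmetric in its two sides
    so that statements about phi also apply to psi. *)
Record local_diffeo (R : realType) (n n' : nat) (M : manifold R n) (M' : manifold R n')
    (U : set M) (U' : set M') (phi : M -> M') (psi : M' -> M) : Prop := LocalDiffeo {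
  ld_open : open U;
  ld_open' : open U';
  ld_maps : forall x, U x -> U' (phi x);
  ld_maps' : forall y, U' y -> U (psi y);
  ld_K : forall x, U x -> psi (phi x) = x;
  ld_K' : forall y, U' y -> phi (psi y) = y;
  ld_smooth : smooth_map U phi;
  ld_smooth' : smooth_map U' psi }.

Lemma local_diffeo_sym (R : realType) (n n' : nat) (M : manifold R n) (M' : manifold R n')
    (U : set M) (U' : set M') (phi : M -> M') (psi : M' -> M) :
  local_diffeo U U' phi psi -> local_diffeo U' U psi phi.
Proof. by case=> *; split. Qed.

Section diffeo.
Context (R : realType) (n n' : nat) (M : manifold R n) (M' : manifold R n').

Lemma smooth_map_open (U : set M) (phi : M -> M') (O : set M') :
  open U -> smooth_map U phi -> open O -> open (U `&` phi @^-1` O).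
Proof.
move=> oU [cphi _] oO; rewrite openE => x [Ux Ox].
apply: filterI; first exact: open_nbhs_nbhs.
by apply: (cphi x Ux); exact: open_nbhs_nbhs.
Qed.

Lemma smooth_near_comp (U : set M) (phi : M -> M') x f : open U -> smooth_map U phi -> U x ->
  smooth_near (phi x) f -> smooth_near x (f \o phi).
Proof.
move=> oU sphi Ux [V [oV Vx sf]]; exists (U `&` phi @^-1` V); split=> //.
  exact: smooth_map_open.
exact: sphi.2.
Qed.

Lemma tangent_map_linear (phi : M -> M') (a : R) (v w : tvec M) :
  tangent_map phi (a *: v + w) = a *: tangent_map phi v + tangent_map phi w.
Proof. by []. Qed.

End diffeo.

(** Needed because tangent vectors take the value 0 on functions not smooth near the point:
    composition with phi must not turn such a function into a smooth one. *)
Lemma smooth_near_diffeo (R : realType) (n n' : nat) (M : manifold R n) (M' : manifold R n')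
    (U : set M) (U' : set M') (phi : M -> M') (psi : M' -> M) x f :
  local_diffeo U U' phi psi -> U x -> smooth_near x (f \o phi) -> smooth_near (phi x) f.
Proof.
move=> D Ux sf; have D' := local_diffeo_sym D.
apply: (@smooth_near_ext _ _ _ U' _ ((f \o phi) \o psi)).
- exact: ld_open' D.
- exact: ld_maps D _ Ux.
- by move=> y /(ld_K' D) /= ->.
apply: (smooth_near_comp (ld_open D') (ld_smooth D')); first exact: ld_maps D _ Ux.
by rewrite (ld_K D).
Qed.

Section local_diffeo.
Context (R : realType) (n n' : nat) (M : manifold R n) (M' : manifold R n').
Context (U : set M) (U' : set M') (phi : M -> M') (psi : M' -> M).
Hypothesis D : local_diffeo U U' phi psi.

Lemma tangent_tangent_map x v : U x -> tangent x v -> tangent (phi x) (tangent_map phi v).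
Proof.
move=> Ux; have [i ix] := mfd_cover x; have [j jy] := mfd_cover (phi x).
move=> /(tangentP ix)[xi ->].
pose G := chart j \o phi \o chart_inv i.
have dG : differentiable G (chart i x).
  apply: differentiable_row => k.
  apply: (@smooth_near_diff _ _ M i x (chart_coord j k \o phi)) => //.
  apply: (smooth_near_comp (ld_open D) (ld_smooth D)) => //.
  exact: smooth_near_coord.
suff -> : tangent_map phi (dirder x i xi) = dirder (phi x) j ('D_xi G (chart i x)).
  exact: tangent_dirder.
apply/funext => f; rewrite /tangent_map.
case: (pselect (smooth_near (phi x) f)) => sf; last first.
  rewrite [RHS]dirder0// dirder0//.
  by apply: contra_not sf; exact: smooth_near_diffeo D Ux.
have sfp : smooth_near x (f \o phi) by exact: smooth_near_comp (ld_open D) (ld_smooth D) Ux sf.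
rewrite !dirderE//.
have E : G (chart i x) = chart j (phi x) by rewrite /G /= (mfd_chartK ix).
rewrite -E -derive_comp//; last by rewrite E; exact: smooth_near_diff.
have oV : open (U `&` phi @^-1` chart_dom j).
  exact: smooth_map_open (ld_open D) (ld_smooth D) (@mfd_dom_open _ _ _ j).
apply: (derive_ext _ (chart_img_open i oV)); first by exists x.
by move=> _ [y [[Uy jy'] iy] <-]; rewrite /G /= (mfd_chartK iy) (mfd_chartK jy').
Qed.

Lemma tangent_mapK x v : U x -> tangent x v -> tangent_map psi (tangent_map phi v) = v.
Proof.
move=> Ux tv; apply/funext => f; rewrite /tangent_map.
by apply: (tan_ext tv (ld_open D) Ux) => y Uy /=; rewrite (ld_K D).
Qed.

(** A total function, but a vector field over U only, even for global X'; it is not a member of any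
    module of global sections. *)
Definition pullback (X' : M' -> tvec M') : M -> tvec M := fun x => tangent_map psi (X' (phi x)).

End local_diffeo.

Section pullback.
Context (R : realType) (n n' : nat) (M : manifold R n) (M' : manifold R n').
Context (U : set M) (U' : set M') (phi : M -> M') (psi : M' -> M).
Hypothesis D : local_diffeo U U' phi psi.
Let D' := local_diffeo_sym D.

Lemma tangent_pullback x w : U x -> tangent (phi x) w -> tangent x (tangent_map psi w).
Proof.
move=> Ux tw; rewrite -[x](ld_K D)//.
by apply: (tangent_tangent_map D') => //; exact: ld_maps D _ Ux.
Qed.

Lemma vfield_pullback X' : vfield_on setT X' -> vfield_on U (pullback phi psi X').
Proof.
move=> [tX sX]; split=> [x Ux|O f oO OU sf]; first by apply: tangent_pullback => //; exact: tX.
pose O' := U' `&` psi @^-1` O.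
have oO' : open O' by exact: smooth_map_open (ld_open D') (ld_smooth D') oO.
have sfp : smooth_fun O' (f \o psi) by exact: (ld_smooth D').2.
have := (ld_smooth D).2 _ _ oO' (sX _ _ oO' (@subsetT _ _) sfp).
apply: smooth_fun_sub => x Ox; have Ux := OU _ Ox; split=> //.
split; first exact: ld_maps D _ Ux.
by rewrite /= (ld_K D).
Qed.

Lemma lie_pullback X' Y' x : U x -> vfield_on setT X' -> vfield_on setT Y' ->
  lie (pullback phi psi X') (pullback phi psi Y') x = tangent_map psi (lie X' Y' (phi x)).
Proof.
move=> Ux vX vY; have Uy := ld_maps D Ux.
have tX := vX.1 (phi x) I; have tY := vY.1 (phi x) I.
apply/funext => f; rewrite /tangent_map; case: (pselect (smooth_near x f)) => sf; last first.
  rewrite !lie_nonsmooth// => sfp; apply: sf.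
  by rewrite -[x](ld_K D)//; apply: (smooth_near_diffeo D') => //.
have sfp : smooth_near (phi x) (f \o psi).
  by apply: (smooth_near_comp (ld_open D') (ld_smooth D')) => //; rewrite (ld_K D).
rewrite !lieE// /pullback /tangent_map; congr (_ - _).
  apply: (tan_ext tX (ld_open' D) Uy) => y U'y.
  by rewrite /apply_vf /= (ld_K' D).
apply: (tan_ext tY (ld_open' D) Uy) => y U'y.
by rewrite /apply_vf /= (ld_K' D).
Qed.

End pullback.

(** * CR structures whose core has type (B) *)

(** A subspace of maximal dimension inside W is all of W, as any further vector could be added to
    it. This gives a dimension to fibres that are defined as mere sets. *)
Lemma linset_vspace (K : fieldType) (V : vectType K) (W : set V) : W 0 ->
  (forall a u v, W u -> W v -> W (a *: u + v)) ->
  exists E : {vspace V}, forall v, W v <-> v \in E.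
Proof.
move=> W0 WL.
pose P d := `[< exists E : {vspace V}, \dim E = d /\ forall v, v \in E -> W v >].
have P0 : exists d, P d.
  exists 0%N; apply/asboolP; exists 0%VS; split; first exact: dimv0.
  by move=> v; rewrite memv0 => /eqP ->.
have Pb d : P d -> (d <= \dim {:V})%N by move=> /asboolP[E [<- _]]; exact/dimvS/subvf.
case: (ex_maxnP P0 Pb) => d /asboolP[E [dE EW]] dmax.
exists E => v; split=> [Wv|]; last exact: EW.
have : P (\dim (E + <[v]>)).
  apply/asboolP; exists (E + <[v]>)%VS; split=> // w /memv_addP[u uE [_ /vlineP[k ->] ->]].
  by rewrite addrC; apply: WL => //; exact: EW.
move=> /dmax; rewrite -dE => dle.
have /eqP -> : E == (E + <[v]>)%VS by rewrite eqEdim addvSl.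
by apply: (subvP (addvSr _ _)); exact: memv_line.
Qed.

(** Rank-nullity for a map that is linear on E only; composing with the projection onto E makes it
    linear everywhere. *)
Lemma dim_filtration (K : fieldType) (V V' : vectType K) (E E' : {vspace V})
    (G : {vspace V'}) (g : V -> V') : (E' <= E)%VS ->
  (forall a u v, u \in E -> v \in E -> g (a *: u + v) = a *: g u + g v) ->
  (forall u, u \in G <-> exists2 v, v \in E & g v = u) ->
  (forall v, v \in E -> g v = 0 <-> v \in E') ->
  \dim E = (\dim G + \dim E')%N.
Proof.
move=> EE gL gG gE'.
pose h v := g (projv E v).
have hL : linear h by move=> a u v; rewrite /h linearP gL ?memv_proj.
pose H : {linear V -> V'} := HB.pack h (GRing.isLinear.Build K V V' _ h hL).
have HE v : v \in E -> linfun H v = g v by move=> vE; rewrite lfunE /= /h projv_id.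
rewrite -(limg_ker_dim (linfun H) E) [LHS]addnC; congr (_ + _)%N; congr (\dim _).
  apply/vspaceP => u; apply/idP/idP.
    by move=> /memv_imgP[v vE ->]; apply/gG; exists v; rewrite ?HE.
  by move=> /gG[v vE <-]; rewrite -HE//; exact: memv_img.
apply/vspaceP => v; rewrite memv_cap memv_ker.
apply/andP/idP => [[vE /eqP]|vE']; first by rewrite HE// => /gE'; exact.
have vE := subvP EE _ vE'; split=> //; rewrite HE//.
by apply/eqP/gE'.
Qed.

(** * Dimensions of the fibres of the filtration *)

Section fibre.
Context (R : realType) (n : nat) (M : manifold R n).

Lemma distribution_linear (K : fieldType) (T : lmodType K) (sm : set M -> (M -> T) -> Prop) E r x :
  Defs.distribution sm E r ->
  E x 0 /\ forall (a : K) (v w : T), E x v -> E x w -> E x (a *: v + w).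
Proof.
move=> /(_ x)[U [X [_ Ux _ /(_ x Ux)[EX _]]]]; split=> [|a v w /EX[c ->] /EX[d ->]]; apply/EX.
  by exists (fun=> 0); rewrite big1// => i _; rewrite scale0r.
exists (fun i => a * c i + d i); rewrite scaler_sumr -big_split; apply: eq_bigr => i _ /=.
by rewrite scalerDl scalerA.
Qed.

Lemma distribution_tangent E r x v : Defs.distribution (@vfield_on R n M) E r -> E x v -> tangent x v.
Proof.
move=> /(_ x)[U [X [_ Ux vX /(_ x Ux)[EX _]]]] /EX[c ->].
by apply: tangent_sum => i _; apply: tangentZ; exact: (vX i).1.
Qed.

Lemma linset_cotangent (i : chart_index M) x (A : set (tvec M)) : chart_dom i x ->
  A 0 -> (forall a v w, A v -> A w -> A (a *: v + w)) ->
  exists E : {vspace 'rV[R]_n}, forall xi, xi \in E <-> A (dirder x i xi).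
Proof.
move=> ix A0 AL.
have d0 : dirder x i 0 = 0 by rewrite (_ : 0 = kappa i 0) -?tangent_kappa//;
  [exact: tangent0|apply/rowP => k; rewrite !mxE].
have [||E EP] := @linset_vspace _ _ [set xi | A (dirder x i xi)].
- by rewrite /= d0.
- by move=> a u v /= Au Av; rewrite dirder_linear//; exact: AL.
by exists E => xi; rewrite -EP.
Qed.

End fibre.

Section cr_fibres.
Context (R : realType) (n : nat) (M : manifold R n) (S : crData M).
Hypothesis reg : regular_CR S.

Lemma tanaka0E k : tanaka S k `<=` tanaka S k.+1.
Proof.
move=> X TX; exists X, [::]; split=> //.
by rewrite big_nil addr0.
Qed.

Lemma fib_tanaka_linear k x : fib (tanaka S k) x 0 /\
  forall (a : R) v w, fib (tanaka S k) x v -> fib (tanaka S k) x w -> fib (tanaka S k) x (a *: v + w).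
Proof. by have [[r dE] _] := reg_tanaka reg k; exact: distribution_linear dE. Qed.

Lemma fib_freeman_linear k x : fib (freeman S k) x 0 /\
  forall (a : R[i]) v w, fib (freeman S k) x v -> fib (freeman S k) x w -> fib (freeman S k) x (a *: v + w).
Proof. by have [[r dE] _] := reg_freeman reg k; exact: distribution_linear dE. Qed.

Lemma fib_tanaka_tangent k x v : fib (tanaka S k) x v -> tangent x v.
Proof. by have [[r dE] _] := reg_tanaka reg k; exact: distribution_tangent dE. Qed.

Lemma crD_linear x : crD S x 0 /\
  forall (a : R) v w, crD S x v -> crD S x w -> crD S x (a *: v + w).
Proof. by have [r dE] := cr_distribution (reg_cr reg); exact: distribution_linear dE. Qed.

Lemma crD_tangent x v : crD S x v -> tangent x v.
Proof. by have [r dE] := cr_distribution (reg_cr reg); exact: distribution_tangent dE. Qed.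

Lemma freemanS k : freeman S k.+1 `<=` freeman S k.
Proof. by move=> X []. Qed.

Lemma freeman_sec10 k : freeman S k `<=` sec10 S.
Proof. by elim: k => // k IH X /freemanS /IH. Qed.

Lemma sec10_re Z : sec10 S Z -> tanaka S 0 (re_vf Z).
Proof. by move=> [[vre vim] DZ]; split=> // x; have [] := DZ x. Qed.

Lemma fib_tanaka0_crD x v : fib (tanaka S 0) x v -> crD S x v.
Proof. by move=> [X [_ XD] <-]. Qed.

Lemma re_freeman_linear k x : let A := [set z.1 | z in fib (freeman S k) x] in A 0 /\
  forall (a : R) v w, A v -> A w -> A (a *: v + w).
Proof.
have [F0 FL] := fib_freeman_linear k x; split; first by exists 0.
move=> a _ _ [z Fz <-] [w Fw <-].
exists (Complex a 0 *: z + w); first exact: FL.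
by rewrite /= scale0r subr0.
Qed.

Lemma re_freeman_eq0 k x z : fib (freeman S k) x z ->
  (forall v, [set z.1 | z in fib (freeman S k) x] v -> v = 0) -> z = 0.
Proof.
move=> Fz A0; have [F0 FL] := fib_freeman_linear k x.
have z1 : z.1 = 0 by apply: A0; exists z.
have z2 : z.2 = 0.
  apply: A0; exists (Complex 0 (-1) *: z + 0); first exact: FL.
  by rewrite /= scale0r sub0r scaleN1r opprK addr0.
by case: z z1 z2 {Fz} => ? ? /= -> ->.
Qed.

End cr_fibres.

(** The core sees only the vectors reached by global sections, so the rank of D has to be deduced.
    The graded pieces have dimensions 1, 4 and 2, which fill the tangent space and leave 0 for F_1.
    Hence global sections of D reach a subspace of dimension 6 in each fibre. *)
Lemma core_dims (R : realType) (M : manifold R 7) (S : crData M) (m : coreData R) x :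
  regular_CR S -> type_B m -> core_at S x m ->
  [/\ forall v, tangent x v -> fib (tanaka S 1) x v,
      forall v, crD S x v -> fib (tanaka S 0) x v,
      forall z, fib (freeman S 2) x z -> z = 0
    & exists2 r, Defs.distribution (@vfield_on R 7 M) (crD S) r & r = 6].
Proof.
move=> reg [d2 d1 d0 _] [pi [[piL piG piK] _]].
have [i ix] := mfd_cover x.
have T k := fib_tanaka_linear reg k x.
have F k := re_freeman_linear reg k x.
have [E2 E2P] := linset_cotangent ix (T 1%N).1 (T 1%N).2.
have [E1 E1P] := linset_cotangent ix (T 0%N).1 (T 0%N).2.
have [E0 E0P] := linset_cotangent ix (F 1%N).1 (F 1%N).2.
have [EP EPP] := linset_cotangent ix (F 2%N).1 (F 2%N).2.
have [ED EDP] := linset_cotangent ix (crD_linear reg x).1 (crD_linear reg x).2.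
have FT k v : [set z.1 | z in fib (freeman S k) x] v -> fib (tanaka S 0) x v.
  move=> [z [X FX <-] <-]; exists (re_vf X) => //.
  exact/sec10_re/(freeman_sec10 FX).
have tD v : tangent x v -> v = dirder x i (kappa i v) by exact: tangent_kappa.
have step p (E E' : {vspace 'rV[R]_7}) :
    (forall v, cr_filt S p x v -> tangent x v) ->
    (forall xi, xi \in E <-> cr_filt S p x (dirder x i xi)) ->
    (forall xi, xi \in E' <-> cr_filt S (p + 1) x (dirder x i xi)) ->
    (E' <= E)%VS -> \dim E = (\dim (gr m p) + \dim E')%N.
  move=> tp EP1 EP2 EE.
  apply: (@dim_filtration _ _ _ E E' (gr m p) (fun xi => pi p (dirder x i xi))) => //.
  - by move=> a u v uE vE; rewrite dirder_linear// piL//; apply/EP1.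
  - move=> u; split=> [/piG[v vp <-]|[xi xiE <-]].
      by exists (kappa i v); [apply/EP1; rewrite -tD//; exact: tp|rewrite -tD//; exact: tp].
    by apply/piG; exists (dirder x i xi) => //; apply/EP1.
  - by move=> xi xiE; rewrite piK; [exact: iff_sym|exact/EP1].
have e2 : \dim E2 = (\dim (gr m (-2)) + \dim E1)%N.
  apply: (step (-2)) => //.
    by move=> v; exact: fib_tanaka_tangent.
  apply/subvP => xi /E1P [X TX XE]; apply/E2P; exists X => //; exact: tanaka0E.
have e1 : \dim E1 = (\dim (gr m (-1)) + \dim E0)%N.
  apply: (step (-1)) => //.
    by move=> v; exact: fib_tanaka_tangent.
  by apply/subvP => xi /E0P /FT /E1P.
have e0 : \dim E0 = (\dim (gr m (0)) + \dim EP)%N.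
  apply: (step 0) => //.
    by move=> v /(@FT 1%N); exact: fib_tanaka_tangent.
  apply/subvP => xi /EPP [z [X FX XE] zE]; apply/E0P; exists z => //; exists X => //.
  exact: freemanS.
rewrite d2 in e2; rewrite d1 in e1; rewrite d0 in e0.
have e7 : (\dim E2 <= 7)%N by have := dimvS (subvf E2); rewrite dimvf /dim /= mul1n.
have eP : \dim EP = 0%N by lia.
have E2f : E2 = fullv by apply/eqP; rewrite eqEdim subvf dimvf /dim /= mul1n; lia.
have [r dr] := cr_distribution (reg_cr reg).
have E1D : (E1 <= ED)%VS.
  by apply/subvP => xi /E1P /fib_tanaka0_crD /EDP.
have dED : \dim ED = r.*2.
  have [U [X [oU Ux vX /(_ x Ux)[EX Xfree]]]] := dr x.
  pose b := [tuple kappa i (X j x) | j < r.*2].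
  have kS (c : 'I_(r.*2) -> R) : kappa i (\sum_j c j *: X j x) = \sum_j c j *: b`_j.
    rewrite (_ : \sum_j c j *: b`_j = \sum_j c j *: kappa i (X j x)); last first.
      by apply: eq_bigr => j _; rewrite -tnth_nth tnth_mktuple.
    apply/rowP => k; rewrite !mxE fct_sumE summxE; apply: eq_bigr => j _.
    by rewrite !mxE.
  have tX j : tangent x (X j x) by exact: (vX j).1.
  have bf : free b.
    apply/freeP => c; rewrite -kS => c0 j; apply: Xfree.
    rewrite (tD (\sum_j0 c j0 *: X j0 x)); last by apply: tangent_sum => l _; exact: tangentZ.
    rewrite c0 (_ : 0 = kappa i 0); last by apply/rowP => l; rewrite !mxE.
    by rewrite -tD//; exact: tangent0.
  have -> : ED = <<b>>%VS.
    apply/vspaceP => xi; apply/idP/idP => [/EDP /EX[c cE]|xib].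
      rewrite -(kappa_dirder xi ix) cE kS; apply: memv_suml => j _; apply: memvZ.
      by apply: memv_span; rewrite -tnth_nth; exact: mem_tnth.
    apply/EDP/EX; exists (fun j => coord b j xi).
    have {1}-> : xi = kappa i (\sum_j coord b j xi *: X j x) by rewrite kS -coord_span.
    by rewrite -tD//; apply: tangent_sum => l _; exact: tangentZ.
  by move: bf; rewrite /free size_tuple => /eqP.
have dle := dimvS E1D.
have d7 : (\dim ED <= 7)%N by have := dimvS (subvf ED); rewrite dimvf /dim /= mul1n.
(* D has even rank between 6 and 7, so global sections span it. *)
have r3 : r = 3 by rewrite -muln2 in dED; lia.
split.
- by move=> v tv; rewrite (tD v)//; apply/E2P; rewrite E2f memvf.
- move=> v Dv; rewrite (tD v); last exact: crD_tangent Dv.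
  apply/E1P; have /eqP -> : E1 == ED by rewrite eqEdim E1D; lia.
  by apply/EDP; rewrite -tD//; exact: crD_tangent Dv.
- move=> z Fz; apply: (re_freeman_eq0 reg Fz) => v Av.
  have tv : tangent x v by apply: fib_tanaka_tangent reg _ _ _ (FT _ _ Av).
  rewrite (tD v)//; have : kappa i v \in EP by apply/EPP; rewrite -tD.
  have /eqP -> : EP == 0%VS by rewrite -dimv_eq0 eP.
  rewrite memv0 => /eqP ->; rewrite (_ : 0 = kappa i 0); last by apply/rowP => l; rewrite !mxE.
  by rewrite -tD//; exact: tangent0.
- by exists r.*2 => //; rewrite r3.
Qed.

(** * Contact forms *)

(* [th] is a local contact form with kernel [E] and [om] represents [- d th];
   both are given by their values on tangent vectors. *)
Record contact_chart (R : realType) (n : nat) (M : manifold R n) (E : M -> set (tvec M))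
    (O : set M) (th : M -> tvec M -> R) (om : M -> tvec M -> tvec M -> R) : Prop := {
  ct_open : open O;
  ct_th_linear : forall y (a : R) v w, th y (a *: v + w) = a * th y v + th y w;
  ct_om_linearl : forall y (a : R) v v' w, om y (a *: v + v') w = a * om y v w + om y v' w;
  ct_om_anti : forall y v w, om y v w = - om y w v;
  ct_ker : forall y v, O y -> tangent y v -> (E y v <-> th y v = 0);
  ct_lie : forall (V : set M) X Y y, open V -> V `<=` O -> V y ->
    vfield_on V X -> vfield_on V Y -> (forall z, V z -> E z (X z)) -> (forall z, V z -> E z (Y z)) ->
    th y (lie X Y y) = om y (X y) (Y y);
  ct_vanish : forall (V : set M) X Y Z y, open V -> V `<=` O -> V y ->
    vfield_on V X -> vfield_on V Y -> vfield_on V Z ->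
    (forall z, V z -> om z (X z) (Z z) = 0) -> X y = 0 -> om y (lie X Y y) (Z y) = 0 }.

Section contact.
Context (R : realType) (n : nat) (M : manifold R n.+1) (i : chart_index M).
Context (O : set M) (th : 'I_n.+1 -> M -> R).
Hypotheses (oO : open O) (iO : O `<=` chart_dom i).
Hypothesis (sth : forall k, smooth_fun O (th k)).

Definition form_th (y : M) (v : tvec M) : R := \sum_k th k y * v (chart_coord i k).
(** The coordinate expression of - d th for th = sum th_k dx_k. *)
Definition form_om (y : M) (v w : tvec M) : R :=
  \sum_k (w (th k) * v (chart_coord i k) - v (th k) * w (chart_coord i k)).

(** For [ct_lie], differentiate th(Y) = 0 along X and th(X) = 0 along Y, as in Cartan's formula. For
    [ct_vanish], differentiate om(X, Z) = 0 along Y: as X y = 0, only derivatives of the components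
    of X remain, and these are those of - [X, Y]. *)
Lemma form_contact (E : M -> set (tvec M)) :
  (forall y v, O y -> tangent y v -> (E y v <-> form_th y v = 0)) ->
  contact_chart E O form_th form_om.
Proof.
move=> EO.
have snc y k : O y -> smooth_near y (chart_coord i k).
  by move=> Oy; apply: smooth_near_coord; exact: iO.
have snt y k : O y -> smooth_near y (th k).
  by move=> Oy; exact: smooth_near_fun oO Oy (sth k).
split=> //.
- move=> y a v w; rewrite /form_th mulr_sumr -big_split; apply: eq_bigr => k _ /=.
  by rewrite !fctE mulrDr; congr (_ + _); rewrite mulrCA.
- move=> y a v v' w; rewrite /form_om mulr_sumr -big_split; apply: eq_bigr => k _ /=.
  by rewrite !fctE /GRing.scale /=; ring.
- move=> y v w; rewrite /form_om -sumrN; apply: eq_bigr => k _ /=; ring.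
- move=> V X Y y oV VO Vy vX vY EX EY.
  have key X' Y' : vfield_on V X' -> vfield_on V Y' -> (forall z, V z -> E z (Y' z)) ->
      \sum_k th k y * X' y (apply_vf Y' (chart_coord i k)) =
      - \sum_k X' y (th k) * Y' y (chart_coord i k).
    move=> vX' vY' EY'; apply/eqP; rewrite -addr_eq0 -big_split /=; apply/eqP.
    have tX := vX'.1 _ Vy.
    rewrite -[RHS](tan_cst 0 tX).
    rewrite (tan_ext tX oV Vy (g := fun z => \sum_k th k z * Y' z (chart_coord i k))); last first.
      by move=> z Vz; apply/esym/EO; [exact: VO|exact: vY'.1|exact: EY'].
    rewrite (tan_sum _ _ tX (f := fun k z => th k z * Y' z (chart_coord i k))); last first.
      move=> k; apply: smooth_nearM; first exact/snt/VO.
      exact: smooth_near_apply oV Vy vY' (snc _ _ (VO _ Vy)).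
    apply: eq_bigr => k _; rewrite (tanM (g := fun z => Y' z (chart_coord i k)) tX).
    + by rewrite /apply_vf [X in _ = _ + X]mulrC.
    + exact/snt/VO.
    + exact: smooth_near_apply oV Vy vY' (snc _ _ (VO _ Vy)).
  rewrite /form_th; under eq_bigr => k _ do rewrite (lieE _ _ (snc _ _ (VO _ Vy))) mulrBr.
  rewrite sumrB (key X Y)// (key Y X)// opprK addrC /form_om sumrB; congr (_ - _).
- move=> V X Y Z y oV VO Vy vX vY vZ omXZ X0.
  have tY := vY.1 _ Vy; have Oy := VO _ Vy.
  have lieX f : smooth_near y f -> lie X Y y f = - Y y (apply_vf X f).
    by move=> sf; rewrite lieE// X0 -[RHS]add0r.
  have sc X' k : vfield_on V X' -> smooth_near y (fun z => X' z (chart_coord i k)).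
    by move=> vX'; exact: smooth_near_apply oV Vy vX' (snc _ _ Oy).
  have st X' k : vfield_on V X' -> smooth_near y (fun z => X' z (th k)).
    by move=> vX'; exact: smooth_near_apply oV Vy vX' (snt _ _ Oy).
  have : Y y (fun=> 0) = 0 by exact: tan_cst tY.
  rewrite (tan_ext tY oV Vy (g := fun z => \sum_k (Z z (th k) * X z (chart_coord i k)
     - X z (th k) * Z z (chart_coord i k)))); last by move=> z Vz; rewrite -[LHS](omXZ z Vz).
  rewrite (tan_sum _ _ tY (f := fun k z => Z z (th k) * X z (chart_coord i k)
     - X z (th k) * Z z (chart_coord i k))); last first.
    move=> k; apply: smooth_nearD; first by apply: smooth_nearM; [exact: st|exact: sc].
    by apply: smooth_nearN; apply: smooth_nearM; [exact: st|exact: sc].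
  move=> sum0; apply/eqP; rewrite -oppr_eq0 -[X in _ == X]sum0 /form_om -sumrN; apply/eqP.
  apply: eq_bigr => k _.
  rewrite (tanB tY (f := fun z => Z z (th k) * X z (chart_coord i k))
    (g := fun z => X z (th k) * Z z (chart_coord i k))); last 2 first.
  + by apply: smooth_nearM; [exact: st|exact: sc].
  + by apply: smooth_nearM; [exact: st|exact: sc].
  rewrite (tanM tY (f := fun z => Z z (th k)) (g := fun z => X z (chart_coord i k))); last 2 first.
  + exact: st.
  + exact: sc.
  rewrite (tanM tY (f := fun z => X z (th k)) (g := fun z => Z z (chart_coord i k))); last 2 first.
  + exact: st.
  + exact: sc.
  rewrite !lieX; [|exact: snt|exact: snc].
  have X00 f : X y f = 0 by rewrite X0.
  by rewrite !X00 /apply_vf; ring.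
Qed.

End contact.

(** A relation among the rows must involve the first one, because the rows of A are independent. *)
Lemma det_col_mx_eq0 (F : fieldType) n (v : 'rV[F]_n.+1) (A : 'M[F]_(n, n.+1)) :
  (forall c : 'rV[F]_n, c *m A = 0 -> c = 0) ->
  \det (col_mx v A : 'M[F]_(1 + n)) = 0 <-> exists c : 'rV[F]_n, v = c *m A.
Proof.
move=> Af; split=> [/eqP /det0P[w w0]|[c ->]].
  rewrite -[w](@hsubmxK _ 1 1 n) mul_row_col [lsubmx _]mx11_scalar mul_scalar_mx.
  set a := lsubmx _ _ _ => avA.
  have [a0|a0] := eqVneq a 0.
    move: avA; rewrite a0 scale0r add0r => /Af b0; case/eqP: w0.
    rewrite -[w](@hsubmxK _ 1 1 n) b0 [lsubmx _]mx11_scalar -/a a0 -scalemx1.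
    by rewrite scale0r row_mx0.
  exists (- a^-1 *: rsubmx (w : 'rV[F]_(1 + n))).
  rewrite -scalemxAl; apply: (scalerI a0); rewrite scalerA mulrN divff// scaleN1r.
  by apply/eqP; rewrite -addr_eq0 avA.
apply/eqP/det0P; exists (row_mx (1%:M : 'M[F]_1) (- c)).
  by apply/eqP => /(congr1 (@lsubmx _ 1 1 n)); rewrite row_mxKl linear0 => /eqP; rewrite oner_eq0.
by rewrite mul_row_col mul1mx mulNmx subrr.
Qed.

(** For a local frame X_1, ..., X_n of a hyperplane distribution, v -> det(v, X_1, ..., X_n) in a
    chart vanishes exactly on the span of the frame. *)
Lemma contact_exists (R : realType) (n : nat) (M : manifold R n.+1) (E : M -> set (tvec M)) (x : M) :
  Defs.distribution (@vfield_on R n.+1 M) E n ->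
  exists O th om, O x /\ contact_chart E O th om.
Proof.
move=> /(_ x)[U [X [oU Ux vX frame]]]; have [i ix] := mfd_cover x.
pose A y : 'M[R]_(n, n.+1) := \matrix_(a, b) X a y (chart_coord i b).
pose O := U `&` chart_dom i.
have oO : open O by apply: openI => //; exact: mfd_dom_open.
(* The cofactors along the row of v in that determinant; they are polynomial in the components of
   the frame, hence smooth. *)
pose th (k : 'I_n.+1) y : R := (-1) ^+ k * \det (\matrix_(a < n, c < n) X a y (chart_coord i (lift k c))).
have sth k : smooth_fun O (th k).
  apply: smooth_funM => //; first exact: smooth_fun_cst.
  apply: smooth_fun_sum => // s; apply: smooth_funM => //; first exact: smooth_fun_cst.
  apply: smooth_fun_prod => // a; under eq_fun do rewrite mxE.
  apply: (vX a).2 => //; first exact: subIsetl.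
  by apply: smooth_fun_sub (@smooth_coord _ _ _ i _); exact: subIsetr.
exists O, (form_th i th), (form_om i th); split=> //.
apply: form_contact => // [y []//|y v [Uy iy] tv].
have tX a : tangent y (X a y) by exact: (vX a).1.
have kE (c : 'rV_n) : kappa i (\sum_(j < n) c ord0 j *: X j y) = c *m A y.
  apply/rowP => b; rewrite !mxE fct_sumE; apply: eq_bigr => j _.
  by rewrite mxE.
have tS (c : 'I_n -> R) : tangent y (\sum_(j < n) c j *: X j y).
  by apply: tangent_sum => j _; exact: tangentZ.
have [EX Xfree] := frame y Uy.
have -> : form_th i th y v = \det (col_mx (kappa i v) (A y) : 'M[R]_(1 + n)).
  rewrite (expand_det_row _ ord0); apply: eq_bigr => k _.
  rewrite [RHS]mulrC; congr (_ * _); last first.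
    transitivity (kappa i v ord0 k); first by rewrite mxE.
    by rewrite -(col_mxEu _ (A y)); congr (col_mx _ _ _ _); exact/val_inj.
  rewrite /cofactor add0n; congr (_ * \det _); apply/matrixP => a b.
  rewrite mxE [RHS]mxE [RHS]mxE; transitivity (A y a (lift k b)); first by rewrite mxE.
  by rewrite -(col_mxEd (kappa i v) (A y)); congr (col_mx _ _ _ _); exact/val_inj.
rewrite det_col_mx_eq0; last first.
  move=> c cA0; apply/rowP => j; rewrite mxE; apply: (Xfree (fun j => c ord0 j)).
  apply: (kappa_inj iy) => //; first exact: tangent0.
  by rewrite kE cA0; apply/rowP => k; rewrite !mxE.
split=> [/EX[c ->]|[c cE]].
  exists (\row_j c j); rewrite -kE; congr (kappa _ _); apply: eq_bigr => j _.
  by rewrite mxE.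
apply/EX; exists (fun j => c ord0 j); apply: (kappa_inj iy) => //.
by rewrite kE.
Qed.

Lemma nondegenerate (R : realType) (t : R) (M : manifold R 7) (S : crData M) : 0 <= t ->
  strongly_regular S (canon_core t) -> nondegenerate_CR S 2.
Proof.
move=> t0 [reg core]; have mB := canon_typeB t0.
split=> [j j2|X FX].
  have [x _] := mfd_inhabited M.
  have [pi [[piL piG piK] _]] := core x.
  have [_ _ d0 _] := mB.
  have u0 := memv_pick (gr (canon_core t) 0).
  have un0 : vpick (gr (canon_core t) 0) != 0 by rewrite vpick0 -dimv_eq0 d0.
  have [v [z [X FX XE] zE] vE] := (piG 0 _).1 u0.
  exists X.
    (* The Freeman modules decrease, so one nonzero section of index 1 also serves index 0. *)
    by move: j2; case: j => [|[|]]// _; exact: freemanS FX.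
  move=> X0; case/eqP: un0; rewrite -vE.
  have v0 : v = 0 by rewrite -zE -XE X0.
  have [A0 AL] := re_freeman_linear reg 1 x.
  by have := piL 0 (-1) 0 0 A0 A0; rewrite v0 scaler0 addr0 scaleN1r addNr.
apply/funext => x.
have [_ _ F2 _] := core_dims reg mB (core x).
by apply: F2; exists X.
Qed.

(** * The cubic form of a strongly regular CR manifold *)

Section levi.
Context (R : realType) (t : R) (M : manifold R 7) (S : crData M).
Hypothesis t0 : 0 <= t.
Hypothesis Sreg : strongly_regular S (canon_core t).
Local Notation C := (R[i]).
Local Notation m := (canon_core t).
Let reg : regular_CR S := Sreg.1.
Let cr : cr_structure S := reg_cr reg.
Let dims (x : M) := core_dims reg (canon_typeB t0) (Sreg.2 x).

(* [core_at S x m] with its projections made explicit. *)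
Definition core_proj (x : M) (pi : int -> tvec M -> amb m) : Prop :=
  [/\ forall p (a : R) v w, cr_filt S p x v -> cr_filt S p x w ->
        pi p (a *: v + w) = a *: pi p v + pi p w,
      forall p u, u \in gr m p <-> exists2 v, cr_filt S p x v & pi p v = u
    & forall p v, cr_filt S p x v -> (pi p v = 0 <-> cr_filt S (p + 1) x v)] /\
  [/\ forall p v, -1 <= p -> cr_filt S p x v -> pi p (crJ S x v) = cJ (pi p v),
      forall (k l : nat) (X Y : M -> tvec M), tanaka S k X -> tanaka S l Y ->
        pi (Negz k + Negz l) (lie X Y x) =
        cbr (pi (Negz k) (X x)) (pi (Negz l) (Y x))
    & forall (p : nat) (X Y A B : M -> cx (tvec M)),
        freeman S p.+1 X -> sec01 S Y -> freeman S p A -> sec01 S B ->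
        clie X Y = A + B ->
        cL p (cx_map (pi p%:Z) (X x)) (cx_map (pi (-1)) (Y x)) =
        cx_map (pi (p%:Z - 1)) (A x)].

Lemma core_projP x : exists pi, core_proj x pi.
Proof. exact: Sreg.2 x. Qed.

Lemma crD_fib x v : crD S x v <-> fib (tanaka S 0) x v.
Proof. by have [_ D _ _] := dims x; split; [exact: D|exact: fib_tanaka0_crD]. Qed.

Lemma crD_section x v : crD S x v -> exists2 X, tanaka S 0 X & X x = v.
Proof. by move=> /crD_fib. Qed.

Lemma crD0 x : crD S x 0. Proof. exact: (crD_linear reg x).1. Qed.

Lemma crDZ x a v : crD S x v -> crD S x (a *: v).
Proof. by move=> Dv; have := (crD_linear reg x).2 a _ _ Dv (crD0 x); rewrite addr0. Qed.

Lemma crDD x v w : crD S x v -> crD S x w -> crD S x (v + w).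
Proof. by move=> Dv; rewrite -[v]scale1r; exact: (crD_linear reg x).2. Qed.

Lemma crDN x v : crD S x v -> crD S x (- v).
Proof. by move=> Dv; rewrite -scaleN1r; exact: crDZ. Qed.

Lemma crJ0 x : crJ S x 0 = 0.
Proof.
by have := cr_J_linear cr (-1) (crD0 x) (crD0 x); rewrite scaleN1r oppr0 addr0 scaleN1r addNr.
Qed.

Lemma crJN x v : crD S x v -> crJ S x (- v) = - crJ S x v.
Proof.
by move=> Dv; have := cr_J_linear cr (-1) Dv (crD0 x); rewrite crJ0 !addr0 !scaleN1r.
Qed.

Lemma D10P x z : D10 S x z <-> crD S x z.1 /\ z.2 = - crJ S x z.1.
Proof.
split=> [[z1 z2]|[z1 E]].
  by rewrite cx_imagE => -[E1 E2]; split=> //; rewrite E1 opprK.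
split=> //; first by rewrite E; apply: crDN; exact: cr_J_stable.
rewrite cx_imagE /cx_map E opprK crJN; last exact: cr_J_stable.
by rewrite (cr_J_square cr z1) opprK.
Qed.

Lemma D01P x z : D01 S x z <-> crD S x z.1 /\ z.2 = crJ S x z.1.
Proof.
rewrite /D01 /= D10P /cx_conj /=; split=> -[z1 E]; split=> //; last by rewrite E.
by apply: oppr_inj.
Qed.

(** A global extension exists because global sections span D by [core_dims]; cutting off a local
    section is not involved. *)
Lemma sec01_section x v : crD S x v -> exists2 Y, sec01 S Y & Y x = (v, crJ S x v).
Proof.
move=> /crD_section[X [vX DX] <-]; exists (fun z => (X z, crJ S z (X z))) => //; split.
  split=> //; apply: (cr_J_smooth cr openT vX) => z _; exact: DX.
by move=> z; apply/D01P; split=> //; exact: DX.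
Qed.

Lemma tanaka0_0 : tanaka S 0 (fun=> 0).
Proof. by split; [exact: vfield_on0 openT|move=> x; exact: crD0]. Qed.

Lemma tanaka_lie X Y : tanaka S 0 X -> tanaka S 0 Y -> tanaka S 1 (lie X Y).
Proof.
move=> TX TY; exists (fun=> 0), [:: (X, Y)]; split.
- exact: tanaka0_0.
- by move=> YZ; rewrite inE => /eqP ->.
- by rewrite big_seq1; apply/funext => x; rewrite fctE add0r.
Qed.

(** The real part of X has zero class in m^{-1}, so by compatibility with the bracket of the core
    the commutator has zero class in m^{-2}. *)
Lemma freeman1_lie X Y x : freeman S 1 X -> tanaka S 0 Y -> crD S x (lie (re_vf X) Y x).
Proof.
move=> FX TY; have TX : tanaka S 0 (re_vf X) by exact/sec10_re/(freeman_sec10 FX).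
have [pi [[piL piG piK] [piJ pib piLL]]] := core_projP x.
have X0 : pi (-1) (re_vf X x) = 0.
  apply/(piK (-1)); first by exists (re_vf X).
  by exists (X x) => //; exists X.
have F2 : cr_filt S (-2) x (lie (re_vf X) Y x) by exists (lie (re_vf X) Y) => //; exact: tanaka_lie.
apply/crD_fib; apply: (piK (-2) _ F2).1.
have := pib 0%N 0%N _ _ TX TY => ->; rewrite [pi (Negz 0) _]X0.
by congr (_, _, _); rewrite /= /sp_B linear0 !mul0mx mxE.
Qed.

Section chart.
Context (O : set M) (th : M -> tvec M -> R) (om : M -> tvec M -> tvec M -> R).
Hypothesis ct : contact_chart (crD S) O th om.

Lemma th0 y : th y 0 = 0.
Proof. by have := ct_th_linear ct y (-1) 0 0; rewrite scaleN1r oppr0 addr0 mulN1r addNr. Qed.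

Lemma thD y v w : th y (v + w) = th y v + th y w.
Proof. by have := ct_th_linear ct y 1 v w; rewrite scale1r mul1r. Qed.

Lemma thZ y a v : th y (a *: v) = a * th y v.
Proof. by have := ct_th_linear ct y a v 0; rewrite !addr0 th0 addr0. Qed.

Lemma thB y v w : th y (v - w) = th y v - th y w.
Proof. by rewrite thD -scaleN1r thZ mulN1r. Qed.

Lemma omDl y u v w : om y (u + v) w = om y u w + om y v w.
Proof. by have := ct_om_linearl ct y 1 u v w; rewrite scale1r mul1r. Qed.

Lemma om0l y w : om y 0 w = 0.
Proof. by have := ct_om_linearl ct y (-1) 0 0 w; rewrite scaleN1r oppr0 addr0 mulN1r addNr. Qed.

Lemma omNl y v w : om y (- v) w = - om y v w.
Proof. by have := ct_om_linearl ct y (-1) v 0 w; rewrite addr0 om0l addr0 scaleN1r mulN1r. Qed.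

(** Both sides measure the class of [X, Y] modulo D, one through [pi (-2)] and the other through th.
    The factor is the inverse of th(v1) for a lift v1 of e^{-2}. *)
Lemma levi_core x pi : O x -> core_proj x pi -> exists2 c : R, c != 0 &
  forall a b, crD S x a -> crD S x b -> sp_B (pi (-1) a).1.2 (pi (-1) b).1.2 = c * om x a b.
Proof.
move=> Ox [[piL piG piK] [piJ pib piLL]].
have c2gr : c2_in 1 \in gr m (-2) by apply/gr2_canon; exists 1.
have [v1 F1 v1E] := (piG (-2) (c2_in 1)).1 c2gr.
have tg v : fib (tanaka S 1) x v -> tangent x v.
  by move=> Fv; exact: (fib_tanaka_tangent reg Fv).
have [T0 TL] := fib_tanaka_linear reg 1 x.
have th1 : th x v1 != 0.
  apply/eqP => /(ct_ker ct Ox (tg _ F1))/crD_fib D1.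
  have := (piK (-2) _ F1).2 D1; rewrite v1E => /(congr1 (fun u : ambB R => u.1.1)) /= /eqP.
  by rewrite oner_eq0.
exists (th x v1)^-1 => [|a b Da Db]; first by rewrite invr_eq0.
have [X TX XE] := crD_section Da; have [Y TY YE] := crD_section Db.
have F2 : fib (tanaka S 1) x (lie X Y x) by exists (lie X Y) => //; exact: tanaka_lie.
have oO := ct_open ct.
have thE : th x (lie X Y x) = om x a b.
  rewrite -XE -YE; apply: (ct_lie ct oO) => //.
  - exact: vfield_on_sub (@subsetT _ _) TX.1.
  - exact: vfield_on_sub (@subsetT _ _) TY.1.
  - by move=> z _; exact: TX.2.
  - by move=> z _; exact: TY.2.
(* Chosen so that [X, Y] - k v1 lies in ker th = D and is therefore killed by [pi (-2)]. *)
pose k := th x (lie X Y x) / th x v1.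
have Fk : fib (tanaka S 1) x (- k *: v1 + lie X Y x) by exact: TL.
have : crD S x (- k *: v1 + lie X Y x).
  apply/(ct_ker ct Ox (tg _ Fk)); rewrite thD thZ /k mulNr divfK// addNr.
  by [].
move=> /crD_fib /(piK (-2) _ Fk).2; rewrite (piL (-2))// v1E.
have -> : pi (-2) (lie X Y x) = cbr (pi (-1) (X x)) (pi (-1) (Y x)) := pib 0%N 0%N _ _ TX TY.
rewrite XE YE => /(congr1 (fun u : ambB R => u.1.1)) /= E.
have {}E : - k * 1 + sp_B (pi (-1) a).1.2 (pi (-1) b).1.2 = 0 := E.
rewrite mulrC -thE -/k; lra.
Qed.

(** Transferred from the J-invariance of B through [levi_core]. *)
Lemma om_J x a b : O x -> crD S x a -> crD S x b -> om x (crJ S x a) (crJ S x b) = om x a b.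
Proof.
move=> Ox Da Db; have [pi cp] := core_projP x; have [c c0 H] := levi_core Ox cp.
have [[piL piG piK] [piJ pib piLL]] := cp.
have Ja := cr_J_stable cr Da; have Jb := cr_J_stable cr Db.
apply: (mulfI c0); rewrite -!H//.
have JE v : crD S x v -> (pi (-1) (crJ S x v)).1.2 = sp_J R *m (pi (-1) v).1.2.
  by move=> /crD_fib Fv; rewrite (piJ (-1)).
by rewrite !JE// sp_B_J.
Qed.

Definition com (y : M) : cx (tvec M) -> cx (tvec M) -> cx R^o :=
  cx_bil (om y : tvec M -> tvec M -> R^o).

(** Formal consequence of J-invariance. Since [cr_involutive] concerns global sections, this is how
    commutators of local (0,1)-sections are shown to lie in the complexification of D. *)
Lemma com_D01 x z w : O x -> D01 S x z -> D01 S x w -> com x z w = 0.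
Proof.
move=> Ox /D01P[Dz Ez] /D01P[Dw Ew]; rewrite /com /cx_bil Ez Ew om_J// subrr.
have JDz := cr_J_stable cr Dz.
have -> : om x (crJ S x z.1) w.1 = - om x z.1 (crJ S x w.1).
  by rewrite -om_J// (cr_J_square cr Dz) omNl.
by rewrite addrN.
Qed.

Definition DC (y : M) (z : cx (tvec M)) : Prop := crD S y z.1 /\ crD S y z.2.

Lemma D01_DC y z : D01 S y z -> DC y z.
Proof. by move=> /D01P[Dz E]; split=> //; rewrite E; exact: cr_J_stable. Qed.

Lemma D10_DC y z : D10 S y z -> DC y z.
Proof. by case. Qed.

Lemma fib_freeman1_D10 y z : fib (freeman S 1) y z -> D10 S y z.
Proof. by move=> [X FX <-]; exact: (freeman_sec10 FX).2. Qed.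

(** The commutator of global extensions stays in D, so th annihilates it: the Freeman fibre lies in
    the Levi kernel. *)
Lemma om_freeman x k v : O x -> fib (freeman S 1) x k -> crD S x v -> om x k.1 v = 0.
Proof.
move=> Ox [X FX <-] /crD_section[Y TY <-]; have oO := ct_open ct.
have TX : tanaka S 0 (re_vf X) by exact/sec10_re/(freeman_sec10 FX).
have Dl := freeman1_lie x FX TY.
have tl : tangent x (lie (re_vf X) Y x) by exact: (crD_tangent reg Dl).
have <- : th x (lie (re_vf X) Y x) = om x (X x).1 (Y x).
  apply: (ct_lie ct oO) => //.
  - exact: vfield_on_sub (@subsetT _ _) TX.1.
  - exact: vfield_on_sub (@subsetT _ _) TY.1.
  - by move=> z _; exact: TX.2.
  - by move=> z _; exact: TY.2.
exact/(ct_ker ct Ox tl).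
Qed.

Lemma om_freeman2 x k v : O x -> fib (freeman S 1) x k -> crD S x v -> om x k.2 v = 0.
Proof.
move=> Ox Fk Dv; have [F0 FL] := fib_freeman_linear reg 1 x.
have := om_freeman Ox (FL (- imag) _ _ Fk F0) Dv.
by rewrite addr0 cx_NimagE.
Qed.

Lemma com_freeman x k w : O x -> fib (freeman S 1) x k -> DC x w -> com x k w = 0.
Proof.
move=> Ox Fk [D1 D2]; rewrite /com /cx_bil !(om_freeman Ox Fk)// !(om_freeman2 Ox Fk)//.
by rewrite subrr addr0.
Qed.

(** Converse of [om_freeman]. B is nondegenerate on m^{-1}, so k has zero class there and its real
    part is that of a Freeman vector; (1,0)-vectors with equal real parts are equal. This pointwise
    description of F_0 is what survives a local diffeomorphism. *)
Lemma freeman1_of_levi x k : O x -> D10 S x k -> (forall v, crD S x v -> om x k.1 v = 0) ->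
  fib (freeman S 1) x k.
Proof.
move=> Ox /D10P[Dk Ek] k0; have [pi cp] := core_projP x; have [c c0 H] := levi_core Ox cp.
have [[piL piG piK] [piJ pib piLL]] := cp.
have Fk := (crD_fib x _).1 Dk.
have Gk : pi (-1) k.1 \in gr m (-1) by apply/piG; exists k.1.
have [u uE] := (gr1_canon _).1 Gk.
have pk0 : pi (-1) k.1 = 0.
  rewrite uE; suff -> : u = 0 by [].
  apply: sp_B_nondeg => v; have : c1_in v \in gr m (-1) by apply/gr1_canon; exists v.
  move=> /(piG (-1))[b /crD_fib Db bE].
  by have := H _ _ Dk Db; rewrite uE bE k0// mulr0.
have [k' Fk' kE] := (piK (-1) _ Fk).1 pk0.
suff -> : k = k' by [].
have /D10P[_ Ek'] := fib_freeman1_D10 Fk'.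
by rewrite [k]surjective_pairing Ek -kE -Ek' -surjective_pairing.
Qed.

Section local.
Context (V : set M) (x : M).
Hypotheses (oV : open V) (VO : V `<=` O) (Vx : V x).

Definition csec (E : M -> set (cx (tvec M))) (Z : M -> cx (tvec M)) : Prop :=
  cvfield_on V Z /\ forall y, V y -> E y (Z y).

Lemma csecW (E E' : M -> set (cx (tvec M))) Z : (forall y z, E y z -> E' y z) ->
  csec E Z -> csec E' Z.
Proof. by move=> EE [vZ EZ]; split=> // y Vy; exact/EE/EZ. Qed.

Lemma cvfield_clie X Y : cvfield_on V X -> cvfield_on V Y -> cvfield_on V (clie X Y).
Proof.
move=> [X1 X2] [Y1 Y2]; split.
  by apply: vfield_onB => //; exact: vfield_lie.
by apply: vfield_onD => //; exact: vfield_lie.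
Qed.

Lemma cth_clie X Y y : V y -> csec DC X -> csec DC Y ->
  cx_map (th y : tvec M -> R^o) (clie X Y y) = com y (X y) (Y y).
Proof.
move=> Vy [[X1 X2] DX] [[Y1 Y2] DY].
have L A B : vfield_on V A -> vfield_on V B -> (forall z, V z -> crD S z (A z)) ->
    (forall z, V z -> crD S z (B z)) -> th y (lie A B y) = om y (A y) (B y).
  exact: (ct_lie ct).
have DX1 z : V z -> crD S z (re_vf X z) by move=> /DX[].
have DX2 z : V z -> crD S z (im_vf X z) by move=> /DX[].
have DY1 z : V z -> crD S z (re_vf Y z) by move=> /DY[].
have DY2 z : V z -> crD S z (im_vf Y z) by move=> /DY[].
by rewrite /cx_map /clie thB thD !L.
Qed.

Lemma clie_DC X Y : csec DC X -> csec DC Y -> (forall y, V y -> com y (X y) (Y y) = 0) ->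
  csec DC (clie X Y).
Proof.
move=> sX sY c0; have [vX _] := sX; have [vY _] := sY.
have [v1 v2] := cvfield_clie vX vY.
split; first by split.
move=> y Vy; have := cth_clie Vy sX sY; rewrite c0// => -[E1 E2]; split.
  exact/(ct_ker ct (VO Vy) (v1.1 y Vy)).
exact/(ct_ker ct (VO Vy) (v2.1 y Vy)).
Qed.

Lemma clie_jacobi X Y Z : cvfield_on V X -> cvfield_on V Y -> cvfield_on V Z ->
  clie X (clie Y Z) x = clie (clie X Y) Z x + clie Y (clie X Z) x.
Proof.
move=> [X1 X2] [Y1 Y2] [Z1 Z2].
have vl A B : vfield_on V A -> vfield_on V B -> vfield_on V (lie A B) by exact: vfield_lie.
have Br A B C : vfield_on V A -> vfield_on V B -> vfield_on V C ->
    lie A (fun y => B y - C y) x = lie A B x - lie A C x.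
  by move=> vA vB vC; exact: (lieBr oV Vx vB vC vA).
have Dr A B C : vfield_on V A -> vfield_on V B -> vfield_on V C ->
    lie A (fun y => B y + C y) x = lie A B x + lie A C x.
  by move=> vA vB vC; exact: (lieDr oV Vx vB vC vA).
have Bl A B C : vfield_on V A -> vfield_on V B -> vfield_on V C ->
    lie (fun y => B y - C y) A x = lie B A x - lie C A x.
  by move=> vA vB vC; exact: (lieBl oV Vx vB vC vA).
have Dl A B C : vfield_on V A -> vfield_on V B -> vfield_on V C ->
    lie (fun y => B y + C y) A x = lie B A x + lie C A x.
  by move=> vA vB vC; exact: (lieDl oV Vx vB vC vA).
have J A B C : vfield_on V A -> vfield_on V B -> vfield_on V C ->
    lie A (lie B C) x = lie (lie A B) C x + lie B (lie A C) x.
  exact: (lie_jacobi oV Vx).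
have E A B C (vA : cvfield_on V A) (vB : cvfield_on V B) (vC : cvfield_on V C) :
    clie A (clie B C) x =
    (lie (re_vf A) (lie (re_vf B) (re_vf C)) x - lie (re_vf A) (lie (im_vf B) (im_vf C)) x
     - (lie (im_vf A) (lie (re_vf B) (im_vf C)) x + lie (im_vf A) (lie (im_vf B) (re_vf C)) x),
     lie (re_vf A) (lie (re_vf B) (im_vf C)) x + lie (re_vf A) (lie (im_vf B) (re_vf C)) x
     + (lie (im_vf A) (lie (re_vf B) (re_vf C)) x - lie (im_vf A) (lie (im_vf B) (im_vf C)) x)).
  move: vA vB vC => [A1 A2] [B1 B2] [C1 C2].
  rewrite -!Br -?Dr//; by apply: vl.
have E' A B C (vA : cvfield_on V A) (vB : cvfield_on V B) (vC : cvfield_on V C) :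
    clie (clie A B) C x =
    (lie (lie (re_vf A) (re_vf B)) (re_vf C) x - lie (lie (im_vf A) (im_vf B)) (re_vf C) x
     - (lie (lie (re_vf A) (im_vf B)) (im_vf C) x + lie (lie (im_vf A) (re_vf B)) (im_vf C) x),
     lie (lie (re_vf A) (re_vf B)) (im_vf C) x - lie (lie (im_vf A) (im_vf B)) (im_vf C) x
     + (lie (lie (re_vf A) (im_vf B)) (re_vf C) x + lie (lie (im_vf A) (re_vf B)) (re_vf C) x)).
  move: vA vB vC => [A1 A2] [B1 B2] [C1 C2].
  rewrite -!Bl -?Dl//; by apply: vl.
rewrite !E ?E'//; rewrite (J (re_vf X) (re_vf Y) (re_vf Z))// (J (re_vf X) (im_vf Y) (im_vf Z))//.
rewrite (J (im_vf X) (re_vf Y) (im_vf Z))// (J (im_vf X) (im_vf Y) (re_vf Z))//.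
rewrite (J (re_vf X) (re_vf Y) (im_vf Z))// (J (re_vf X) (im_vf Y) (re_vf Z))//.
rewrite (J (im_vf X) (re_vf Y) (re_vf Z))// (J (im_vf X) (im_vf Y) (im_vf Z))//.
have pairD (a b c d : tvec M) : (a, b) + (c, d) = (a + c, b + d) :> cx (tvec M) by [].
by rewrite pairD; congr pair; apply/funext => f; rewrite !fctE; ring.
Qed.

(* Jacobi: [th [X, [Y, Z]]] vanishes because [Y, Z] lies in D and X in the Levi kernel. *)
Lemma com_sym X Y Z : csec (fun y => fib (freeman S 1) y) X -> csec (D01 S) Y -> csec (D01 S) Z ->
  com x (clie X Y x) (Z x) = com x (clie X Z x) (Y x).
Proof.
move=> sX sY sZ; have DX := csecW (fun y z (h : fib (freeman S 1) y z) => D10_DC (fib_freeman1_D10 h)) sX.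
have DY := csecW D01_DC sY; have DZ := csecW D01_DC sZ.
have XD A y : V y -> csec DC A -> com y (X y) (A y) = 0.
  by move=> Vy [_ DA]; apply: com_freeman; [exact: VO|exact: sX.2|exact: DA].
have DYZ : csec DC (clie Y Z).
  by apply: clie_DC => // y Vy; apply: com_D01; [exact: VO|exact: sY.2|exact: sZ.2].
have DXY : csec DC (clie X Y) by apply: clie_DC => // y Vy; exact: XD.
have DXZ : csec DC (clie X Z) by apply: clie_DC => // y Vy; exact: XD.
have := cth_clie Vx DX DYZ; rewrite XD// (clie_jacobi sX.1 sY.1 sZ.1).
have cthD z w : cx_map (th x : tvec M -> R^o) (z + w) =
    cx_map (th x : tvec M -> R^o) z + cx_map (th x : tvec M -> R^o) w.
  by rewrite /cx_map !thD.
rewrite cthD (cth_clie Vx DXY DZ) (cth_clie Vx DY DXZ) => /eqP.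
rewrite addr_eq0 => /eqP ->; move: (clie X Z x) (Y x) => w y.
have E a b := ct_om_anti ct x a b.
rewrite /com /cx_bil (E w.1 y.1) (E w.2 y.2) (E w.1 y.2) (E w.2 y.1); congr pair.
  by rewrite /= opprB opprK addrC.
by rewrite /= opprD addrC.
Qed.

(** X - X' is a section of the Levi kernel vanishing at x, so [ct_vanish] applies to each of the
    eight real terms of the complex expression. *)
Lemma com_eql X X' Y Z : csec (fun y => fib (freeman S 1) y) X ->
  csec (fun y => fib (freeman S 1) y) X' -> cvfield_on V Y -> csec DC Z -> X x = X' x ->
  com x (clie X Y x) (Z x) = com x (clie X' Y x) (Z x).
Proof.
move=> [[X1 X2] FX] [[X1' X2'] FX'] [Y1 Y2] [[Z1 Z2] DZ] XX.
have key A A' B D : vfield_on V A -> vfield_on V A' -> vfield_on V B -> vfield_on V D ->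
    (forall y, V y -> om y (A y) (D y) = 0) -> (forall y, V y -> om y (A' y) (D y) = 0) ->
    A x = A' x -> om x (lie A B x) (D x) = om x (lie A' B x) (D x).
  move=> vA vA' vB vD A0 A0' AA.
  have : om x (lie (fun y => A y - A' y) B x) (D x) = 0.
    apply: (ct_vanish ct oV VO Vx) => //.
    - exact: vfield_onB.
    - by move=> z Vz; rewrite omDl omNl A0// A0'// oppr0 addr0.
    - by rewrite AA subrr.
  by rewrite (lieBl oV Vx vA vA' vB) omDl omNl => /eqP; rewrite subr_eq0 => /eqP.
have XX1 : re_vf X x = re_vf X' x by rewrite /re_vf XX.
have XX2 : im_vf X x = im_vf X' x by rewrite /im_vf XX.
have a11 y : V y -> om y (re_vf X y) (re_vf Z y) = 0.
  by move=> Vy; have [D1 D2] := DZ y Vy; exact: om_freeman (VO Vy) (FX y Vy) D1.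
have a12 y : V y -> om y (re_vf X y) (im_vf Z y) = 0.
  by move=> Vy; have [D1 D2] := DZ y Vy; exact: om_freeman (VO Vy) (FX y Vy) D2.
have a21 y : V y -> om y (im_vf X y) (re_vf Z y) = 0.
  by move=> Vy; have [D1 D2] := DZ y Vy; exact: om_freeman2 (VO Vy) (FX y Vy) D1.
have a22 y : V y -> om y (im_vf X y) (im_vf Z y) = 0.
  by move=> Vy; have [D1 D2] := DZ y Vy; exact: om_freeman2 (VO Vy) (FX y Vy) D2.
have b11 y : V y -> om y (re_vf X' y) (re_vf Z y) = 0.
  by move=> Vy; have [D1 D2] := DZ y Vy; exact: om_freeman (VO Vy) (FX' y Vy) D1.
have b12 y : V y -> om y (re_vf X' y) (im_vf Z y) = 0.
  by move=> Vy; have [D1 D2] := DZ y Vy; exact: om_freeman (VO Vy) (FX' y Vy) D2.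
have b21 y : V y -> om y (im_vf X' y) (re_vf Z y) = 0.
  by move=> Vy; have [D1 D2] := DZ y Vy; exact: om_freeman2 (VO Vy) (FX' y Vy) D1.
have b22 y : V y -> om y (im_vf X' y) (im_vf Z y) = 0.
  by move=> Vy; have [D1 D2] := DZ y Vy; exact: om_freeman2 (VO Vy) (FX' y Vy) D2.
have Z1E : (Z x).1 = re_vf Z x by [].
have Z2E : (Z x).2 = im_vf Z x by [].
rewrite /com /cx_bil Z1E Z2E /clie !omDl !omNl.
rewrite (key (re_vf X) (re_vf X') (re_vf Y) (re_vf Z))// (key (im_vf X) (im_vf X') (im_vf Y) (re_vf Z))//.
rewrite (key (re_vf X) (re_vf X') (im_vf Y) (im_vf Z))// (key (im_vf X) (im_vf X') (re_vf Y) (im_vf Z))//.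
rewrite (key (re_vf X) (re_vf X') (re_vf Y) (im_vf Z))// (key (im_vf X) (im_vf X') (im_vf Y) (im_vf Z))//.
by rewrite (key (re_vf X) (re_vf X') (im_vf Y) (re_vf Z))// (key (im_vf X) (im_vf X') (re_vf Y) (re_vf Z)).
Qed.

Lemma com_clie_tensor X X' Y Y' Z Z' : csec (fun y => fib (freeman S 1) y) X ->
  csec (fun y => fib (freeman S 1) y) X' -> csec (D01 S) Y -> csec (D01 S) Y' ->
  csec (D01 S) Z -> csec (D01 S) Z' -> X x = X' x -> Y x = Y' x -> Z x = Z' x ->
  com x (clie X Y x) (Z x) = com x (clie X' Y' x) (Z' x).
Proof.
move=> sX sX' sY sY' sZ sZ' XX YY ZZ.
rewrite (com_eql sX sX' sY.1 (csecW D01_DC sZ) XX).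
by rewrite (com_sym sX' sY sZ) YY -(com_sym sX' sY' sZ) ZZ.
Qed.

End local.

(** Links the cubic form to L^2: in [X, Y] = A + B, the (1,0)-part A represents L^2(X)(Y), and
    [canon_formC] evaluates the bracket with Z. *)
Lemma com_core x pi c X : O x -> core_proj x pi ->
  (forall a b, crD S x a -> crD S x b -> sp_B (pi (-1) a).1.2 (pi (-1) b).1.2 = c * om x a b) ->
  freeman S 1 X -> X x <> 0 ->
  exists2 g : C, g != 0 & forall Y Z, sec01 S Y -> sec01 S Z ->
    let w := com x (clie X Y x) (Z x) in
    g * canon_S t (pi (-1) (Y x).1).1.2 (pi (-1) (Z x).1).1.2 = Complex (c * w.1) (c * w.2).
Proof.
move=> Ox [[piL piG piK] [piJ pib piLL]] H FX X0.
have FXx : fib (freeman S 1) x (X x) by exists X.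
have /D10P[DX1 X2E] := fib_freeman1_D10 FXx.
have [A0 AL] := re_freeman_linear reg 1 x.
have F01 : cr_filt S 0 x (X x).1 by exists (X x).
have F02 : cr_filt S 0 x (X x).2.
  have [F0 FL] := fib_freeman_linear reg 1 x; exists (- imag *: X x + 0); first exact: FL.
  by rewrite addr0 cx_NimagE.
have pi0 p (P0 : cr_filt S p x 0) : pi p 0 = 0.
  by have := piL p (-1) 0 0 P0 P0; rewrite scaleN1r oppr0 addr0 scaleN1r addNr.
have piN p (P0 : cr_filt S p x 0) v : cr_filt S p x v -> pi p (- v) = - pi p v.
  by move=> Pv; have := piL p (-1) v 0 Pv P0; rewrite !scaleN1r addr0 pi0// addr0.
pose v0 : cx (amb m) := cx_map (pi 0) (X x).
have v0m : m10 0 v0.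
  apply/m10P; split.
  - by apply/piG; exists (X x).1.
  - by apply/piG; exists (X x).2.
  - change (cJ (pi 0 (X x).1) = - pi 0 (X x).2).
    rewrite -(piJ 0)// -piN//; congr (pi 0 _); by rewrite X2E opprK.
  - change (cJ (pi 0 (X x).2) = pi 0 (X x).1).
    rewrite -(piJ 0)//; congr (pi 0 _).
    rewrite X2E crJN; last exact: cr_J_stable.
    by rewrite (cr_J_square cr DX1) opprK.
have [g [g0 gE]] := canon_formC v0m.
exists g.
  (* If X x had zero class in m^0, its real part would lie in Re F_1, which is zero by
     [core_dims]. *)
  apply: g0 => -[p1 _]; apply: X0.
  have [_ _ F2 _] := dims x.
  have [z Fz zE] := (piK 0 _ F01).1 p1.
  have z0 := F2 _ Fz; have X10 : (X x).1 = 0 by rewrite -zE z0.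
  by rewrite [X x]surjective_pairing X2E X10 crJ0 oppr0.
move=> Y Z sY sZ w.
have [A [B [FA sB AB]]] := FX.2 Y sY.
have bar01 W : sec01 S W -> cx_map (pi (-1)) (W x) =
    (c1_in (pi (-1) (W x).1).1.2, c1_in (sp_J R *m (pi (-1) (W x).1).1.2)) :> cx (amb m).
  move=> [_ /(_ x)/D01P[DW WE]]; have FW := (crD_fib x _).1 DW.
  have G : pi (-1) (W x).1 \in gr m (-1) by apply/piG; exists (W x).1.
  have [u uE] := (gr1_canon _).1 G.
  by rewrite /cx_map WE (piJ (-1))// uE cJ_c1.
have := gE (pi (-1) (Y x).1).1.2 (pi (-1) (Z x).1).1.2; rewrite -!bar01// scale_c2 /core_form.
have -> : cL 0 v0 (cx_map (pi (-1)) (Y x)) = cx_map (pi (-1)) (A x) := piLL 0%N X Y A B FX sY FA sB AB.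
have sA : D10 S x (A x) by have [_] := FA; exact.
have [_ /(_ x) sBx] := sB; have [_ /(_ x) sZx] := sZ.
(* B and Z are both of type (0,1), so B contributes nothing. *)
have wE : w = com x (A x) (Z x).
  rewrite /w AB; have cD : com x ((A + B) x) (Z x) = com x (A x) (Z x) + com x (B x) (Z x).
    have := @cx_bil_linearl _ _ _ _ (om x : tvec M -> tvec M -> R^o) 1 (A x) (B x) (Z x).
    rewrite !scale1r; apply => k u u' v; exact: (ct_om_linearl ct).
  by rewrite cD (com_D01 Ox sBx sZx) addr0.
have [D1 D2] := D10_DC sA; have [D3 D4] := D01_DC sZx.
have c1E v : crD S x v -> pi (-1) v = c1_in (pi (-1) v).1.2.
  move=> /crD_fib Fv; have G : pi (-1) v \in gr m (-1) by apply/piG; exists v.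
  by have [u uE] := (gr1_canon _).1 G; rewrite uE.
have bE u v : crD S x u -> crD S x v -> cbr (pi (-1) u) (pi (-1) v) = c2_in (c * om x u v).
  by move=> Du Dv; rewrite (c1E u)// (c1E v)// cbr_c1 H.
rewrite wE; move: (g * _) => k E.
have c2I (r s : R) : c2_in r = c2_in s -> r = s by move=> /(congr1 (fun u : ambB R => u.1.1)).
have := congr1 fst E; have := congr1 snd E; rewrite /cx_bil /cx_map /com.
change (cbr (pi (-1) (A x).1) (pi (-1) (Z x).2) + cbr (pi (-1) (A x).2) (pi (-1) (Z x).1)
  = c2_in (complex.Im k) -> cbr (pi (-1) (A x).1) (pi (-1) (Z x).1) - cbr (pi (-1) (A x).2) (pi (-1) (Z x).2)
  = c2_in (complex.Re k) -> k = Complex (c * (om x (A x).1 (Z x).1 - om x (A x).2 (Z x).2))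
    (c * (om x (A x).1 (Z x).2 + om x (A x).2 (Z x).1))).
rewrite !bE// -c2_inN -!c2_inD => /c2I E2 /c2I E1.
by apply: eqC; [rewrite -E1|rewrite -E2] => /=; ring.
Qed.

End chart.

End levi.

(** * Invariance under local diffeomorphisms *)

Section transport.
Context (R : realType) (t t' : R) (M M' : manifold R 7) (S : crData M) (S' : crData M').
Hypotheses (t01 : 0 <= t <= 1) (t'01 : 0 <= t' <= 1).
Hypotheses (Sreg : strongly_regular S (canon_core t)) (S'reg : strongly_regular S' (canon_core t')).
Context (U : set M) (U' : set M') (phi : M -> M') (psi : M' -> M).
Hypothesis LD : local_diffeo U U' phi psi.
Hypothesis phiD : forall x, U x ->
    [set tangent_map phi v | v in crD S x] = crD S' (phi x) /\
    (forall v, crD S x v ->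
       tangent_map phi (crJ S x v) = crJ S' (phi x) (tangent_map phi v)).
Let t0 : 0 <= t. Proof. by case/andP: t01. Qed.
Let t'0 : 0 <= t'. Proof. by case/andP: t'01. Qed.
Local Notation C := (R[i]).
Local Notation psi_ := (tangent_map psi).
Local Notation pb := (pullback phi psi).

Lemma psi_D x v : U x -> crD S' (phi x) v -> crD S x (psi_ v) /\ psi_ (crJ S' (phi x) v) = crJ S x (psi_ v).
Proof.
move=> Ux; have [<- JE] := phiD Ux; move=> [u Du <-].
have tu : tangent x u by exact: (crD_tangent Sreg.1 Du).
have tJ : tangent x (crJ S x u).
  by apply: (crD_tangent Sreg.1); exact: cr_J_stable (reg_cr Sreg.1) _ _ Du.
by rewrite -JE// !(tangent_mapK LD Ux).
Qed.

Lemma psi_D_onto x v : U x -> crD S x v -> exists2 u, crD S' (phi x) u & psi_ u = v.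
Proof.
move=> Ux Dv; have [E _] := phiD Ux.
exists (tangent_map phi v); first by rewrite -E; exists v.
by rewrite (tangent_mapK LD Ux)//; exact: (crD_tangent Sreg.1 Dv).
Qed.

Lemma psi_D_inv x v : U x -> tangent (phi x) v -> crD S x (psi_ v) -> crD S' (phi x) v.
Proof.
move=> Ux tv Dv; have [E _] := phiD Ux.
have <- : tangent_map phi (psi_ v) = v.
  have LD' := local_diffeo_sym LD.
  by rewrite (tangent_mapK LD' (ld_maps LD Ux)).
by rewrite -E; exists (psi_ v).
Qed.

Lemma psi_inj x v : U x -> tangent (phi x) v -> psi_ v = 0 -> v = 0.
Proof.
move=> Ux tv v0; rewrite -(tangent_mapK (local_diffeo_sym LD) (ld_maps LD Ux) tv) v0.
by apply/funext.
Qed.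

Lemma psi_D01 x z : U x -> D01 S' (phi x) z -> D01 S x (cx_map psi_ z).
Proof.
move=> Ux /(D01P S'reg)[Dz Ez]; apply/(D01P Sreg); rewrite /cx_map /= Ez.
by have [] := psi_D Ux Dz.
Qed.

Lemma psiN v : psi_ (- v) = - psi_ v. Proof. by []. Qed.

Lemma psi_D10 x z : U x -> D10 S' (phi x) z -> D10 S x (cx_map psi_ z).
Proof.
move=> Ux /(D10P S'reg)[Dz Ez]; apply/(D10P Sreg); rewrite /cx_map /= Ez psiN.
by have [? ->] := psi_D Ux Dz.
Qed.

Lemma contact_chart_at (N : manifold R 7) (T : crData N) s x : 0 <= s ->
  strongly_regular T (canon_core s) ->
  exists O th om, O x /\ contact_chart (crD T) O th om.
Proof.
move=> s0 Treg; have [_ _ _ [r dr r6]] := core_dims Treg.1 (canon_typeB s0) (Treg.2 x).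
by subst r; exact: contact_exists.
Qed.

Definition cpb (X : M' -> cx (tvec M')) : M -> cx (tvec M) := fun x => cx_map psi_ (X (phi x)).

Lemma cpb_cvfield X : cvfield_on setT X -> cvfield_on U (cpb X).
Proof. by move=> [X1 X2]; split; [exact: (vfield_pullback LD X1)|exact: (vfield_pullback LD X2)]. Qed.

Lemma cpb_clie X Y x : U x -> cvfield_on setT X -> cvfield_on setT Y ->
  clie (cpb X) (cpb Y) x = cx_map psi_ (clie X Y (phi x)).
Proof.
move=> Ux [X1 X2] [Y1 Y2].
have LP A B : vfield_on setT A -> vfield_on setT B -> lie (fun z => psi_ (A (phi z))) (fun z => psi_ (B (phi z))) x = psi_ (lie A B (phi x)) by exact: (lie_pullback LD Ux).
rewrite /clie (_ : re_vf (cpb X) = fun z => psi_ (re_vf X (phi z)))// (_ : im_vf (cpb X) = fun z => psi_ (im_vf X (phi z)))//.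
rewrite (_ : re_vf (cpb Y) = fun z => psi_ (re_vf Y (phi z)))// (_ : im_vf (cpb Y) = fun z => psi_ (im_vf Y (phi z)))//.
by rewrite (LP _ _ X1 Y1) (LP _ _ X2 Y2) (LP _ _ X1 Y2) (LP _ _ X2 Y1).
Qed.

(** The pulled-back section is only local, so membership is checked through the Levi kernel: om(psi
    X, v) is th of the image of a commutator that lies in D. *)
Lemma psi_freeman1 X x : U x -> freeman S' 1 X -> fib (freeman S 1) x (cx_map psi_ (X (phi x))).
Proof.
move=> Ux FX; have [W [th [om [Wx ct]]]] := contact_chart_at x t0 Sreg.
have FXx : fib (freeman S' 1) (phi x) (X (phi x)) by exists X.
have sX := freeman_sec10 FX.
have TX : tanaka S' 0 (re_vf X) by exact: sec10_re.
apply: (freeman1_of_levi t0 Sreg ct Wx).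
  by apply: psi_D10 => //; exact: fib_freeman1_D10.
move=> v Dv; have [u Du uE] := psi_D_onto Ux Dv.
have [Y TY YE] := crD_section t'0 S'reg Du.
have Dl := freeman1_lie t'0 S'reg (phi x) FX TY.
pose V := U `&` W.
have oV : open V by apply: openI; [exact: ld_open LD|exact: ct_open ct].
have VO : V `<=` W by exact: subIsetr.
have vX : vfield_on V (pb (re_vf X)).
  by apply: vfield_on_sub (vfield_pullback LD TX.1); exact: subIsetl.
have vY : vfield_on V (pb Y).
  by apply: vfield_on_sub (vfield_pullback LD TY.1); exact: subIsetl.
have DX z : V z -> crD S z (pb (re_vf X) z).
  by move=> [Uz _]; have [] := psi_D Uz (TX.2 (phi z)).
have DY z : V z -> crD S z (pb Y z).
  by move=> [Uz _]; have [] := psi_D Uz (TY.2 (phi z)).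
have Vx : V x by [].
have := ct_lie ct oV VO Vx vX vY DX DY.
rewrite (lie_pullback LD Ux TX.1 TY.1).
have [Dp _] := psi_D Ux Dl.
have tp : tangent x (psi_ (lie (re_vf X) Y (phi x))) by exact: (crD_tangent Sreg.1 Dp).
by rewrite ((ct_ker ct Wx tp).1 Dp) /pullback YE uE => /esym.
Qed.

(** On D at y = phi x there are two coordinate systems with values in c^{-1}: that of the core at y,
    and that of the core at x after applying psi. [canon_S_unique] compares them. *)
Lemma parameter_invariant x : U x -> t' = t.
Proof.
move=> Ux; set y := phi x.
have [W [th [om [Wx ct]]]] := contact_chart_at x t0 Sreg.
have [W' [th' [om' [Wy ct']]]] := contact_chart_at y t'0 S'reg.
have [pi cp] := core_projP Sreg x; have [pi' cp'] := core_projP S'reg y.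
have [c c0 H] := levi_core t0 Sreg ct Wx cp.
have [c' c'0 H'] := levi_core t'0 S'reg ct' Wy cp'.
have [[piL piG piK] [piJ pib piLL]] := cp.
have [[piL' piG' piK'] [piJ' pib' piLL']] := cp'.
have oV : open (U `&` W) by apply: openI; [exact: ld_open LD|exact: ct_open ct].
have VO : U `&` W `<=` W by exact: subIsetr.
have VU : U `&` W `<=` U by exact: subIsetl.
have Vx : (U `&` W) x by [].
(* th' and the pullback of th along psi have the same kernel D, a hyperplane, so they are
   proportional; k is read off on a vector u1 outside D. *)
have [k k0 kE] : exists2 k : R, k != 0 & forall u, tangent y u -> th' y u = k * th x (psi_ u).
  have c2gr : c2_in 1 \in gr (canon_core t') (-2) by apply/gr2_canon; exists 1.
  have [u1 F1 u1E] := (piG' (-2) (c2_in 1)).1 c2gr.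
  have tu1 : tangent y u1 by exact: (fib_tanaka_tangent S'reg.1 F1).
  have N1 : ~ crD S' y u1.
    move=> /(crD_fib t'0 S'reg) D1.
    have := (piK' (-2) _ F1).2 D1; rewrite u1E => /(congr1 (fun u : ambB R => u.1.1)) /= /eqP.
    by rewrite oner_eq0.
  have th'1 : th' y u1 != 0 by apply/eqP => /(ct_ker ct' Wy tu1).
  have tp u : tangent y u -> tangent x (psi_ u) by exact: (tangent_pullback LD Ux).
  have th1 : th x (psi_ u1) != 0.
    by apply/eqP => /(ct_ker ct Wx (tp _ tu1))/(psi_D_inv Ux tu1).
  exists (th' y u1 / th x (psi_ u1)); first by rewrite mulf_neq0 ?invr_eq0.
  move=> u tu; pose l := th' y u / th' y u1.
  have tl : tangent y (- l *: u1 + u) by exact: tangent_linear.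
  have : crD S' y (- l *: u1 + u).
    by apply/(ct_ker ct' Wy tl); rewrite (thD ct') (thZ ct') /l mulNr divfK// addNr.
  move=> /(psi_D Ux)[+ _] => /(ct_ker ct Wx (tp _ tl)).
  rewrite tangent_map_linear (thD ct) (thZ ct) => E.
  have -> : th x (psi_ u) = l * th x (psi_ u1) by lra.
  by rewrite /l; field; rewrite th1 th'1.
have omE a b : crD S' y a -> crD S' y b -> om' y a b = k * om x (psi_ a) (psi_ b).
  move=> Da Db; have [A TA AE] := crD_section t'0 S'reg Da; have [B TB BE] := crD_section t'0 S'reg Db.
  have tl : tangent y (lie A B y) by exact: tangent_lie openT I TA.1 TB.1.
  have -> : om' y a b = th' y (lie A B y).
    rewrite -AE -BE; apply/esym/(ct_lie ct' (ct_open ct')) => //.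
    - exact: vfield_on_sub (@subsetT _ _) TA.1.
    - exact: vfield_on_sub (@subsetT _ _) TB.1.
    - by move=> z _; exact: TA.2.
    - by move=> z _; exact: TB.2.
  rewrite kE// -(lie_pullback LD Ux TA.1 TB.1); congr (_ * _).
  rewrite (ct_lie ct oV VO Vx (X := pb A) (Y := pb B)).
  - by rewrite /pullback -/y AE BE.
  - by apply: vfield_on_sub (vfield_pullback LD TA.1).
  - by apply: vfield_on_sub (vfield_pullback LD TB.1).
  - by move=> z /VU Uz; have [] := psi_D Uz (TA.2 (phi z)).
  - by move=> z /VU Uz; have [] := psi_D Uz (TB.2 (phi z)).
have [X' FX' X'0] : exists2 X', freeman S' 1 X' & X' y <> 0.
  have [_ _ d0 _] := canon_typeB t'0.
  have un0 : vpick (gr (canon_core t') 0) != 0 by rewrite vpick0 -dimv_eq0 d0.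
  have [v [z [X' FX' XE] zE] vE] := (piG' 0 _).1 (memv_pick (gr (canon_core t') 0)).
  exists X' => // X0; case/eqP: un0; rewrite -vE -zE -XE X0.
  have [A0 AL] := re_freeman_linear S'reg.1 1 y.
  by have := piL' 0 (-1) 0 0 A0 A0; rewrite scaler0 addr0 scaleN1r addNr.
(* A global Freeman section on M with the same value at x as the pullback of X'; the structure of
   the core at x can be applied to X, not to the pullback. *)
have [X FX XE] := psi_freeman1 Ux FX'.
have DX' := fib_freeman1_D10 (ex_intro2 _ _ X' FX' erefl : fib (freeman S' 1) y (X' y)).
have X0 : X x <> 0.
  rewrite XE => E; apply: X'0; have /(D10P S'reg)[D1 E2] := DX'.
  have z1 : (X' y).1 = 0.
    apply: (psi_inj Ux); first exact: (crD_tangent S'reg.1 D1).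
    exact: (congr1 fst E).
  by rewrite [X' y]surjective_pairing E2 z1 (crJ0 S'reg) oppr0.
have [g g0 gE] := com_core t0 Sreg ct Wx cp H FX X0.
have [g' g'0 gE'] := com_core t'0 S'reg ct' Wy cp' H' FX' X'0.
have lamN0 : c / (k * c') != 0 by rewrite mulf_neq0 ?invr_eq0 ?mulf_neq0.
have nC (u : R) : u != 0 -> Complex u 0 != 0 :> C by apply: contra => /eqP[->].
have muN0 : g' / g * Complex (c / (k * c')) 0 != 0 by rewrite !mulf_neq0 ?invr_eq0// nC.
(* Write w for the cubic form at x. Then om' = k om and the relations g S = c w, g' S' = c' k w give
   the factor c / (k c') for B and (g' / g)(c / (k c')) for the symmetric form. *)
apply: (@canon_S_unique _ t' t (c / (k * c')) _ _ (crD S' y)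
  (fun a => (pi' (-1) a).1.2) (fun a => (pi (-1) (psi_ a)).1.2)) lamN0 muN0 _ _ _ _ => //.
- move=> v; have Gv : c1_in v \in gr (canon_core t') (-1) by apply/gr1_canon; exists v.
  have [a /(crD_fib t'0 S'reg) Da aE] := (piG' (-1) _).1 Gv.
  by exists a => //; rewrite aE.
- move=> a Da; have Ja := cr_J_stable (reg_cr S'reg.1) Da; exists (crJ S' y a); split=> //.
    by rewrite (piJ' (-1))//; exact/(crD_fib t'0 S'reg).
  have [Dp ->] := psi_D Ux Da.
  by rewrite (piJ (-1))//; exact/(crD_fib t0 Sreg).
- move=> a b Da Db; have [Dpa _] := psi_D Ux Da; have [Dpb _] := psi_D Ux Db.
  by rewrite H// H'// omE//; field; rewrite k0 c'0.
move=> a b Da Db; have [Dpa Jpa] := psi_D Ux Da; have [Dpb Jpb] := psi_D Ux Db.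
have [Y' sY' Y'E] := sec01_section t'0 S'reg Da; have [Z' sZ' Z'E] := sec01_section t'0 S'reg Db.
have [Y sY YE] := sec01_section t0 Sreg Dpa; have [Z sZ ZE] := sec01_section t0 Sreg Dpb.
have e1 := gE _ _ sY sZ; have e2 := gE' _ _ sY' sZ'.
rewrite YE ZE in e1; cbn beta iota zeta delta [fst] in e1.
rewrite Y'E Z'E in e2; cbn beta iota zeta delta [fst] in e2.
(* The global triple on M and the pulled-back triple agree at x only; tensoriality over U and W
   identifies their cubic forms. *)
have tens : com om x (clie X Y x) (Z x) = com om x (clie (cpb X') (cpb Y') x) (cpb Z' x).
  apply: (com_clie_tensor t0 Sreg ct oV VO Vx).
  - split; last by move=> z _; exists X.
    by have [[v1 v2] _] := freeman_sec10 FX; split; apply: vfield_on_sub (@subsetT _ _) _.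
  - split; last by move=> z /VU Uz; exact: psi_freeman1.
    have [v12 _] := freeman_sec10 FX'; have [w1 w2] := cpb_cvfield v12.
    by split; exact: vfield_on_sub VU _.
  - by have [[v1 v2] DY] := sY; split=> //; split; apply: vfield_on_sub (@subsetT _ _) _.
  - have [v12 DY] := sY'; have [w1 w2] := cpb_cvfield v12.
    split; first by split; exact: vfield_on_sub VU _.
    by move=> z /VU Uz; exact: psi_D01.
  - by have [[v1 v2] DY] := sZ; split=> //; split; apply: vfield_on_sub (@subsetT _ _) _.
  - have [v12 DY] := sZ'; have [w1 w2] := cpb_cvfield v12.
    split; first by split; exact: vfield_on_sub VU _.
    by move=> z /VU Uz; exact: psi_D01.
  - exact: XE.
  - by rewrite YE /cpb -/y Y'E /cx_map /= Jpa.
  - by rewrite ZE /cpb -/y Z'E /cx_map /= Jpb.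
(* [omE] relates om' to om on D only, so the commutator has first to be placed there; the Freeman
   decomposition A + B does this. *)
have DC' : DC S' y (clie X' Y' y).
  have [A [B [FA sB ->]]] := FX'.2 Y' sY'.
  have [A1 A2] := D10_DC (FA.2 y); have [B1 B2] := D01_DC S'reg (sB.2 y).
  by split; exact: (crDD S'reg).
have DZ' := D01_DC S'reg (sZ'.2 y).
have comE : com om' y (clie X' Y' y) (Z' y) =
    (k * (com om x (clie X Y x) (Z x)).1, k * (com om x (clie X Y x) (Z x)).2) :> cx R^o.
  rewrite tens cpb_clie//; last 2 first.
  - by have [] := freeman_sec10 FX'.
  - by have [] := sY'.
  case: DC' => [D1 D2]; case: DZ' => [D3 D4].
  by rewrite /com /cx_bil !omE// -mulrBr -mulrDr.
rewrite Z'E ZE in comE; rewrite comE in e2; cbn beta iota zeta delta [fst snd] in e2.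
move: e1 e2; move: (com om x _ _) (canon_S t _ _) (canon_S t' _ _) => w s s' e1 e2.
apply: (mulfI g0); rewrite e1.
transitivity (Complex (c / (k * c')) 0 * (g' * s')); last by field.
rewrite e2; apply: eqC => /=; field; by rewrite k0 c'0.
Qed.

End transport.

Lemma not_locally_diffeo (R : realType) (t t' : R) (M M' : manifold R 7) (S : crData M) (S' : crData M') :
  0 <= t <= 1 -> 0 <= t' <= 1 -> t <> t' ->
  strongly_regular S (canon_core t) -> strongly_regular S' (canon_core t') ->
  ~ locally_cr_diffeo S S'.
Proof.
move=> t01 t'01 tt' Sreg S'reg [U [U' [phi [psi [oU oU' [x Ux] [[h1 h2 h3 h4] h5]]]]]].
have LD : local_diffeo U U' phi psi.
  by split=> // z; [case/h1|case/h2|case/h1|case/h2].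
by apply: tt'; apply/esym; exact: (parameter_invariant t01 t'01 Sreg S'reg LD h5 Ux).
Qed.

Theorem theorem4p9 (R : realType) :
  [/\ forall m : coreData R,
        abstract_core m -> core_dim m 7 -> type_B m -> core_signature m 2 0 ->
        [/\ forall p : int, p \notin [:: -2; -1; 0] -> gr m p = 0%VS,
            exists q : cx 'M[R]_4, [/\ S2c10 q, q != 0 & core_iso m (coreB q)]
          & exists! t : R, (0 <= t <= 1) /\ core_iso m (canon_core t)],
      forall t : R, 0 <= t <= 1 ->
        [/\ abstract_core (canon_core t), core_dim (canon_core t) 7, type_B (canon_core t)
          & core_signature (canon_core t) 2 0],
      forall (t : R) (M : manifold R 7) (S : crData M), 0 <= t <= 1 ->
        strongly_regular S (canon_core t) -> nondegenerate_CR S 2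
    & forall (t t' : R) (M M' : manifold R 7) (S : crData M) (S' : crData M'),
        0 <= t <= 1 -> 0 <= t' <= 1 -> t <> t' ->
        strongly_regular S (canon_core t) -> strongly_regular S' (canon_core t') ->
        ~ locally_cr_diffeo S S'].
Proof.
split=> [m mA m7 mB sig|t t01|t M S /andP[t0 _]|t t' M M' S S'].
- split=> [p|| ].
  + rewrite !inE !negb_or => /and3P[p2 p1 p0]; have [_ _ _ H] := mB.
      exact: H.
  + have [t [/andP[t0 _] iso]] := normal_form_exists mA m7 mB sig.
    by exists (canon_gen t); split; [exact: canon_gen_S2|exact: canon_gen_neq0|].
  have [t [t01 iso]] := normal_form_exists mA m7 mB sig.
  exists t; split=> [//|t' [t'01 iso']].
  exact: core_iso_unique mA mB t01 t'01 iso iso'.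
- have /andP[t0 _] := t01.
  by split; [exact: canon_abstract|exact: canon_dim|exact: canon_typeB|exact: canon_signature].
- exact: nondegenerate.
exact: not_locally_diffeo.
Qed.
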